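(* Let $\underline J=(A_0\xleftarrow{p_1}J_1\xrightarrow{q_1}\cdots\xleftarrow{p_n}J_n\xrightarrow{q_n}A_n)$ be an iterated span of split two-sided $2$-fibrations $J_m\colon A_{m-1}\nrightarrow A_m$ of length $n\ge1$, let $K=[C\xleftarrow{p}K\xrightarrow{q}D]$ be a split two-sided $2$-fibration and let $f\colon A_0\to C$, $g\colon A_n\to D$ be $2$-functors. Unary cells $\phi\colon(J_1,\dots,J_n)\Rightarrow K$ along $f$ and $g$ in $\mathsf{SpTwo2Fib}$ correspond precisely to $2$-functors $\phi\colon J_1\times_{A_1}\cdots\times_{A_{n-1}}J_n\to K$ over $f$ and $g$ that satisfy: (pcm) $\phi(\lambda_{p_1}(u,i_1),\mathrm{id}_{i_2},\dots,\mathrm{id}_{i_n})=\lambda_p(fu,\phi(i_1,\dots,i_n))$ for any object $(i_1,\dots,i_n)$ of $\prod\underline J$ and $u\colon a\to p_1i_1$ in $A_0$; (poc) $\phi(\lambda_{p_1}(s_1,\alpha),\mathrm{id}_{s_2},\dots,\mathrm{id}_{s_n})=\lambda_p(\phi(s_1,\dots,s_n),f\alpha)$ for any morphism $(s_1,\dots,s_n)$ of $\prod\underline J$ and $\alpha\colon p_1s_1\Rightarrow u$ in $A_0$; (iem) for any $1\le m<n$, objects $(i_1,\dots,i_m)$ in $\prod(J_1,\dots,J_m)$ and $(i_{m+1},\dots,i_n)$ in $\prod(J_{m+1},\dots,J_n)$, and $u\colon q_mi_m\to p_{m+1}i_{m+1}$ in $A_m$, the morphism $\phi(\mathrm{id}_{i_1},\dots,\mathrm{id}_{i_{m-1}},\rho_{q_m}(i_m,u),\lambda_{p_{m+1}}(u,i_{m+1}),\mathrm{id}_{i_{m+2}},\dots,\mathrm{id}_{i_n})$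 is an identity morphism; (iec) for any $1\le m<n$, morphisms $(s_1,\dots,s_m)$ in $\prod(J_1,\dots,J_m)$ and $(s_{m+1},\dots,s_n)$ in $\prod(J_{m+1},\dots,J_n)$, and $\alpha\colon p_{m+1}s_{m+1}\Rightarrow q_ms_m$ in $A_m$, the cell $\phi(\mathrm{id}_{s_1},\dots,\mathrm{id}_{s_{m-1}},\rho_{q_m}(\alpha,s_m),\lambda_{p_{m+1}}(s_{m+1},\alpha),\mathrm{id}_{s_{m+2}},\dots,\mathrm{id}_{s_n})$ is an identity cell; (pom) $\phi(\mathrm{id}_{i_1},\dots,\mathrm{id}_{i_{n-1}},\rho_{q_n}(i_n,v))=\rho_q(\phi(i_1,\dots,i_n),gv)$ for any object $(i_1,\dots,i_n)$ of $\prod\underline J$ and $v\colon q_ni_n\to b$ in $A_n$; (pcc) $\phi(\mathrm{id}_{s_1},\dots,\mathrm{id}_{s_{n-1}},\rho_{q_n}(\beta,s_n))=\rho_q(g\beta,\phi(s_1,\dots,s_n))$ for any morphism $(s_1,\dots,s_n)$ of $\prod\underline J$ and $\beta\colon u\Rightarrow q_ns_n$ in $A_n$.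
   Context: All $2$-categories are large. $\odot$ denotes composition of cells along a morphism, in diagrammatic order; $\circ$ denotes composition of morphisms, horizontal composition and whiskering. All pullbacks are strict. **Lax arrow $2$-category.** $A^{\mathbf 2}$ has objects $(a,u,b)$ with $u\colon a\to b$; morphisms $(s,\zeta,t)\colon(a_0,u_0,b_0)\to(a_1,u_1,b_1)$ with $s\colon a_0\to a_1$, $t\colon b_0\to b_1$, $\zeta\colon t\circ u_0\Rightarrow u_1\circ s$; cells $(\sigma\colon s_0\Rightarrow s_1,\tau\colon t_0\Rightarrow t_1)$ with $\zeta_0\odot(u_1\circ\sigma)=(\tau\circ u_0)\odot\zeta_1$; projections $\mathrm{src},\mathrm{tgt}\colon A^{\mathbf 2}\to A$. Unit $\tilde\alpha\colon A\to A^{\mathbf 2}$: $a\mapsto(a,\mathrm{id}_a,a)$, $s\mapsto(s,\mathrm{id}_s,s)$, $\sigma\mapsto(\sigma,\sigma)$. Composition $\bar\alpha\colon A^{\mathbf 2}\times_AA^{\mathbf 2}\to A^{\mathbf 2}$: $(a,u,b,v,c)\mapsto(a,v\circ u,c)$, $(r,\zeta,s,\eta,t)\mapsto(r,(\eta\circ u_0)\odot(v_1\circ\zeta),t)$, $(\rho,\sigma,\tau)\mapsto(\rho,\tau)$. A $2$-functor $f\colon A\to C$ induces $f^{\mathbf 2}\colon A^{\mathbf 2}\to C^{\mathbf 2}$ entrywise. **Split two-sided $2$-fibrations.** A split two-sided $2$-fibration $J\colon A\nrightarrow B$ is a span $A\xleftarrow{p}J\xrightarrow{q}B$ of $2$-functors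 with $2$-functors $\lambda\colon A^{\mathbf 2}\times_AJ\to J$ (pullback of $\mathrm{tgt}$ and $p$) and $\rho\colon J\times_BB^{\mathbf 2}\to J$ (pullback of $q$ and $\mathrm{src}$) such that $p\lambda(x,i)=\mathrm{src}\,x$, $q\lambda(x,i)=qi$, $p\rho(i,y)=pi$, $q\rho(i,y)=\mathrm{tgt}\,y$ (on objects, morphisms and cells), $\lambda\circ(\bar\alpha\times\mathrm{id})=\lambda\circ(\mathrm{id}\times\lambda)$, $\lambda\circ(\tilde\alpha p,\mathrm{id}_J)=\mathrm{id}_J$, $\rho\circ(\mathrm{id}\times\bar\beta)=\rho\circ(\rho\times\mathrm{id})$, $\rho\circ(\mathrm{id}_J,\tilde\beta q)=\mathrm{id}_J$, $\rho\circ(\lambda\times\mathrm{id})=\lambda\circ(\mathrm{id}\times\rho)$. Associated cleavages ($\lambda_p$ for $p$, $\rho_q$ for $q$): for $v\colon qi\to b$, $v_!i:=\rho(i,(qi,v,b))$ and $\rho_q(i,v):=\rho(\mathrm{id}_i,(\mathrm{id}_{qi},\mathrm{id}_v,v))\colon i\to v_!i$; for $s\colon i\to j$ in $J$ and $\beta\colon u\Rightarrow qs$, $\beta^*s:=\rho(s,(qs,\beta,u))\colon i\to j$ and $\rho_q(\beta,s):=\rho(\mathrm{id}_s,(\mathrm{id}_{qs},\beta))\colon\beta^*s\Rightarrow s$; for $u\colon a\to pi$, $u^*i:=\lambda((a,u,pi),i)$ and $\lambda_p(u,i):=\lambda((u,\mathrm{id}_u,\mathrm{id}_{pi}),\mathrm{id}_i)\colon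 u^*i\to i$; for $\alpha\colon ps\Rightarrow v$, $\alpha_!s:=\lambda((v,\alpha,ps),s)$ and $\lambda_p(s,\alpha):=\lambda((\alpha,\mathrm{id}_{ps}),\mathrm{id}_s)\colon s\Rightarrow\alpha_!s$. (Equivalently, $p$ is a split co-$2$-fibration with cleavage $\lambda_p$ and $q$ a split op-$2$-fibration with cleavage $\rho_q$, suitably compatible.) **Unary cells.** $\prod\underline J:=J_1\times_{A_1}\cdots\times_{A_{n-1}}J_n$, and likewise for subpaths. A unary cell $(J_1,\dots,J_n)\Rightarrow K$ along $f,g$ in $\mathsf{SpTwo2Fib}$ ($n\ge1$) is a $2$-functor $\phi\colon\prod\underline J\to K$ over $f$ and $g$ (i.e. $p\phi=fp_1\pi_{J_1}$, $q\phi=gq_n\pi_{J_n}$) satisfying the equivariance axioms, as equalities of $2$-functors: $\phi(\lambda(x,i_1),i_2,\dots,i_n)=\lambda_K(f^{\mathbf 2}x,\phi(i_1,\dots,i_n))$ on $A_0^{\mathbf 2}\times_{A_0}\prod\underline J$; $\phi(i_1,\dots,i_{n-1},\rho(i_n,y))=\rho_K(\phi(i_1,\dots,i_n),g^{\mathbf 2}y)$ on $\prod\underline J\times_{A_n}A_n^{\mathbf 2}$; and for $1\le m<n$, $\phi(\dots,\rho(i_m,x),i_{m+1},\dots)=\phi(\dots,i_m,\lambda(x,i_{m+1}),\dots)$ on $\prod(J_1,\dots,J_m)\times_{A_m}A_m^{\mathbf 2}\times_{A_m}\prod(J_{m+1},\dots,J_n)$. *)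

(* Defs.v *)
From mathcomp Require Import all_boot.
From Stdlib Require Import FunctionalExtensionality ProofIrrelevance.
From Stdlib Require Import ClassicalEpsilon.

Set Implicit Arguments.
Unset Strict Implicit.
Unset Printing Implicit Defensive.

(* Strict 2-categories are presented by their sets of objects, morphisms and  *)
(* cells, with source/target functions and partial compositions: objects,     *)
(* morphisms and cells with varying boundaries can then be compared by plain  *)
(* equality, which is what strict pullbacks and equalities of 2-functors need.*)
(* Every composite takes a proof of composability; since such proofs are      *)
(* irrelevant, axioms are stated for arbitrary ones.                          *)
(* A 2-category consists of three category structures: [cat1] (composition of *)
(* morphisms), [catv] (vertical composition of cells, along a morphism) and   *)
(* [cath] (horizontal composition of cells, along an object).                 *)

Record cat_on (O M : Type) := CatOn {
  cdom : M -> O;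
  ccod : M -> O;
  cid : O -> M;
  ccomp : forall g f : M, ccod f = cdom g -> M;
  cdom_id : forall a, cdom (cid a) = a;
  ccod_id : forall a, ccod (cid a) = a;
  cdom_comp : forall g f h, cdom (@ccomp g f h) = cdom f;
  ccod_comp : forall g f h, ccod (@ccomp g f h) = ccod g;
  ccomp_idl : forall f h, @ccomp (cid (ccod f)) f h = f;
  ccomp_idr : forall f h, @ccomp f (cid (cdom f)) h = f;
  ccompA : forall k g f e1 e2 e3 e4,
    @ccomp k (@ccomp g f e1) e2 = @ccomp (@ccomp k g e3) f e4
}.

Inductive level := Ob | Mor | Cel.

Record two_cat := TwoCat {
  cells :> level -> Type;
  cat1 : cat_on (cells Ob) (cells Mor);
  catv : cat_on (cells Mor) (cells Cel);
  cath : cat_on (cells Ob) (cells Cel);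
  hdom_vdom : forall x, cdom cath x = cdom cat1 (cdom catv x);
  hdom_vcod : forall x, cdom cath x = cdom cat1 (ccod catv x);
  hcod_vdom : forall x, ccod cath x = ccod cat1 (cdom catv x);
  hcod_vcod : forall x, ccod cath x = ccod cat1 (ccod catv x);
  hid_vid : forall a, cid cath a = cid catv (cid cat1 a);
  hcomp_vid : forall t s e e',
    @ccomp _ _ cath (cid catv t) (cid catv s) e
    = cid catv (@ccomp _ _ cat1 t s e');
  vdom_hcomp : forall y x e e',
    cdom catv (@ccomp _ _ cath y x e)
    = @ccomp _ _ cat1 (cdom catv y) (cdom catv x) e';
  vcod_hcomp : forall y x e e',
    ccod catv (@ccomp _ _ cath y x e)
    = @ccomp _ _ cat1 (ccod catv y) (ccod catv x) e';
  interchange : forall y' y x' x e1 e2 e3 e4 e5 e6,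
    @ccomp _ _ cath (@ccomp _ _ catv y' y e1) (@ccomp _ _ catv x' x e2) e3
    = @ccomp _ _ catv (@ccomp _ _ cath y' x' e4) (@ccomp _ _ cath y x e5) e6
}.

Notation dom := (cdom (cat1 _)).
Notation cod := (ccod (cat1 _)).
Notation id1 := (cid (cat1 _)).
Notation comp1 t s e := (@ccomp _ _ (cat1 _) t s e).
Notation src2 := (cdom (catv _)).
Notation tgt2 := (ccod (catv _)).
Notation id2 := (cid (catv _)).
(* Vertical composition, in diagrammatic order: first [x], then [y]. *)
Notation vcomp x y e := (@ccomp _ _ (catv _) y x e).
Notation hcomp y x e := (@ccomp _ _ (cath _) y x e).
Notation whiskl u x e := (hcomp (id2 u) x e).
Notation whiskr y u e := (hcomp y (id2 u) e).

Record is_functor (O M O' M' : Type) (X : cat_on O M) (Y : cat_on O' M')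
    (F0 : O -> O') (F1 : M -> M') : Prop := IsFunctor {
  is_fdom : forall f, cdom Y (F1 f) = F0 (cdom X f);
  is_fcod : forall f, ccod Y (F1 f) = F0 (ccod X f);
  is_fid : forall a, F1 (cid X a) = cid Y (F0 a);
  is_fcomp : forall g f e e', F1 (@ccomp _ _ X g f e) = @ccomp _ _ Y (F1 g) (F1 f) e'
}.

Record two_functor (A B : two_cat) := TwoFunctor {
  fmap :> forall k, A k -> B k;
  functor1 : is_functor (cat1 A) (cat1 B) (@fmap Ob) (@fmap Mor);
  functorv : is_functor (catv A) (catv B) (@fmap Mor) (@fmap Cel);
  functorh : is_functor (cath A) (cath B) (@fmap Ob) (@fmap Cel)
}.
Arguments fmap {A B} _ k _.

Lemma sig_eq (T : Type) (P : T -> Prop) (x y : {t | P t}) :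
  proj1_sig x = proj1_sig y -> x = y.
Proof.
case: x y => [x Px] [y Py] /= e; case: y / e Py => Py.
by rewrite (proof_irrelevance _ Px Py).
Qed.

Lemma ccomp_eq (O M : Type) (X : cat_on O M) g g' f f' e e' :
  g = g' -> f = f' -> @ccomp _ _ X g f e = @ccomp _ _ X g' f' e'.
Proof.
by move=> eg ef; case: g' / eg e' => e'; case: f' / ef e' => e';
  rewrite (proof_irrelevance _ e e').
Qed.

(* Products and sub-2-categories. *)

Definition prod_cat O M O' M' (X : cat_on O M) (Y : cat_on O' M') :
  cat_on (O * O') (M * M').
Proof.
refine (@CatOn (O * O') (M * M')
  (fun f => (cdom X f.1, cdom Y f.2)) (fun f => (ccod X f.1, ccod Y f.2))
  (fun a => (cid X a.1, cid Y a.2))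
  (fun g f e => (@ccomp _ _ X g.1 f.1 (f_equal fst e),
                 @ccomp _ _ Y g.2 f.2 (f_equal snd e))) _ _ _ _ _ _ _).
- by case=> *; rewrite !cdom_id.
- by case=> *; rewrite !ccod_id.
- by move=> *; rewrite !cdom_comp.
- by move=> *; rewrite !ccod_comp.
- by case=> *; rewrite !ccomp_idl.
- by case=> *; rewrite !ccomp_idr.
- by move=> *; congr pair; exact: ccompA.
Defined.

Definition dprod_cat (I : Type) (O M : I -> Type)
  (X : forall i, cat_on (O i) (M i)) :
  cat_on (forall i, O i) (forall i, M i).
Proof.
refine (@CatOn (forall i, O i) (forall i, M i)
  (fun f i => cdom (X i) (f i)) (fun f i => ccod (X i) (f i))
  (fun a i => cid (X i) (a i))
  (fun g f e i => @ccomp _ _ (X i) (g i) (f i) (f_equal (fun a => a i) e))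
  _ _ _ _ _ _ _);
  move=> *; apply: functional_extensionality_dep => i.
- exact: cdom_id.
- exact: ccod_id.
- exact: cdom_comp.
- exact: ccod_comp.
- exact: ccomp_idl.
- exact: ccomp_idr.
- exact: ccompA.
Defined.

Record is_subcat O M (X : cat_on O M) (P0 : O -> Prop) (P1 : M -> Prop) : Prop :=
  IsSubcat {
  sub_dom : forall f, P1 f -> P0 (cdom X f);
  sub_cod : forall f, P1 f -> P0 (ccod X f);
  sub_id : forall a, P0 a -> P1 (cid X a);
  sub_comp : forall g f e, P1 g -> P1 f -> P1 (@ccomp _ _ X g f e)
}.

Definition sub_cat O M (X : cat_on O M) (P0 : O -> Prop) (P1 : M -> Prop)
  (s : is_subcat X P0 P1) : cat_on {a | P0 a} {f | P1 f}.
Proof.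
refine (@CatOn {a | P0 a} {f | P1 f}
  (fun f => exist _ _ (sub_dom s (proj2_sig f)))
  (fun f => exist _ _ (sub_cod s (proj2_sig f)))
  (fun a => exist _ _ (sub_id s (proj2_sig a)))
  (fun g f e => exist _ _
     (@sub_comp _ _ _ _ _ s (proj1_sig g) (proj1_sig f)
        (f_equal (@proj1_sig _ _) e) (proj2_sig g) (proj2_sig f)))
  _ _ _ _ _ _ _); move=> *; apply: sig_eq => /=.
- exact: cdom_id.
- exact: ccod_id.
- exact: cdom_comp.
- exact: ccod_comp.
- exact: ccomp_idl.
- exact: ccomp_idr.
- exact: ccompA.
Defined.

Definition prod2 (A B : two_cat) : two_cat.
Proof.
refine (@TwoCat (fun k => A k * B k)%type
  (prod_cat (cat1 A) (cat1 B)) (prod_cat (catv A) (catv B))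
  (prod_cat (cath A) (cath B)) _ _ _ _ _ _ _ _ _);
  move=> *; congr pair.
all: by [apply: hdom_vdom | apply: hdom_vcod | apply: hcod_vdom
  | apply: hcod_vcod | apply: hid_vid | apply: hcomp_vid | apply: vdom_hcomp
  | apply: vcod_hcomp | apply: interchange].
Defined.

Definition dprod2 (I : Type) (A : I -> two_cat) : two_cat.
Proof.
refine (@TwoCat (fun k => forall i, A i k)
  (dprod_cat (fun i => cat1 (A i))) (dprod_cat (fun i => catv (A i)))
  (dprod_cat (fun i => cath (A i))) _ _ _ _ _ _ _ _ _);
  move=> *; apply: functional_extensionality_dep => i.
all: by [apply: hdom_vdom | apply: hdom_vcod | apply: hcod_vdom
  | apply: hcod_vcod | apply: hid_vid | apply: hcomp_vid | apply: vdom_hcomp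
  | apply: vcod_hcomp | apply: interchange].
Defined.

Record is_subcat2 (A : two_cat) (P : forall k, A k -> Prop) : Prop := IsSubcat2 {
  subcat1 : is_subcat (cat1 A) (P Ob) (P Mor);
  subcatv : is_subcat (catv A) (P Mor) (P Cel);
  subcath : is_subcat (cath A) (P Ob) (P Cel)
}.

Definition sub2 (A : two_cat) (P : forall k, A k -> Prop) (s : is_subcat2 P) :
  two_cat.
Proof.
refine (@TwoCat (fun k => {x : A k | P k x})
  (sub_cat (subcat1 s)) (sub_cat (subcatv s)) (sub_cat (subcath s))
  _ _ _ _ _ _ _ _ _); move=> *; apply: sig_eq => /=.
all: by [apply: hdom_vdom | apply: hdom_vcod | apply: hcod_vdom
  | apply: hcod_vcod | apply: hid_vid | apply: hcomp_vid | apply: vdom_hcomp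
  | apply: vcod_hcomp | apply: interchange].
Defined.

(* Strict pullbacks. *)

Lemma pullback_closed (O M O' M' O'' M'' : Type) (X : cat_on O M)
  (Y : cat_on O' M') (Z : cat_on O'' M'') F0 F1 G0 G1 :
  is_functor X Z F0 F1 -> is_functor Y Z G0 G1 ->
  is_subcat (prod_cat X Y) (fun x => F0 x.1 = G0 x.2) (fun x => F1 x.1 = G1 x.2).
Proof.
move=> FF GG; split=> [f /= e|f /= e|a /= e|g f e /= eg ef].
- by rewrite -(is_fdom FF) -(is_fdom GG) e.
- by rewrite -(is_fcod FF) -(is_fcod GG) e.
- by rewrite (is_fid FF) (is_fid GG) e.
have eF : ccod Z (F1 f.1) = cdom Z (F1 g.1).
  by rewrite (is_fcod FF) (is_fdom FF); congr F0; exact: (f_equal fst e).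
have eG : ccod Z (G1 f.2) = cdom Z (G1 g.2).
  by rewrite (is_fcod GG) (is_fdom GG); congr G0; exact: (f_equal snd e).
by rewrite (is_fcomp FF _ eF) (is_fcomp GG _ eG); exact: ccomp_eq.
Qed.

Lemma pullback_subcat2 A B C (F : two_functor A C) (G : two_functor B C) :
  @is_subcat2 (prod2 A B) (fun k x => F k x.1 = G k x.2).
Proof.
by split; apply: pullback_closed; [apply: functor1 | apply: functor1
  | apply: functorv | apply: functorv | apply: functorh | apply: functorh].
Qed.

Definition pullback A B C (F : two_functor A C) (G : two_functor B C) : two_cat :=
  sub2 (pullback_subcat2 F G).

Definition pb A B C (F : two_functor A C) (G : two_functor B C) k
  (x : A k) (y : B k) (e : F k x = G k y) : pullback F G k :=
  exist (fun z => F k z.1 = G k z.2) (x, y) e.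
Arguments pb {A B C F G k} x y e.

(* Totalised composition, used only in proofs: rewriting with it does not     *)
(* have to transport proofs of composability.                                 *)

Definition tcomp (O M : Type) (X : cat_on O M) (g f : M) : M :=
  match excluded_middle_informative (ccod X f = cdom X g) with
  | left e => @ccomp _ _ X g f e
  | right _ => g
  end.

Lemma tcompE O M (X : cat_on O M) g f e : @ccomp _ _ X g f e = tcomp X g f.
Proof.
by rewrite /tcomp; case: excluded_middle_informative => // e';
  rewrite (proof_irrelevance _ e e').
Qed.

Lemma tdom O M (X : cat_on O M) g f :
  ccod X f = cdom X g -> cdom X (tcomp X g f) = cdom X f.
Proof. by move=> e; rewrite -(tcompE e) cdom_comp. Qed.

Lemma tcod O M (X : cat_on O M) g f :
  ccod X f = cdom X g -> ccod X (tcomp X g f) = ccod X g.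
Proof. by move=> e; rewrite -(tcompE e) ccod_comp. Qed.

Lemma tidl O M (X : cat_on O M) a f : ccod X f = a -> tcomp X (cid X a) f = f.
Proof.
move=> <-; have e : ccod X f = cdom X (cid X (ccod X f)) by rewrite cdom_id.
by rewrite -(tcompE e) ccomp_idl.
Qed.

Lemma tidr O M (X : cat_on O M) a f : cdom X f = a -> tcomp X f (cid X a) = f.
Proof.
move=> <-; have e : ccod X (cid X (cdom X f)) = cdom X f by rewrite ccod_id.
by rewrite -(tcompE e) ccomp_idr.
Qed.

Lemma tcompA O M (X : cat_on O M) k g f :
  ccod X f = cdom X g -> ccod X g = cdom X k ->
  tcomp X k (tcomp X g f) = tcomp X (tcomp X k g) f.
Proof.
move=> e1 e2.
have e3 : ccod X (ccomp e1) = cdom X k by rewrite ccod_comp.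
have e4 : ccod X f = cdom X (ccomp e2) by rewrite cdom_comp.
have := @ccompA _ _ X k g f e1 e3 e2 e4.
by rewrite !tcompE.
Qed.

Notation tc1 := (tcomp (cat1 _)).
Notation tcv := (tcomp (catv _)).
Notation tch := (tcomp (cath _)).

Section TotalCalculus.
Variable A : two_cat.
Implicit Types (x y : A Cel) (s t u : A Mor).

Lemma hdomE x : cdom (cath A) x = dom (src2 x).
Proof. exact: hdom_vdom. Qed.
Lemma hcodE x : ccod (cath A) x = cod (src2 x).
Proof. exact: hcod_vdom. Qed.
Lemma dom_tgt2 x : dom (tgt2 x) = dom (src2 x).
Proof. by rewrite -hdom_vcod hdom_vdom. Qed.
Lemma cod_tgt2 x : cod (tgt2 x) = cod (src2 x).
Proof. by rewrite -hcod_vcod hcod_vdom. Qed.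

Lemma th_src y x : cod (src2 x) = dom (src2 y) ->
  src2 (tch y x) = tc1 (src2 y) (src2 x).
Proof.
move=> e; have e' : ccod (cath A) x = cdom (cath A) y by rewrite hcodE hdomE.
by rewrite -(tcompE e') (vdom_hcomp _ e) tcompE.
Qed.

Lemma th_tgt y x : cod (src2 x) = dom (src2 y) ->
  tgt2 (tch y x) = tc1 (tgt2 y) (tgt2 x).
Proof.
move=> e; have e' : ccod (cath A) x = cdom (cath A) y by rewrite hcodE hdomE.
have e2 : cod (tgt2 x) = dom (tgt2 y) by rewrite cod_tgt2 dom_tgt2.
by rewrite -(tcompE e') (vcod_hcomp _ e2) tcompE.
Qed.

Lemma th_id t s : cod s = dom t -> tch (id2 t) (id2 s) = id2 (tc1 t s) :> A Cel.
Proof.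
move=> e; have e' : ccod (cath A) (id2 s) = cdom (cath A) (id2 t).
  by rewrite hcodE hdomE !cdom_id.
by rewrite -(tcompE e') (hcomp_vid _ e) tcompE.
Qed.

Lemma th_A z y x : cod (src2 x) = dom (src2 y) -> cod (src2 y) = dom (src2 z) ->
  tch z (tch y x) = tch (tch z y) x :> A Cel.
Proof. by move=> e1 e2; rewrite tcompA // hcodE hdomE. Qed.

Lemma th_idl a x : cod (src2 x) = a -> tch (id2 (id1 a)) x = x.
Proof. by move=> e; rewrite -hid_vid tidl // hcodE. Qed.

Lemma th_idr a x : dom (src2 x) = a -> tch x (id2 (id1 a)) = x.
Proof. by move=> e; rewrite -hid_vid tidr // hdomE. Qed.

Lemma tinterchange y' y x' x : tgt2 y = src2 y' -> tgt2 x = src2 x' ->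
  cod (src2 x) = dom (src2 y) ->
  tch (tcv y' y) (tcv x' x) = tcv (tch y' x') (tch y x).
Proof.
move=> ey ex e.
have e3 : ccod (cath A) (ccomp ex) = cdom (cath A) (ccomp ey).
  by rewrite hcodE hdomE !cdom_comp.
have e4 : ccod (cath A) x' = cdom (cath A) y'.
  by rewrite hcodE hdomE -ex -ey cod_tgt2 dom_tgt2.
have e5 : ccod (cath A) x = cdom (cath A) y by rewrite hcodE hdomE.
have e6 : tgt2 (ccomp e5) = src2 (ccomp e4).
  by rewrite !tcompE th_src ?th_tgt ?ex ?ey // -ex -ey cod_tgt2 dom_tgt2.
by have := interchange e3 e6; rewrite !tcompE.
Qed.

Lemma twhiskl t x' x : tgt2 x = src2 x' -> cod (src2 x) = dom t ->
  tch (id2 t) (tcv x' x) = tcv (tch (id2 t) x') (tch (id2 t) x).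
Proof.
move=> ex e; rewrite -tinterchange ?cdom_id ?ccod_id //.
by rewrite tidl // ccod_id.
Qed.

Lemma twhiskr t x' x : tgt2 x = src2 x' -> cod t = dom (src2 x) ->
  tch (tcv x' x) (id2 t) = tcv (tch x' (id2 t)) (tch x (id2 t)).
Proof.
move=> ex e; rewrite -tinterchange ?cdom_id ?ccod_id //.
by rewrite tidl // ccod_id.
Qed.

End TotalCalculus.

(* The lax arrow 2-category: an object is [u : a -> b]; a morphism from [u0]  *)
(* to [u1] is [(s, z, t)] with [z : t o u0 => u1 o s]; a cell is [(s, t)] with*)
(* [z0 (.) (u1 o s) = (t o u0) (.) z1], recorded with its boundary.           *)

Record arr_mor (A : two_cat) := ArrMor {
  am_u0 : A Mor;
  am_u1 : A Mor;
  am_s : A Mor;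
  am_t : A Mor;
  am_z : A Cel;
  am_dom_s : dom am_s = dom am_u0;
  am_cod_s : cod am_s = dom am_u1;
  am_dom_t : cod am_u0 = dom am_t;
  am_cod_t : cod am_t = cod am_u1;
  am_src : src2 am_z = comp1 am_t am_u0 am_dom_t;
  am_tgt : tgt2 am_z = comp1 am_u1 am_s am_cod_s
}.

Record arr_cel (A : two_cat) := ArrCel {
  ac_m0 : arr_mor A;
  ac_m1 : arr_mor A;
  ac_s : A Cel;
  ac_t : A Cel;
  ac_u0 : am_u0 ac_m0 = am_u0 ac_m1;
  ac_u1 : am_u1 ac_m0 = am_u1 ac_m1;
  ac_src_s : src2 ac_s = am_s ac_m0;
  ac_tgt_s : tgt2 ac_s = am_s ac_m1;
  ac_src_t : src2 ac_t = am_t ac_m0;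
  ac_tgt_t : tgt2 ac_t = am_t ac_m1;
  ac_comm : forall e1 e2 e3 e4,
    vcomp (am_z ac_m0) (whiskl (am_u1 ac_m0) ac_s e1) e2
    = vcomp (whiskr ac_t (am_u0 ac_m0) e3) (am_z ac_m1) e4
}.

Lemma arr_mor_eq A (m m' : arr_mor A) :
  am_u0 m = am_u0 m' -> am_u1 m = am_u1 m' -> am_s m = am_s m' ->
  am_t m = am_t m' -> am_z m = am_z m' -> m = m'.
Proof.
case: m => u0 u1 s t z a b c d i j; case: m' => u0' u1' s' t' z' a' b' c' d' i' j' /=.
move=> e0 e1 e2 e3 e4; subst.
have ? := proof_irrelevance _ a a'; have ? := proof_irrelevance _ b b'.
have ? := proof_irrelevance _ c c'; have ? := proof_irrelevance _ d d'; subst.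
by rewrite (proof_irrelevance _ i i') (proof_irrelevance _ j j').
Qed.

Lemma arr_cel_eq A (x x' : arr_cel A) :
  ac_m0 x = ac_m0 x' -> ac_m1 x = ac_m1 x' -> ac_s x = ac_s x' ->
  ac_t x = ac_t x' -> x = x'.
Proof.
case: x => m n s t a b c d i j k; case: x' => m' n' s' t' a' b' c' d' i' j' k' /=.
move=> e0 e1 e2 e3; subst.
have ? := proof_irrelevance _ a a'; have ? := proof_irrelevance _ b b'.
have ? := proof_irrelevance _ c c'; have ? := proof_irrelevance _ d d'; subst.
by rewrite (proof_irrelevance _ i i') (proof_irrelevance _ j j')
  (proof_irrelevance _ k k').
Qed.

(* Total forms of the fields. *)

Section Fields.
Variable A : two_cat.
Implicit Types (m n : arr_mor A) (x y : arr_cel A).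

Lemma am_srcE m : src2 (am_z m) = tc1 (am_t m) (am_u0 m).
Proof. by rewrite (am_src m) tcompE. Qed.

Lemma am_tgtE m : tgt2 (am_z m) = tc1 (am_u1 m) (am_s m).
Proof. by rewrite (am_tgt m) tcompE. Qed.

Lemma am_dom_z m : dom (src2 (am_z m)) = dom (am_u0 m).
Proof. by rewrite am_srcE tdom // am_dom_t. Qed.

Lemma am_cod_z m : cod (src2 (am_z m)) = cod (am_t m).
Proof. by rewrite am_srcE tcod // am_dom_t. Qed.

Definition ac_law m0 m1 (s t : A Cel) : Prop :=
  tcv (tch (id2 (am_u1 m0)) s) (am_z m0) = tcv (am_z m1) (tch t (id2 (am_u0 m0))).

Definition mk_arr_cel m0 m1 (s t : A Cel)
  (e0 : am_u0 m0 = am_u0 m1) (e1 : am_u1 m0 = am_u1 m1)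
  (ss : src2 s = am_s m0) (st : tgt2 s = am_s m1)
  (ts : src2 t = am_t m0) (tt : tgt2 t = am_t m1)
  (law : ac_law m0 m1 s t) : arr_cel A.
Proof.
by apply: (ArrCel e0 e1 ss st ts tt) => *; rewrite !tcompE.
Defined.

Lemma ac_lawE x : ac_law (ac_m0 x) (ac_m1 x) (ac_s x) (ac_t x).
Proof.
case: x => m n s t a b c d i j k; rewrite /ac_law /=.
have e1 : ccod (cath A) s = cdom (cath A) (id2 (am_u1 m)).
  by rewrite hcodE hdomE cdom_id c am_cod_s.
have e3 : ccod (cath A) (id2 (am_u0 m)) = cdom (cath A) t.
  by rewrite hcodE hdomE cdom_id i am_dom_t.
have e2 : tgt2 (am_z m) = src2 (ccomp e1).
  by rewrite tcompE th_src ?cdom_id ?c ?am_cod_s // am_tgtE.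
have e4 : tgt2 (ccomp e3) = src2 (am_z n).
  rewrite tcompE th_tgt ?cdom_id ?ccod_id ?i ?am_dom_t //.
  by rewrite am_srcE j a.
by have := k e1 e2 e3 e4; rewrite !tcompE.
Qed.

End Fields.

Ltac am_facts m :=
  have := am_srcE m; have := am_tgtE m; have := am_dom_z m;
  have := am_cod_z m; have := am_dom_s m; have := am_cod_s m;
  have := am_dom_t m; have := am_cod_t m; do 8! move=> ?.

(* Discharges boundary conditions. *)
Ltac bd :=
  first [ assumption | reflexivity | congruence
        | rewrite ?hdomE ?hcodE; bd_norm; first [reflexivity | congruence] ]
with bd_norm :=
  repeat first
  [ rewrite cdom_id | rewrite ccod_id | rewrite dom_tgt2 | rewrite cod_tgt2
  | rewrite am_srcE | rewrite am_tgtE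
  | rewrite th_src; [| solve [bd] ] | rewrite th_tgt; [| solve [bd] ]
  | rewrite tdom; [| solve [bd] ] | rewrite tcod; [| solve [bd] ]
  | rewrite -tcompA; [| solve [bd] | solve [bd] ] ].

Ltac ac_facts x :=
  let h := fresh in
  have := ac_src_s x; have := ac_tgt_s x; have := ac_src_t x;
  have := ac_tgt_t x; have := ac_u0 x; have := ac_u1 x; do 6! move=> ?;
  have h := ac_lawE x; rewrite /ac_law in h; move: h;
  have := am_dom_s (ac_m0 x); have := am_cod_s (ac_m0 x);
  have := am_dom_t (ac_m0 x); have := am_cod_t (ac_m0 x);
  have := am_dom_s (ac_m1 x); have := am_cod_s (ac_m1 x);
  have := am_dom_t (ac_m1 x); have := am_cod_t (ac_m1 x); do 8! move=> ?;
  have := am_dom_z (ac_m0 x); have := am_cod_z (ac_m0 x);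
  have := am_dom_z (ac_m1 x); have := am_cod_z (ac_m1 x); do 4! move=> ?.

Section LaxArrow.
Variable A : two_cat.
Implicit Types (m n : arr_mor A) (x y : arr_cel A).

Definition mk_arr_mor u0 u1 s t z (ds : dom s = dom u0) (cs : cod s = dom u1)
  (dt : cod u0 = dom t) (ct : cod t = cod u1)
  (zs : src2 z = tc1 t u0) (zt : tgt2 z = tc1 u1 s) : arr_mor A :=
  @ArrMor A u0 u1 s t z ds cs dt ct (etrans zs (esym (tcompE dt)))
    (etrans zt (esym (tcompE cs))).

Definition arr_id (u : A Mor) : arr_mor A.
Proof.
refine (@mk_arr_mor u u (id1 (dom u)) (id1 (cod u)) (id2 u) _ _ _ _ _ _).
- by rewrite cdom_id.
- by rewrite ccod_id.
- by rewrite cdom_id.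
- by rewrite ccod_id.
- by rewrite cdom_id tidl.
- by rewrite ccod_id tidr.
Defined.

Section Pasting.
Variables (n m : arr_mor A) (e : am_u1 m = am_u0 n).

Lemma arr_comp_s : cod (am_s m) = dom (am_s n).
Proof. by rewrite am_cod_s am_dom_s e. Qed.

Lemma arr_comp_t : cod (am_t m) = dom (am_t n).
Proof. by rewrite am_cod_t -am_dom_t e. Qed.

Lemma arr_comp_zt : ccod (cath A) (am_z m) = cdom (cath A) (id2 (am_t n)).
Proof. by rewrite hcodE hdomE cdom_id am_cod_z arr_comp_t. Qed.

Lemma arr_comp_zs : ccod (cath A) (id2 (am_s m)) = cdom (cath A) (am_z n).
Proof. by rewrite hcodE hdomE cdom_id am_dom_z am_cod_s e. Qed.

Lemma arr_comp_zz :
  tgt2 (whiskl (am_t n) (am_z m) arr_comp_zt)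
  = src2 (whiskr (am_z n) (am_s m) arr_comp_zs).
Proof.
rewrite !tcompE th_tgt ?th_src ?cdom_id ?ccod_id ?am_cod_z ?am_dom_z;
  rewrite ?am_cod_s ?arr_comp_t ?e //.
by rewrite am_tgtE am_srcE tcompA ?e -?am_dom_t // -e am_cod_s.
Qed.

(* The composite [n o m], with cell [(t_n o z_m) (.) (z_n o s_m)]. *)
Definition arr_comp : arr_mor A.
Proof.
refine (@mk_arr_mor (am_u0 m) (am_u1 n) (comp1 (am_s n) (am_s m) arr_comp_s)
  (comp1 (am_t n) (am_t m) arr_comp_t)
  (vcomp (whiskl (am_t n) (am_z m) arr_comp_zt)
         (whiskr (am_z n) (am_s m) arr_comp_zs) arr_comp_zz)
  _ _ _ _ _ _).
- by rewrite cdom_comp am_dom_s.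
- by rewrite ccod_comp am_cod_s.
- by rewrite cdom_comp am_dom_t.
- by rewrite ccod_comp am_cod_t.
- rewrite cdom_comp !tcompE th_src ?cdom_id ?am_cod_z ?arr_comp_t //.
  by rewrite am_srcE tcompA ?arr_comp_t // am_dom_t.
- rewrite ccod_comp !tcompE th_tgt ?cdom_id ?ccod_id ?am_dom_z ?am_cod_s ?e //.
  by rewrite am_tgtE tcompA ?arr_comp_s // am_cod_s.
Defined.

Lemma arr_comp_z : am_z arr_comp
  = tcv (tch (am_z n) (id2 (am_s m))) (tch (id2 (am_t n)) (am_z m)).
Proof. by rewrite /= !tcompE. Qed.

End Pasting.

Definition lax_cat1 : cat_on (A Mor) (arr_mor A).
Proof.
refine (@CatOn (A Mor) (arr_mor A) (@am_u0 A) (@am_u1 A) arr_id arr_comp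
  _ _ _ _ _ _ _) => //.
- move=> m e; apply: arr_mor_eq => //; rewrite ?arr_comp_z /= ?tcompE.
  + by rewrite tidl // am_cod_s.
  + by rewrite tidl // am_cod_t.
  + rewrite th_idl ?am_cod_z ?am_cod_t // th_id ?am_cod_s //.
    by rewrite tidl // am_tgtE.
- move=> m e; apply: arr_mor_eq => //; rewrite ?arr_comp_z /= ?tcompE.
  + by rewrite tidr // am_dom_s.
  + by rewrite tidr // -am_dom_t.
  + rewrite th_idr ?am_dom_z // th_id -?am_dom_t //.
    by rewrite tidr // am_srcE.
move=> k n m e1 e2 e3 e4.
have es1 : cod (am_s m) = dom (am_s n) by rewrite am_cod_s am_dom_s e1.
have es2 : cod (am_s n) = dom (am_s k) by rewrite am_cod_s am_dom_s e3.
have et1 : cod (am_t m) = dom (am_t n) by rewrite am_cod_t -am_dom_t e1.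
have et2 : cod (am_t n) = dom (am_t k) by rewrite am_cod_t -am_dom_t e3.
apply: arr_mor_eq => //; rewrite ?arr_comp_z.
- by rewrite /= !tcompE tcompA.
- by rewrite /= !tcompE tcompA.
rewrite [am_s _]/= [am_t (arr_comp e3)]/= ?arr_comp_z !tcompE.
have e1' : am_u1 m = am_u0 n := e1.
have e3' : am_u1 n = am_u0 k := e3.
am_facts m; am_facts n; am_facts k.
rewrite twhiskl; [| bd | bd].
rewrite twhiskr; [| bd | bd].
rewrite -th_id; [| bd].
rewrite -th_id; [| bd].
rewrite th_A; [| bd | bd].
rewrite th_A; [| bd | bd].
rewrite th_A; [| bd | bd].
rewrite tcompA; [| bd | bd].
by [].
Defined.

Definition arr_cel_id m : arr_cel A.
Proof.
refine (@mk_arr_cel A m m (id2 (am_s m)) (id2 (am_t m)) erefl erefl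
  (cdom_id _ _) (ccod_id _ _) (cdom_id _ _) (ccod_id _ _) _).
by rewrite /ac_law; am_facts m; rewrite !th_id ?tidl ?tidr //; bd.
Defined.

Section VerticalComposition.
Variables (y x : arr_cel A) (e : ac_m1 x = ac_m0 y).

Lemma arr_vcomp_s : tgt2 (ac_s x) = src2 (ac_s y).
Proof. by rewrite ac_tgt_s ac_src_s e. Qed.

Lemma arr_vcomp_t : tgt2 (ac_t x) = src2 (ac_t y).
Proof. by rewrite ac_tgt_t ac_src_t e. Qed.

Definition arr_vcomp : arr_cel A.
Proof.
refine (@mk_arr_cel A (ac_m0 x) (ac_m1 y) (ccomp arr_vcomp_s) (ccomp arr_vcomp_t)
  _ _ _ _ _ _ _).
- by rewrite ac_u0 e ac_u0.
- by rewrite ac_u1 e ac_u1.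
- by rewrite cdom_comp ac_src_s.
- by rewrite ccod_comp ac_tgt_s.
- by rewrite cdom_comp ac_src_t.
- by rewrite ccod_comp ac_tgt_t.
have es := arr_vcomp_s; have et := arr_vcomp_t.
rewrite /ac_law !tcompE; ac_facts x; ac_facts y => ly lx.
rewrite twhiskl; [| bd | bd].
rewrite -tcompA; [| bd | bd].
rewrite lx tcompA; [| bd | bd].
have -> : am_u1 (ac_m0 x) = am_u1 (ac_m0 y) by congruence.
rewrite e ly -tcompA; [| bd | bd].
have -> : am_u0 (ac_m0 x) = am_u0 (ac_m0 y) by congruence.
by rewrite twhiskr; [| bd | bd].
Defined.

End VerticalComposition.

Section HorizontalComposition.
Variables (y x : arr_cel A) (e : am_u1 (ac_m0 x) = am_u0 (ac_m0 y)).

Lemma arr_hcomp_1 : am_u1 (ac_m1 x) = am_u0 (ac_m1 y).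
Proof. by rewrite -ac_u1 e ac_u0. Qed.

Lemma arr_hcomp_s : cod (src2 (ac_s x)) = dom (src2 (ac_s y)).
Proof. by rewrite !ac_src_s am_cod_s am_dom_s e. Qed.

Lemma arr_hcomp_t : cod (src2 (ac_t x)) = dom (src2 (ac_t y)).
Proof. by rewrite !ac_src_t am_cod_t -am_dom_t e. Qed.

Lemma arr_hcomp_hs : ccod (cath A) (ac_s x) = cdom (cath A) (ac_s y).
Proof. by rewrite hcodE hdomE arr_hcomp_s. Qed.

Lemma arr_hcomp_ht : ccod (cath A) (ac_t x) = cdom (cath A) (ac_t y).
Proof. by rewrite hcodE hdomE arr_hcomp_t. Qed.

Definition arr_hcomp : arr_cel A.
Proof.
refine (@mk_arr_cel A (arr_comp e) (arr_comp arr_hcomp_1)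
  (ccomp arr_hcomp_hs) (ccomp arr_hcomp_ht) _ _ _ _ _ _ _).
- exact: ac_u0.
- exact: ac_u1.
- by rewrite /= !tcompE th_src ?arr_hcomp_s // !ac_src_s.
- by rewrite /= !tcompE th_tgt ?arr_hcomp_s // !ac_tgt_s.
- by rewrite /= !tcompE th_src ?arr_hcomp_t // !ac_src_t.
- by rewrite /= !tcompE th_tgt ?arr_hcomp_t // !ac_tgt_t.
have e1 := arr_hcomp_1; have es := arr_hcomp_s; have et := arr_hcomp_t.
rewrite /ac_law !arr_comp_z !tcompE; ac_facts x; ac_facts y => ly lx.
rewrite [am_u1 _]/= [am_u0 _]/=.
rewrite th_A; [| bd | bd].
rewrite tcompA; [| bd | bd].
rewrite -tinterchange; [| bd | bd | bd].
rewrite ly [tcv (ac_s x) _]tidr; [| bd].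
rewrite -[X in tch (tcv _ _) X](@tidl _ _ (catv A) (am_s (ac_m1 x))); [| bd].
rewrite tinterchange; [| bd | bd | bd].
rewrite -tcompA; [| bd | bd].
rewrite -[RHS]tcompA; [| bd | bd].
congr tcv.
rewrite -e -th_A; [| bd | bd].
rewrite -tinterchange; [| bd | bd | bd].
rewrite lx tidr; [| bd].
rewrite -[X in tch X (tcv _ _)](@tidl _ _ (catv A) (am_t (ac_m1 y))); [| bd].
rewrite tinterchange; [| bd | bd | bd].
by rewrite th_A; [| bd | bd].
Defined.

End HorizontalComposition.

Lemma arr_compA k n m e1 e2 e3 e4 :
  @arr_comp k (@arr_comp n m e1) e2 = @arr_comp (@arr_comp k n e3) m e4.
Proof. exact: (@ccompA _ _ lax_cat1). Qed.

Lemma arr_hcomp_m1 y x e : ac_m1 (@arr_hcomp y x e) = arr_comp (arr_hcomp_1 e).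
Proof. by []. Qed.

Definition lax_catv : cat_on (arr_mor A) (arr_cel A).
Proof.
refine (@CatOn (arr_mor A) (arr_cel A) (@ac_m0 A) (@ac_m1 A) arr_cel_id arr_vcomp
  _ _ _ _ _ _ _) => //.
- move=> x e; apply: arr_cel_eq => //=; rewrite tcompE tidl //.
  + by rewrite ac_tgt_s.
  + by rewrite ac_tgt_t.
- move=> x e; apply: arr_cel_eq => //=; rewrite tcompE tidr //.
  + by rewrite ac_src_s.
  + by rewrite ac_src_t.
- move=> z y x e1 e2 e3 e4; apply: arr_cel_eq => //=; exact: ccompA.
Defined.

Definition lax_cath : cat_on (A Mor) (arr_cel A).
Proof.
refine (@CatOn (A Mor) (arr_cel A)
  (fun x => am_u0 (ac_m0 x)) (fun x => am_u1 (ac_m0 x))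
  (fun u => arr_cel_id (arr_id u)) arr_hcomp _ _ _ _ _ _ _) => //.
- move=> x e; apply: arr_cel_eq.
  + exact: (@ccomp_idl _ _ lax_cat1 (ac_m0 x) e).
  + apply: etrans (@ccomp_idl _ _ lax_cat1 (ac_m1 x) erefl).
    by apply: (@ccomp_eq _ _ lax_cat1) => //=; rewrite ac_u1.
  + by rewrite /= tcompE th_idl // ac_src_s am_cod_s.
  + by rewrite /= tcompE th_idl // ac_src_t am_cod_t.
- move=> x e; apply: arr_cel_eq.
  + exact: (@ccomp_idr _ _ lax_cat1 (ac_m0 x) e).
  + apply: etrans (@ccomp_idr _ _ lax_cat1 (ac_m1 x) erefl).
    by apply: (@ccomp_eq _ _ lax_cat1) => //=; rewrite ac_u0.
  + by rewrite /= tcompE th_idr // ac_src_s am_dom_s.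
  + by rewrite /= tcompE th_idr // ac_src_t -am_dom_t.
- move=> z y x e1 e2 e3 e4; apply: arr_cel_eq.
  + exact: arr_compA.
  + by rewrite !arr_hcomp_m1; apply: arr_compA.
  + exact: (@ccompA _ _ (cath A) (ac_s z) (ac_s y) (ac_s x)).
  + exact: (@ccompA _ _ (cath A) (ac_t z) (ac_t y) (ac_t x)).
Defined.

(* [A^2] *)
Definition lax_arrow : two_cat.
Proof.
refine (@TwoCat
  (fun k => match k with Ob => A Mor | Mor => arr_mor A | Cel => arr_cel A end)
  lax_cat1 lax_catv lax_cath _ _ _ _ _ _ _ _ _) => //.
- by move=> x; rewrite /= ac_u0.
- by move=> x; rewrite /= ac_u1.
- move=> n m e e'; apply: arr_cel_eq => /=.
  + exact: (@ccomp_eq _ _ lax_cat1).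
  + exact: (@ccomp_eq _ _ lax_cat1).
  + exact: hcomp_vid.
  + exact: hcomp_vid.
- by move=> y x e e'; apply: (@ccomp_eq _ _ lax_cat1).
- by move=> y x e e'; apply: (@ccomp_eq _ _ lax_cat1).
- move=> y' y x' x e1 e2 e3 e4 e5 e6; apply: arr_cel_eq => /=.
  + exact: (@ccomp_eq _ _ lax_cat1).
  + exact: (@ccomp_eq _ _ lax_cat1).
  + exact: interchange.
  + exact: interchange.
Defined.

End LaxArrow.

Section LaxArrowStructure.
Variable A : two_cat.
Implicit Types (m n : arr_mor A) (x y : arr_cel A).

Definition lax_src : two_functor (lax_arrow A) A.
Proof.
refine (@TwoFunctor (lax_arrow A) A
  (fun k => match k return lax_arrow A k -> A k with
            | Ob => fun u => dom u | Mor => fun m => am_s m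
            | Cel => fun x => ac_s x end) _ _ _); split => //=.
- exact: am_dom_s.
- exact: am_cod_s.
- by move=> n m e e'; apply: ccomp_eq.
- exact: ac_src_s.
- exact: ac_tgt_s.
- by move=> y x e e'; apply: ccomp_eq.
- by move=> x; rewrite hdomE ac_src_s am_dom_s.
- by move=> x; rewrite hcodE ac_src_s am_cod_s.
- by move=> u; rewrite hid_vid.
- by move=> y x e e'; apply: ccomp_eq.
Defined.

Definition lax_tgt : two_functor (lax_arrow A) A.
Proof.
refine (@TwoFunctor (lax_arrow A) A
  (fun k => match k return lax_arrow A k -> A k with
            | Ob => fun u => cod u | Mor => fun m => am_t m
            | Cel => fun x => ac_t x end) _ _ _); split => //=.
- by move=> m; rewrite -am_dom_t.
- exact: am_cod_t.
- by move=> n m e e'; apply: ccomp_eq.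
- exact: ac_src_t.
- exact: ac_tgt_t.
- by move=> y x e e'; apply: ccomp_eq.
- by move=> x; rewrite hdomE ac_src_t -am_dom_t.
- by move=> x; rewrite hcodE ac_src_t am_cod_t.
- by move=> u; rewrite hid_vid.
- by move=> y x e e'; apply: ccomp_eq.
Defined.

(* A cell [b : s => t], with [s, t : a -> a'], as the morphism [(t, b, s)] of  *)
(* [A^2] from [id_a] to [id_a'].                                              *)
Definition arr_of_cel (b : A Cel) : arr_mor A.
Proof.
refine (@mk_arr_mor A (id1 (dom (src2 b))) (id1 (cod (src2 b))) (tgt2 b) (src2 b) b
  _ _ _ _ _ _).
- by rewrite cdom_id dom_tgt2.
- by rewrite cdom_id cod_tgt2.
- by rewrite ccod_id.
- by rewrite ccod_id.
- by rewrite tidr.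
- by rewrite tidl // cod_tgt2.
Defined.

Definition unit_mor (s : A Mor) : arr_mor A.
Proof.
refine (@mk_arr_mor A (id1 (dom s)) (id1 (cod s)) s s (id2 s) _ _ _ _ _ _).
- by rewrite cdom_id.
- by rewrite cdom_id.
- by rewrite ccod_id.
- by rewrite ccod_id.
- by rewrite cdom_id tidr.
- by rewrite ccod_id tidl.
Defined.

Definition unit_cel (b : A Cel) : arr_cel A.
Proof.
refine (@mk_arr_cel A (unit_mor (src2 b)) (unit_mor (tgt2 b)) b b
  _ _ erefl erefl erefl erefl _) => /=.
- by rewrite dom_tgt2.
- by rewrite cod_tgt2.
by rewrite /ac_law /= th_idl // th_idr // tidl // tidr.
Defined.

Definition lax_unit : two_functor A (lax_arrow A).
Proof.
refine (@TwoFunctor A (lax_arrow A)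
  (fun k => match k return A k -> lax_arrow A k with
            | Ob => fun a => id1 a | Mor => unit_mor
            | Cel => unit_cel end) _ _ _); split => //=.
- move=> a; apply: arr_mor_eq; rewrite ?arr_id_z /= ?cdom_id ?ccod_id //.
- move=> t s e e'; apply: arr_mor_eq; rewrite ?arr_comp_z /= ?cdom_comp ?ccod_comp //;
    try exact: ccomp_eq.
  by rewrite !tcompE !th_id // tidl // ccod_id.
- by move=> s; apply: arr_cel_eq => //=; apply: arr_mor_eq; rewrite /= ?cdom_id ?ccod_id.
- move=> y x e e'; apply: arr_cel_eq => //=; try exact: ccomp_eq;
  by rewrite ?cdom_comp ?ccod_comp.
- by move=> x; rewrite hdomE.
- by move=> x; rewrite hcodE.
- move=> a; apply: arr_cel_eq; rewrite ?hid_vid //=.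
  + by rewrite !cdom_id; apply: arr_mor_eq; rewrite /= ?cdom_id ?ccod_id.
  + by rewrite !ccod_id; apply: arr_mor_eq; rewrite /= ?cdom_id ?ccod_id.
  + by rewrite cdom_id.
  + by rewrite ccod_id.
- move=> y x e e'.
  have e1 : cod (src2 x) = dom (src2 y) by rewrite -hdomE -hcodE.
  have e2 : cod (tgt2 x) = dom (tgt2 y) by rewrite dom_tgt2 cod_tgt2.
  apply: arr_cel_eq => /=; try exact: ccomp_eq.
  + rewrite (vdom_hcomp _ e1).
    apply: arr_mor_eq; rewrite ?arr_comp_z /= ?cdom_comp ?ccod_comp //;
    try exact: ccomp_eq.
    by rewrite !tcompE !th_id // tidl // ccod_id.
  + rewrite (vcod_hcomp _ e2).
    apply: arr_mor_eq; rewrite ?arr_comp_z /= ?cdom_comp ?ccod_comp //;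
    try exact: ccomp_eq.
    by rewrite !tcompE !th_id // tidl // ccod_id.
Defined.

End LaxArrowStructure.

Lemma ftcomp (O M O' M' : Type) (X : cat_on O M) (Y : cat_on O' M') F0 F1 g f :
  is_functor X Y F0 F1 -> ccod X f = cdom X g ->
  F1 (tcomp X g f) = tcomp Y (F1 g) (F1 f).
Proof.
move=> FF e; have e' : ccod Y (F1 f) = cdom Y (F1 g).
  by rewrite (is_fcod FF) (is_fdom FF) e.
by rewrite -(tcompE e) (is_fcomp FF _ e') tcompE.
Qed.

Section LaxArrowMap.
Variables (A C : two_cat) (f : two_functor A C).

Lemma fdom s : dom (f Mor s) = f Ob (dom s).
Proof. exact: is_fdom (functor1 f) s. Qed.
Lemma fcod s : cod (f Mor s) = f Ob (cod s).
Proof. exact: is_fcod (functor1 f) s. Qed.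
Lemma fid1 a : f Mor (id1 a) = id1 (f Ob a).
Proof. exact: is_fid (functor1 f) a. Qed.
Lemma fsrc2 x : src2 (f Cel x) = f Mor (src2 x).
Proof. exact: is_fdom (functorv f) x. Qed.
Lemma ftgt2 x : tgt2 (f Cel x) = f Mor (tgt2 x).
Proof. exact: is_fcod (functorv f) x. Qed.
Lemma fid2 s : f Cel (id2 s) = id2 (f Mor s).
Proof. exact: is_fid (functorv f) s. Qed.
Lemma ftc1 t s : cod s = dom t -> f Mor (tc1 t s) = tc1 (f Mor t) (f Mor s).
Proof. exact: ftcomp (functor1 f). Qed.
Lemma ftcv y x : tgt2 x = src2 y -> f Cel (tcv y x) = tcv (f Cel y) (f Cel x).
Proof. exact: ftcomp (functorv f). Qed.
Lemma ftch y x : cod (src2 x) = dom (src2 y) ->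
  f Cel (tch y x) = tch (f Cel y) (f Cel x).
Proof. by move=> e; rewrite (ftcomp (functorh f)) // hdomE hcodE. Qed.

Definition map_mor (m : arr_mor A) : arr_mor C.
Proof.
refine (@mk_arr_mor C (f Mor (am_u0 m)) (f Mor (am_u1 m)) (f Mor (am_s m))
  (f Mor (am_t m)) (f Cel (am_z m)) _ _ _ _ _ _).
- by rewrite !fdom am_dom_s.
- by rewrite fdom fcod am_cod_s.
- by rewrite fdom fcod am_dom_t.
- by rewrite !fcod am_cod_t.
- by rewrite fsrc2 am_srcE ftc1 // am_dom_t.
- by rewrite ftgt2 am_tgtE ftc1 // am_cod_s.
Defined.

Definition map_cel (x : arr_cel A) : arr_cel C.
Proof.
refine (@mk_arr_cel C (map_mor (ac_m0 x)) (map_mor (ac_m1 x)) (f Cel (ac_s x))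
  (f Cel (ac_t x)) _ _ _ _ _ _ _) => /=.
- by rewrite ac_u0.
- by rewrite ac_u1.
- by rewrite fsrc2 ac_src_s.
- by rewrite ftgt2 ac_tgt_s.
- by rewrite fsrc2 ac_src_t.
- by rewrite ftgt2 ac_tgt_t.
rewrite /ac_law /= -!fid2; ac_facts x => lx.
rewrite -!ftch; [| bd | bd].
rewrite -!ftcv; [| bd | bd].
by rewrite lx.
Defined.

(* [f^2] *)
Definition lax_map : two_functor (lax_arrow A) (lax_arrow C).
Proof.
refine (@TwoFunctor (lax_arrow A) (lax_arrow C)
  (fun k => match k return lax_arrow A k -> lax_arrow C k with
            | Ob => f Mor | Mor => map_mor | Cel => map_cel end)
  _ _ _); split => //=.
- move=> u; apply: arr_mor_eq; rewrite /= ?fid1 ?fid2 ?fdom ?fcod //.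
- move=> n m e e'; apply: arr_mor_eq => //=.
  + exact: is_fcomp (functor1 f) _ _ _ _.
  + exact: is_fcomp (functor1 f) _ _ _ _.
  + rewrite !tcompE; am_facts m; am_facts n.
    have e1 : am_u1 m = am_u0 n := e.
    rewrite ftcv; [| bd].
    by rewrite !ftch ?fid2 //; bd.
- by move=> m; apply: arr_cel_eq; rewrite //= fid2.
- by move=> y x e e'; apply: arr_cel_eq => //=; exact: is_fcomp (functorv f) _ _ _ _.
- move=> u; apply: arr_cel_eq => /=; try (apply: arr_mor_eq => /=);
  by rewrite ?fid2 ?fid1 ?fdom ?fcod.
- move=> y x e e'.
  apply: arr_cel_eq => /=; try exact: is_fcomp (functorh f) _ _ _ _.
  + ac_facts x; ac_facts y => _ _.
    have e1 : am_u1 (ac_m0 x) = am_u0 (ac_m0 y) := e.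
    apply: arr_mor_eq => //=; rewrite !tcompE; try by rewrite ftc1 //; bd.
    rewrite ftcv; [| bd].
    by rewrite !ftch ?fid2 //; bd.
  + ac_facts x; ac_facts y => _ _.
    have e1 := arr_hcomp_1 e.
    apply: arr_mor_eq => //=; rewrite !tcompE; try by rewrite ftc1 //; bd.
    rewrite ftcv; [| bd].
    by rewrite !ftch ?fid2 //; bd.
Defined.

End LaxArrowMap.

Section LaxArrowComposition.
Variable A : two_cat.

Section PasteMor.
Variables (x y : arr_mor A) (e : am_t x = am_s y).

Lemma paste_u0 : cod (am_u0 x) = dom (am_u0 y).
Proof. by rewrite am_dom_t e am_dom_s. Qed.

Lemma paste_u1 : cod (am_u1 x) = dom (am_u1 y).
Proof. by rewrite -am_cod_t e am_cod_s. Qed.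

Lemma paste_y : ccod (cath A) (id2 (am_u0 x)) = cdom (cath A) (am_z y).
Proof. by rewrite hcodE hdomE cdom_id am_dom_z paste_u0. Qed.

Lemma paste_x : ccod (cath A) (am_z x) = cdom (cath A) (id2 (am_u1 y)).
Proof. by rewrite hcodE hdomE cdom_id am_cod_z am_cod_t paste_u1. Qed.

Lemma paste_z : tgt2 (whiskr (am_z y) (am_u0 x) paste_y)
  = src2 (whiskl (am_u1 y) (am_z x) paste_x).
Proof.
have := paste_u0; have := paste_u1; rewrite !tcompE; am_facts x; am_facts y.
by move=> ? ?; bd.
Qed.

Definition paste_mor : arr_mor A.
Proof.
refine (@mk_arr_mor A (comp1 (am_u0 y) (am_u0 x) paste_u0)
  (comp1 (am_u1 y) (am_u1 x) paste_u1) (am_s x) (am_t y)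
  (vcomp (whiskr (am_z y) (am_u0 x) paste_y) (whiskl (am_u1 y) (am_z x) paste_x)
     paste_z) _ _ _ _ _ _);
  have := paste_u0; have := paste_u1; am_facts x; am_facts y => ? ?;
  rewrite ?cdom_comp ?ccod_comp ?tcompE; bd.
Defined.

Lemma paste_mor_z : am_z paste_mor
  = tcv (tch (id2 (am_u1 y)) (am_z x)) (tch (am_z y) (id2 (am_u0 x))).
Proof. by rewrite /= !tcompE. Qed.

Lemma paste_mor_u0 : am_u0 paste_mor = tc1 (am_u0 y) (am_u0 x).
Proof. by rewrite /= tcompE. Qed.

Lemma paste_mor_u1 : am_u1 paste_mor = tc1 (am_u1 y) (am_u1 x).
Proof. by rewrite /= tcompE. Qed.

End PasteMor.

Section PasteCel.
Variables (x y : arr_cel A) (e : ac_t x = ac_s y).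

Lemma paste_m0 : am_t (ac_m0 x) = am_s (ac_m0 y).
Proof. by rewrite -ac_src_t e ac_src_s. Qed.

Lemma paste_m1 : am_t (ac_m1 x) = am_s (ac_m1 y).
Proof. by rewrite -ac_tgt_t e ac_tgt_s. Qed.

Definition paste_cel : arr_cel A.
Proof.
refine (@mk_arr_cel A (paste_mor paste_m0) (paste_mor paste_m1) (ac_s x) (ac_t y)
  _ _ _ _ _ _ _).
- by rewrite /= !tcompE !ac_u0.
- by rewrite /= !tcompE !ac_u1.
- exact: ac_src_s.
- exact: ac_tgt_s.
- exact: ac_src_t.
- exact: ac_tgt_t.
have e0 := paste_u0 paste_m0; have e1 := paste_u1 paste_m0.
have e0' := paste_u0 paste_m1; have e1' := paste_u1 paste_m1.
rewrite /ac_law !paste_mor_z paste_mor_u0 paste_mor_u1.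
ac_facts x; ac_facts y => ly lx.
rewrite -th_id; [| bd].
rewrite -th_id; [| bd].
rewrite -th_A; [| bd | bd].
rewrite tcompA; [| bd | bd].
rewrite -twhiskl; [| bd | bd].
rewrite lx twhiskl; [| bd | bd].
rewrite th_A; [| bd | bd].
rewrite -tcompA; [| bd | bd].
rewrite e -twhiskr; [| bd | bd].
rewrite ly twhiskr; [| bd | bd].
rewrite -th_A; [| bd | bd].
rewrite tcompA; [| bd | bd].
by congr (tcv (tcv (tch (id2 _) _) (tch _ (id2 _))) _).
Defined.

End PasteCel.

(* The composition 2-functor [A^2 x_A A^2 -> A^2]. *)
Definition lax_comp_map k :
  pullback (lax_tgt A) (lax_src A) k -> lax_arrow A k :=
  match k return pullback (lax_tgt A) (lax_src A) k -> lax_arrow A k with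
  | Ob => fun z => @ccomp _ _ (cat1 A) (proj1_sig z).2 (proj1_sig z).1 (proj2_sig z)
  | Mor => fun z => paste_mor (proj2_sig z)
  | Cel => fun z => paste_cel (proj2_sig z)
  end.

Lemma paste_mor_eq x y x' y' e e' :
  x = x' -> y = y' -> @paste_mor x y e = @paste_mor x' y' e'.
Proof. by move=> ex ey; subst; rewrite (proof_irrelevance _ e e'). Qed.

Lemma paste_mor_id v u e (h : cod u = dom v) :
  @paste_mor (arr_id u) (arr_id v) e = arr_id (comp1 v u h).
Proof.
apply: arr_mor_eq => //=; rewrite ?cdom_comp ?ccod_comp //; try exact: ccomp_eq.
by rewrite !tcompE !th_id ?tidl // ccod_id.
Qed.

Lemma paste_mor_comp x' x y' y (hx : am_u1 x = am_u0 x') (hy : am_u1 y = am_u0 y')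
  e1 e2 e3 h :
  @paste_mor (arr_comp hx) (arr_comp hy) e1
  = @arr_comp A (@paste_mor x' y' e2) (@paste_mor x y e3) h.
Proof.
have ? := paste_u0 e2; have ? := paste_u1 e2.
have ? := paste_u0 e3; have ? := paste_u1 e3.
apply: arr_mor_eq; try exact: (@ccomp_eq _ _ (cat1 A)).
rewrite paste_mor_z !arr_comp_z !paste_mor_z.
rewrite [am_s (paste_mor _)]/= [am_t (paste_mor _)]/=.
rewrite [am_u0 _]/= [am_u1 (arr_comp _)]/=.
am_facts x; am_facts y; am_facts x'; am_facts y'.
rewrite twhiskl; [| bd | bd].
rewrite twhiskr; [| bd | bd].
rewrite twhiskr; [| bd | bd].
rewrite twhiskl; [| bd | bd].
have mid : tch (am_z y') (am_z x)
    = tcv (tch (id2 (am_u1 y')) (tch (id2 (am_t x')) (am_z x)))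
        (tch (tch (am_z y') (id2 (am_s y))) (id2 (am_u0 x))).
  rewrite [X in tcv X _]th_A; [| bd | bd].
  rewrite -[X in tcv _ X]th_A; [| bd | bd].
  rewrite th_id; [| bd].
  rewrite th_id; [| bd].
  rewrite -tinterchange; [| bd | bd | bd].
  by rewrite tidl ?tidr //; bd.
have mid' : tch (am_z y') (am_z x)
    = tcv (tch (tch (am_z y') (id2 (am_u0 x'))) (id2 (am_s x)))
        (tch (id2 (am_t y')) (tch (id2 (am_u1 y)) (am_z x))).
  rewrite [X in tcv _ X]th_A; [| bd | bd].
  rewrite -[X in tcv X _]th_A; [| bd | bd].
  rewrite th_id; [| bd].
  rewrite th_id; [| bd].
  rewrite -tinterchange; [| bd | bd | bd].
  by rewrite tidr ?tidl //; bd.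
rewrite -tcompA; [| bd | bd].
rewrite [X in tcv _ X]tcompA; [| bd | bd].
rewrite -mid mid' -[RHS]tcompA; [| bd | bd].
rewrite -[X in tcv _ X]tcompA; [| bd | bd].
by rewrite !th_A //; bd.
Qed.

Lemma lax_comp_ob (w : pullback (lax_tgt A) (lax_src A) Ob) u v h :
  proj1_sig w = (u, v) -> comp1 v u h = lax_comp_map w.
Proof. by case: w => -[u' v'] e /= [? ?]; subst; apply: ccomp_eq. Qed.

Lemma lax_comp_mor (w : pullback (lax_tgt A) (lax_src A) Mor) x y h :
  proj1_sig w = (x, y) -> @paste_mor x y h = lax_comp_map w.
Proof. by case: w => -[u' v'] e /= [? ?]; subst; apply: paste_mor_eq. Qed.

Lemma lax_comp_cel (w : pullback (lax_tgt A) (lax_src A) Cel) x y h :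
  proj1_sig w = (x, y) -> @paste_cel x y h = lax_comp_map w.
Proof.
case: w => -[u' v'] e /= [? ?]; subst.
by rewrite (proof_irrelevance _ h e).
Qed.

Let P := pullback (lax_tgt A) (lax_src A).

Lemma lax_comp_functor1 :
  is_functor (cat1 P) (cat1 (lax_arrow A)) (@lax_comp_map Ob) (@lax_comp_map Mor).
Proof.
split.
- case=> -[x y] h.
  change (comp1 (am_u0 y) (am_u0 x) (paste_u0 h)
    = lax_comp_map (cdom (cat1 P) (exist _ (x, y) h))).
  exact: lax_comp_ob.
- case=> -[x y] h.
  change (comp1 (am_u1 y) (am_u1 x) (paste_u1 h)
    = lax_comp_map (ccod (cat1 P) (exist _ (x, y) h))).
  exact: lax_comp_ob.
- case=> -[u v] h.
  change (@paste_mor (arr_id u) (arr_id v)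
    (proj2_sig (cid (cat1 P) (exist _ (u, v) h))) = arr_id (comp1 v u h)).
  exact: paste_mor_id.
- case=> -[x' y'] h' [[x y] h] e e'.
  have ex : am_u1 x = am_u0 x' by exact (f_equal (fun z : P Ob => (proj1_sig z).1) e).
  have ey : am_u1 y = am_u0 y' by exact (f_equal (fun z : P Ob => (proj1_sig z).2) e).
  have hh : am_t (arr_comp ex) = am_s (arr_comp ey) by exact: (@ccomp_eq _ _ (cat1 A)).
  change (lax_comp_map (@ccomp _ _ (cat1 P) (exist _ (x', y') h') (exist _ (x, y) h) e)
    = @arr_comp A (paste_mor h') (paste_mor h) e').
  rewrite -(paste_mor_comp hh); apply/esym; apply: lax_comp_mor.
  by congr pair; apply: (@ccomp_eq _ _ (lax_cat1 A)).
Qed.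

Lemma lax_comp_functorv :
  is_functor (catv P) (catv (lax_arrow A)) (@lax_comp_map Mor) (@lax_comp_map Cel).
Proof.
split.
- case=> -[x y] h.
  change (paste_mor (paste_m0 h)
    = lax_comp_map (cdom (catv P) (exist _ (x, y) h))).
  exact: lax_comp_mor.
- case=> -[x y] h.
  change (paste_mor (paste_m1 h)
    = lax_comp_map (ccod (catv P) (exist _ (x, y) h))).
  exact: lax_comp_mor.
- case=> -[x y] h.
  change (@paste_cel (arr_cel_id x) (arr_cel_id y)
    (proj2_sig (cid (catv P) (exist _ (x, y) h))) = arr_cel_id (paste_mor h)).
  by apply: arr_cel_eq => //; apply: paste_mor_eq.
- case=> -[x' y'] h' [[x y] h] e e'.
  have ex : ac_m1 x = ac_m0 x' by exact (f_equal (fun z : P Mor => (proj1_sig z).1) e).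
  have ey : ac_m1 y = ac_m0 y' by exact (f_equal (fun z : P Mor => (proj1_sig z).2) e).
  have hh : ac_t (arr_vcomp ex) = ac_s (arr_vcomp ey) by exact: (@ccomp_eq _ _ (catv A)).
  change (lax_comp_map (@ccomp _ _ (catv P) (exist _ (x', y') h') (exist _ (x, y) h) e)
    = @arr_vcomp A (paste_cel h') (paste_cel h) e').
  apply: etrans (esym (@lax_comp_cel _ _ _ hh _)) _.
    by congr pair; apply: (@ccomp_eq _ _ (lax_catv A)).
  apply: arr_cel_eq; [exact: paste_mor_eq | exact: paste_mor_eq | |];
  exact: (@ccomp_eq _ _ (catv A)).
Qed.

Lemma lax_comp_functorh :
  is_functor (cath P) (cath (lax_arrow A)) (@lax_comp_map Ob) (@lax_comp_map Cel).
Proof.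
split.
- case=> -[x y] h.
  change (comp1 (am_u0 (ac_m0 y)) (am_u0 (ac_m0 x)) (paste_u0 (paste_m0 h))
    = lax_comp_map (cdom (cath P) (exist _ (x, y) h))).
  exact: lax_comp_ob.
- case=> -[x y] h.
  change (comp1 (am_u1 (ac_m0 y)) (am_u1 (ac_m0 x)) (paste_u1 (paste_m0 h))
    = lax_comp_map (ccod (cath P) (exist _ (x, y) h))).
  exact: lax_comp_ob.
- case=> -[u v] h.
  change (@paste_cel (arr_cel_id (arr_id u)) (arr_cel_id (arr_id v))
    (proj2_sig (cid (cath P) (exist _ (u, v) h)))
    = arr_cel_id (arr_id (comp1 v u h))).
  by apply: arr_cel_eq; [exact: paste_mor_id | exact: paste_mor_id | |];
    rewrite /= ?cdom_comp ?ccod_comp.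
- case=> -[x' y'] h' [[x y] h] e e'.
  have ex : am_u1 (ac_m0 x) = am_u0 (ac_m0 x')
    by exact (f_equal (fun z : P Ob => (proj1_sig z).1) e).
  have ey : am_u1 (ac_m0 y) = am_u0 (ac_m0 y')
    by exact (f_equal (fun z : P Ob => (proj1_sig z).2) e).
  have hh : ac_t (arr_hcomp ex) = ac_s (arr_hcomp ey) by exact: (@ccomp_eq _ _ (cath A)).
  change (lax_comp_map (@ccomp _ _ (cath P) (exist _ (x', y') h') (exist _ (x, y) h) e)
    = @arr_hcomp A (paste_cel h') (paste_cel h) e').
  apply: etrans (esym (@lax_comp_cel _ _ _ hh _)) _.
    by congr pair; apply: (@ccomp_eq _ _ (lax_cath A)).
  apply: arr_cel_eq; [exact: paste_mor_comp | exact: paste_mor_comp | |];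
  exact: (@ccomp_eq _ _ (cath A)).
Qed.

Definition lax_comp : two_functor P (lax_arrow A) :=
  TwoFunctor lax_comp_functor1 lax_comp_functorv lax_comp_functorh.

End LaxArrowComposition.

(* Split two-sided 2-fibrations. All equations between 2-functors are stated  *)
(* on objects, morphisms and cells at once, by quantifying over the level. The*)
(* matching conditions [e1, ..., e4] follow from the other ones and from the  *)
(* first four equations.                                                      *)

Record two_fib (A B : two_cat) := TwoFib {
  fib :> two_cat;
  legp : two_functor fib A;
  legq : two_functor fib B;
  lam : two_functor (pullback (lax_tgt A) legp) fib;
  rho : two_functor (pullback legq (lax_src B)) fib;
  p_lam : forall k x i e, legp k (lam k (pb x i e)) = lax_src A k x;
  q_lam : forall k x i e, legq k (lam k (pb x i e)) = legq k i;
  p_rho : forall k i y e, legp k (rho k (pb i y e)) = legp k i;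
  q_rho : forall k i y e, legq k (rho k (pb i y e)) = lax_tgt B k y;
  lam_comp : forall k x y i exy e e1 e2,
    lam k (pb (lax_comp A k (pb x y exy)) i e1)
    = lam k (pb x (lam k (pb y i e)) e2);
  lam_unit : forall k i e, lam k (pb (lax_unit A k (legp k i)) i e) = i;
  rho_comp : forall k i x y exy e e1 e2,
    rho k (pb i (lax_comp B k (pb x y exy)) e1)
    = rho k (pb (rho k (pb i x e)) y e2);
  rho_unit : forall k i e, rho k (pb i (lax_unit B k (legq k i)) e) = i;
  rho_lam : forall k x i y e1 e2 e3 e4,
    rho k (pb (lam k (pb x i e1)) y e2) = lam k (pb x (rho k (pb i y e3)) e4)
}.

(* The morphisms and cells of [A^2] from which the cleavages are obtained. *)

Section CleavageData.
Variable A : two_cat.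

(* [(u, id_u, id_b) : (a, u, b) -> (b, id_b, b)] for [u : a -> b] *)
Definition arr_to_id (u : A Mor) : arr_mor A.
Proof.
refine (@mk_arr_mor A u (id1 (cod u)) u (id1 (cod u)) (id2 u) _ _ _ _ _ _).
- by [].
- by rewrite cdom_id.
- by rewrite cdom_id.
- by [].
- by rewrite cdom_id tidl.
- by rewrite ccod_id tidl.
Defined.

(* [(id_a, id_v, v) : (a, id_a, a) -> (a, v, b)] for [v : a -> b] *)
Definition arr_from_id (v : A Mor) : arr_mor A.
Proof.
refine (@mk_arr_mor A (id1 (dom v)) v (id1 (dom v)) v (id2 v) _ _ _ _ _ _).
- by [].
- by rewrite ccod_id.
- by rewrite ccod_id.
- by [].
- by rewrite cdom_id tidr.
- by rewrite ccod_id tidr.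
Defined.

(* [(b, id_s) : (s, id_s, s) => (t, b, s)] for [b : s => t] *)
Definition cel_from_unit (b : A Cel) : arr_cel A.
Proof.
refine (@mk_arr_cel A (unit_mor (src2 b)) (arr_of_cel b) b (id2 (src2 b))
  erefl erefl erefl erefl _ _ _).
- by rewrite cdom_id.
- by rewrite ccod_id.
by rewrite /ac_law /= th_idl // th_idr ?cdom_id // !tidr.
Defined.

(* [(id_t, b) : (t, b, s) => (t, id_t, t)] for [b : s => t] *)
Definition cel_to_unit (b : A Cel) : arr_cel A.
Proof.
refine (@mk_arr_cel A (arr_of_cel b) (unit_mor (tgt2 b)) (id2 (tgt2 b)) b
  _ _ _ _ erefl erefl _).
- by rewrite /= dom_tgt2.
- by rewrite /= cod_tgt2.
- by rewrite cdom_id.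
- by rewrite ccod_id.
by rewrite /ac_law /= th_idr // th_idl ?cdom_id ?cod_tgt2 // !tidl.
Defined.

End CleavageData.

(* [lam_mor u i : u^* i -> i], [lam_cel s a : s => a_! s],                    *)
(* [rho_mor i v : i -> v_! i] and [rho_cel b s : b^* s => s].                 *)

Section Cleavage.
Variables (A B : two_cat) (J : two_fib A B).

Lemma lam_mor_match u (i : J Ob) : cod u = legp J Ob i ->
  lax_tgt A Mor (arr_to_id u) = legp J Mor (id1 i).
Proof. by move=> e; rewrite fid1 -e. Qed.

Definition lam_mor (u : A Mor) (i : J Ob) (e : cod u = legp J Ob i) : J Mor :=
  lam J Mor (pb (F := lax_tgt A) (k := Mor) (arr_to_id u) (id1 i) (lam_mor_match e)).

Lemma lam_cel_match (s : J Mor) a : src2 a = legp J Mor s ->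
  lax_tgt A Cel (cel_from_unit a) = legp J Cel (id2 s).
Proof. by move=> e; rewrite fid2 -e. Qed.

Definition lam_cel (s : J Mor) (a : A Cel) (e : src2 a = legp J Mor s) : J Cel :=
  lam J Cel (pb (F := lax_tgt A) (k := Cel) (cel_from_unit a) (id2 s)
    (lam_cel_match e)).

Lemma rho_mor_match (i : J Ob) v : legq J Ob i = dom v ->
  legq J Mor (id1 i) = lax_src B Mor (arr_from_id v).
Proof. by move=> e; rewrite fid1 e. Qed.

Definition rho_mor (i : J Ob) (v : B Mor) (e : legq J Ob i = dom v) : J Mor :=
  rho J Mor (pb (G := lax_src B) (k := Mor) (id1 i) (arr_from_id v) (rho_mor_match e)).

Lemma rho_cel_match b (s : J Mor) : legq J Mor s = tgt2 b ->
  legq J Cel (id2 s) = lax_src B Cel (cel_to_unit b).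
Proof. by move=> e; rewrite fid2 e. Qed.

Definition rho_cel (b : B Cel) (s : J Mor) (e : legq J Mor s = tgt2 b) : J Cel :=
  rho J Cel (pb (G := lax_src B) (k := Cel) (id2 s) (cel_to_unit b)
    (rho_cel_match e)).

Lemma q_lam_mor u i e : legq J Mor (@lam_mor u i e) = legq J Mor (id1 i).
Proof. exact: q_lam. Qed.
Lemma q_lam_cel s a e : legq J Cel (@lam_cel s a e) = legq J Cel (id2 s).
Proof. exact: q_lam. Qed.
Lemma p_rho_mor i v e : legp J Mor (@rho_mor i v e) = legp J Mor (id1 i).
Proof. exact: p_rho. Qed.
Lemma p_rho_cel b s e : legp J Cel (@rho_cel b s e) = legp J Cel (id2 s).
Proof. exact: p_rho. Qed.
Lemma p_lam_mor u i e : legp J Mor (@lam_mor u i e) = u.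
Proof. exact: p_lam. Qed.
Lemma p_lam_cel s a e : legp J Cel (@lam_cel s a e) = a.
Proof. exact: p_lam. Qed.
Lemma q_rho_mor i v e : legq J Mor (@rho_mor i v e) = v.
Proof. exact: q_rho. Qed.
Lemma q_rho_cel b s e : legq J Cel (@rho_cel b s e) = b.
Proof. exact: q_rho. Qed.

End Cleavage.
Arguments lam_mor {A B} J u i e.
Arguments lam_cel {A B} J s a e.
Arguments rho_mor {A B} J i v e.
Arguments rho_cel {A B} J b s e.

(* Iterated spans of length [n.+1], with components [J_0, ..., J_n] and       *)
(* vertices [A_0, ..., A_(n.+1)]; the values [A m] for larger [m] are unused. *)
(* A junction [l : 'I_n] is the vertex [A_(l.+1)] between [J_l] and [J_(l.+1)]*)

Definition ljoin n (l : 'I_n) : 'I_n.+1 := widen_ord (leqnSn n) l.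
Definition rjoin n (l : 'I_n) : 'I_n.+1 := @Ordinal n.+1 l.+1 (ltn_ord l).

Lemma dfwith_ind (I : eqType) (T : I -> Type) (P : forall i, T i -> Prop)
  (f : forall i, T i) (i : I) (v : T i) :
  P i v -> (forall j, j != i -> P j (f j)) -> forall j, P j (dfwith f v j).
Proof. by move=> Pv Pf j; case: dfwithP => // k ik; apply: Pf; rewrite eq_sym. Qed.

Section IteratedSpan.
Variables (n : nat) (A : nat -> two_cat).
Variable J : forall m : 'I_n.+1, two_fib (A m) (A m.+1).

Definition matched (l : 'I_n) k (i : forall m, J m k) : Prop :=
  legq (J (ljoin l)) k (i (ljoin l)) = legp (J (rjoin l)) k (i (rjoin l))
  :> A l.+1 k.

Lemma tuples_subcat (S : pred 'I_n) :
  @is_subcat2 (dprod2 (fun m => J m : two_cat))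
    (fun k i => forall l, S l -> matched l i).
Proof.
have H k k' (X : forall B : two_cat, cat_on (B k) (B k')) :
    (forall B C (F : two_functor B C), is_functor (X B) (X C) (F k) (F k')) ->
    is_subcat (dprod_cat (fun m => X (J m)))
      (fun i => forall l, S l -> matched l i)
      (fun i => forall l, S l -> matched l i).
  rewrite /matched => XF; split=> [i|i|i|j i e] /=.
  - move=> Hi l Sl.
    by rewrite -(is_fdom (XF _ _ (legq _))) -(is_fdom (XF _ _ (legp _))) Hi.
  - move=> Hi l Sl.
    by rewrite -(is_fcod (XF _ _ (legq _))) -(is_fcod (XF _ _ (legp _))) Hi.
  - move=> Hi l Sl.
    by rewrite (is_fid (XF _ _ (legq _))) (is_fid (XF _ _ (legp _))) Hi.
  - move=> Hj Hi l Sl.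
    have E m := f_equal (fun a => a m) e.
    have e1 : ccod (X (A l.+1)) (legq (J (ljoin l)) k' (i (ljoin l)))
        = cdom (X (A l.+1)) (legq (J (ljoin l)) k' (j (ljoin l))).
      rewrite (is_fcod (XF _ _ (legq _))) (is_fdom (XF _ _ (legq _))).
      by congr (legq _ k _); exact: E.
    have e2 : ccod (X (A l.+1)) (legp (J (rjoin l)) k' (i (rjoin l)))
        = cdom (X (A l.+1)) (legp (J (rjoin l)) k' (j (rjoin l))).
      rewrite (is_fcod (XF _ _ (legp _))) (is_fdom (XF _ _ (legp _))).
      by congr (legp _ k _); exact: E.
    rewrite (is_fcomp (XF _ _ (legq _)) _ e1) (is_fcomp (XF _ _ (legp _)) _ e2).
    by apply: ccomp_eq; [exact: Hj | exact: Hi].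
split.
- by apply: H => B C F; exact: functor1.
- by apply: H => B C F; exact: functorv.
- by apply: H => B C F; exact: functorh.
Qed.

(* Tuples matching at the junctions in [S]. *)
Definition tuples (S : pred 'I_n) : two_cat := sub2 (tuples_subcat S).

(* [J_0 x_(A_1) ... x_(A_n) J_n] *)
Definition prod_path : two_cat := tuples xpredT.

(* The product of the pullbacks of [J_0, ..., J_l] and [J_(l.+1), ..., J_n]:  *)
(* a pair of tuples is one tuple that need not match at the junction [l].     *)
Definition split_path (l : 'I_n) : two_cat := tuples (predC1 l).

Definition coord (S : pred 'I_n) k (i : tuples S k) m : J m k := proj1_sig i m.

(* The tuples [(v, i_1, ..., i_n)] and [(i_0, ..., i_(n-1), v)]. *)

Lemma set_first_match k (i : prod_path k) (v : J ord0 k) :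
  legq (J ord0) k v = legq (J ord0) k (coord i ord0) ->
  forall l, true -> matched l (dfwith (coord i) v).
Proof.
move=> e l _; rewrite /matched [in RHS]dfwith_out //.
apply: etrans _ (proj2_sig i l isT).
exact: (@dfwith_ind _ _ (fun m w => legq (J m) k w = legq (J m) k (coord i m))
  (coord i) ord0 v e (fun _ _ => erefl) (ljoin l)).
Qed.

Definition set_first k (i : prod_path k) (v : J ord0 k)
  (e : legq (J ord0) k v = legq (J ord0) k (coord i ord0)) : prod_path k :=
  exist _ (dfwith (coord i) v) (set_first_match e).

Lemma set_last_match k (i : prod_path k) (v : J ord_max k) :
  legp (J ord_max) k v = legp (J ord_max) k (coord i ord_max) ->
  forall l, true -> matched l (dfwith (coord i) v).
Proof.
move=> e l _; rewrite /matched [in LHS]dfwith_out; last first.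
  by rewrite -val_eqE /= neq_ltn ltn_ord orbT.
apply: etrans (proj2_sig i l isT) _; apply/esym.
exact: (@dfwith_ind _ _ (fun m w => legp (J m) k w = legp (J m) k (coord i m))
  (coord i) ord_max v e (fun _ _ => erefl) (rjoin l)).
Qed.

Definition set_last k (i : prod_path k) (v : J ord_max k)
  (e : legp (J ord_max) k v = legp (J ord_max) k (coord i ord_max)) : prod_path k :=
  exist _ (dfwith (coord i) v) (set_last_match e).

(* The tuple [(i_0, ..., i_(l-1), v, w, i_(l+2), ..., i_n)]. *)

Lemma set_join_match l k (i : split_path l k) (v : J (ljoin l) k)
  (w : J (rjoin l) k) :
  legp (J (ljoin l)) k v = legp (J (ljoin l)) k (coord i (ljoin l)) ->
  legq (J (rjoin l)) k w = legq (J (rjoin l)) k (coord i (rjoin l)) ->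
  legq (J (ljoin l)) k v = legp (J (rjoin l)) k w :> A l.+1 k ->
  forall l', true -> matched l' (dfwith (dfwith (coord i) v) w).
Proof.
move=> ev ew evw l' _; rewrite /matched.
have [->|ne] := eqVneq l' l.
  have lr : rjoin l != ljoin l by rewrite -val_eqE /= neq_ltn leqnn orbT.
  by rewrite dfwith_in dfwith_out // dfwith_in.
have nl : ljoin l != ljoin l' by rewrite -val_eqE /= eq_sym.
have nr : rjoin l != rjoin l' by rewrite -val_eqE /= eqSS eq_sym.
transitivity (legq (J (ljoin l')) k (coord i (ljoin l'))).
  have : ljoin l' != ljoin l by rewrite eq_sym.
  apply: (@dfwith_ind _ _ (fun m u => m != ljoin l ->
    legq (J m) k u = legq (J m) k (coord i m))) => // m _ nm.
  by rewrite dfwith_out // eq_sym.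
rewrite [in RHS]dfwith_out //.
apply: etrans (proj2_sig i l' ne) _; apply/esym.
exact: (@dfwith_ind _ _ (fun m u => legp (J m) k u = legp (J m) k (coord i m))
  (coord i) (ljoin l) v ev (fun _ _ => erefl) (rjoin l')).
Qed.

Definition set_join l k (i : split_path l k) (v : J (ljoin l) k)
  (w : J (rjoin l) k)
  (ev : legp (J (ljoin l)) k v = legp (J (ljoin l)) k (coord i (ljoin l)))
  (ew : legq (J (rjoin l)) k w = legq (J (rjoin l)) k (coord i (rjoin l)))
  (evw : legq (J (ljoin l)) k v = legp (J (rjoin l)) k w :> A l.+1 k) :
  prod_path k :=
  exist _ (dfwith (dfwith (coord i) v) w) (set_join_match ev ew evw).

End IteratedSpan.

Section UnaryCells.
Variables (n : nat) (A : nat -> two_cat).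
Variable J : forall m : 'I_n.+1, two_fib (A m) (A m.+1).
Variables (C D : two_cat) (K : two_fib C D).
Variables (f : two_functor (A 0) C) (g : two_functor (A n.+1) D).

(* 2-functors [J_0 x ... x J_n -> K] over [f] and [g] *)
Record functor_over := FunctorOver {
  fover :> two_functor (prod_path J) K;
  over_p : forall k (i : prod_path J k),
    legp K k (fover k i) = f k (legp (J ord0) k (coord i ord0));
  over_q : forall k (i : prod_path J k),
    legq K k (fover k i) = g k (legq (J ord_max) k (coord i ord_max))
}.

Variable phi : functor_over.

Lemma lax_src_map B E (h : two_functor B E) k (x : lax_arrow B k) :
  lax_src E k (lax_map h k x) = h k (lax_src B k x).
Proof. by case: k x => //= u; exact: fdom. Qed.

Lemma lax_tgt_map B E (h : two_functor B E) k (x : lax_arrow B k) :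
  lax_tgt E k (lax_map h k x) = h k (lax_tgt B k x).
Proof. by case: k x => //= u; exact: fcod. Qed.

Lemma lax_left_match k (x : lax_arrow (A 0) k) (i : prod_path J k) :
  lax_tgt (A 0) k x = legp (J ord0) k (coord i ord0) ->
  lax_tgt C k (lax_map f k x) = legp K k (phi k i).
Proof. by move=> e; rewrite lax_tgt_map e over_p. Qed.

Lemma lax_right_match k (i : prod_path J k) (y : lax_arrow (A n.+1) k) :
  legq (J ord_max) k (coord i ord_max) = lax_src (A n.+1) k y ->
  legq K k (phi k i) = lax_src D k (lax_map g k y).
Proof. by move=> e; rewrite lax_src_map -e over_q. Qed.

(* phi(lam(x, i_0), i_1, ..., i_n) = lam(f^2 x, phi(i_0, ..., i_n)) *)
Definition equivariant_left : Prop :=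
  forall k (x : lax_arrow (A 0) k) (i : prod_path J k)
    (e : lax_tgt (A 0) k x = legp (J ord0) k (coord i ord0)),
  phi k (set_first (v := lam (J ord0) k (pb x (coord i ord0) e)) (q_lam e))
  = lam K k (pb (lax_map f k x) (phi k i) (lax_left_match e)).

(* phi(i_0, ..., i_(n-1), rho(i_n, y)) = rho(phi(i_0, ..., i_n), g^2 y) *)
Definition equivariant_right : Prop :=
  forall k (i : prod_path J k) (y : lax_arrow (A n.+1) k)
    (e : legq (J ord_max) k (coord i ord_max) = lax_src (A n.+1) k y),
  phi k (set_last (v := rho (J ord_max) k (pb (coord i ord_max) y e)) (p_rho e))
  = rho K k (pb (phi k i) (lax_map g k y) (lax_right_match e)).

(* phi(..., rho(i_l, x), i_(l+1), ...) = phi(..., i_l, lam(x, i_(l+1)), ...) *)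
Definition equivariant_inner : Prop :=
  forall (l : 'I_n) k (i : split_path J l k) (x : lax_arrow (A l.+1) k)
    (e1 : legq (J (ljoin l)) k (coord i (ljoin l)) = lax_src (A l.+1) k x)
    (e2 : lax_tgt (A l.+1) k x = legp (J (rjoin l)) k (coord i (rjoin l))),
  phi k (set_join (v := rho (J (ljoin l)) k (pb (coord i (ljoin l)) x e1))
           (p_rho e1) erefl (etrans (q_rho e1) e2))
  = phi k (set_join (w := lam (J (rjoin l)) k (pb x (coord i (rjoin l)) e2))
           erefl (q_lam e2) (etrans e1 (esym (p_lam e2)))).

Definition is_unary_cell : Prop :=
  [/\ equivariant_left, equivariant_right & equivariant_inner].

Lemma pcm_match (i : prod_path J Ob) (u : A 0 Mor) :
  cod u = legp (J ord0) Ob (coord i ord0) ->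
  cod (f Mor u) = legp K Ob (phi Ob i).
Proof. by move=> e; rewrite fcod e over_p. Qed.

Lemma poc_match (s : prod_path J Mor) (a : A 0 Cel) :
  src2 a = legp (J ord0) Mor (coord s ord0) ->
  src2 (f Cel a) = legp K Mor (phi Mor s).
Proof. by move=> e; rewrite fsrc2 e over_p. Qed.

Lemma pom_match (i : prod_path J Ob) (v : A n.+1 Mor) :
  legq (J ord_max) Ob (coord i ord_max) = dom v ->
  legq K Ob (phi Ob i) = dom (g Mor v).
Proof. by move=> e; rewrite fdom -e over_q. Qed.

Lemma pcc_match (s : prod_path J Mor) (b : A n.+1 Cel) :
  legq (J ord_max) Mor (coord s ord_max) = tgt2 b ->
  legq K Mor (phi Mor s) = tgt2 (g Cel b).
Proof. by move=> e; rewrite ftgt2 -e over_q. Qed.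

(* [id1 i] and [id2 s] below are the tuples of identities.                    *)
(* pcm: phi(lam(u, i_0), id, ..., id) = lam(f u, phi i)                       *)
(* poc: phi(lam(s_0, a), id, ..., id) = lam(phi s, f a)                       *)
(* iem: phi(id, ..., rho(i_l, u), lam(u, i_(l+1)), ..., id) is an identity    *)
(* iec: phi(id, ..., rho(a, s_l), lam(s_(l+1), a), ..., id) is an identity    *)
(* pom: phi(id, ..., id, rho(i_n, v)) = rho(phi i, g v)                       *)
(* pcc: phi(id, ..., id, rho(b, s_n)) = rho(g b, phi s)                       *)

Definition pcm : Prop :=
  forall (i : prod_path J Ob) (u : A 0 Mor)
    (e : cod u = legp (J ord0) Ob (coord i ord0)),
  phi Mor (set_first (i := id1 i) (v := lam_mor (J ord0) u (coord i ord0) e)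
             (q_lam_mor e))
  = lam_mor K (f Mor u) (phi Ob i) (pcm_match e).

Definition poc : Prop :=
  forall (s : prod_path J Mor) (a : A 0 Cel)
    (e : src2 a = legp (J ord0) Mor (coord s ord0)),
  phi Cel (set_first (i := id2 s) (v := lam_cel (J ord0) (coord s ord0) a e)
             (q_lam_cel e))
  = lam_cel K (phi Mor s) (f Cel a) (poc_match e).

Definition iem : Prop :=
  forall (l : 'I_n) (i : split_path J l Ob) (u : A l.+1 Mor)
    (e1 : legq (J (ljoin l)) Ob (coord i (ljoin l)) = dom u)
    (e2 : cod u = legp (J (rjoin l)) Ob (coord i (rjoin l))),
  exists c : K Ob,
  phi Mor (set_join (i := id1 i)
             (v := rho_mor (J (ljoin l)) (coord i (ljoin l)) u e1)
             (w := lam_mor (J (rjoin l)) u (coord i (rjoin l)) e2)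
             (p_rho_mor e1) (q_lam_mor e2)
             (etrans (q_rho_mor e1) (esym (p_lam_mor e2))))
  = id1 c.

Definition iec : Prop :=
  forall (l : 'I_n) (s : split_path J l Mor) (a : A l.+1 Cel)
    (e1 : legq (J (ljoin l)) Mor (coord s (ljoin l)) = tgt2 a)
    (e2 : src2 a = legp (J (rjoin l)) Mor (coord s (rjoin l))),
  exists r : K Mor,
  phi Cel (set_join (i := id2 s)
             (v := rho_cel (J (ljoin l)) a (coord s (ljoin l)) e1)
             (w := lam_cel (J (rjoin l)) (coord s (rjoin l)) a e2)
             (p_rho_cel e1) (q_lam_cel e2)
             (etrans (q_rho_cel e1) (esym (p_lam_cel e2))))
  = id2 r.

Definition pom : Prop :=
  forall (i : prod_path J Ob) (v : A n.+1 Mor)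
    (e : legq (J ord_max) Ob (coord i ord_max) = dom v),
  phi Mor (set_last (i := id1 i) (v := rho_mor (J ord_max) (coord i ord_max) v e)
             (p_rho_mor e))
  = rho_mor K (phi Ob i) (g Mor v) (pom_match e).

Definition pcc : Prop :=
  forall (s : prod_path J Mor) (b : A n.+1 Cel)
    (e : legq (J ord_max) Mor (coord s ord_max) = tgt2 b),
  phi Cel (set_last (i := id2 s) (v := rho_cel (J ord_max) b (coord s ord_max) e)
             (p_rho_cel e))
  = rho_cel K (g Cel b) (phi Mor s) (pcc_match e).

End UnaryCells.

(* Main.v *)
Require Import Defs.
From mathcomp Require Import all_boot.
From Stdlib Require Import FunctionalExtensionality ProofIrrelevance.
From Stdlib Require Import ClassicalEpsilon.

(** A unary cell has to commute with the actions of the whole lax arrow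
2-categories, while the six conditions only mention the actions of very special
morphisms and cells, the cleavages. They suffice because the special ones
generate. In [A^2], let [x : m0 => m1] be a cell and [m = (s, z, t)] a
morphism. Composing [m] with [arr_to_id (cod m)] gives the pasting of the cell
[z], seen as a morphism between identities, with [t o arr_to_id (dom m)];
whiskering [x] in the same way gives a square of cells whose other sides are a
pasting of [z0], a pasting of [z1] and the target component of [x]
([to_id_cell_natural]). Applying [lam] turns this into
  [lam(_, z0) (.) (lam(u1, i1) o lam(x, c)) = (c o lam(u0, i0)) (.) lam(_, z1)]
with two cleavages on either side ([left_decomposition]). The situation is
mirrored for [arr_from_id] and [rho].

For the two outer equivariance axioms, [phi] sends this equation to the
corresponding equation in [K], by pcm and poc (pom and pcc in the mirrored
case). So [phi (lam(x, c))] and [lam(f^2 x, phi c)] become equal after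
composition with two cleavages. These can be cancelled: a cleavage of [p] is
cartesian on morphisms and opcartesian on cells, and the two candidates have
the same image under [p] ([lam_lift1_mono], [lam_lift2_epi],
[left_equivariantP]; for [rho], [right_equivariantP]).

For the inner axiom both actions at the junction are combined into [bact x i y
= lam(x, rho(i, y))]. The pairs of cleavages in iem and iec are then the
morphisms [bact (arr_to_id u) id (arr_from_id u)] from [lam(u, i)] to [rho(i,
u)], and similarly cells in the other direction, and the two squares in [A^2]
combine into a naturality square between [lam(x, c)] and [rho(c, x)] with these
as its remaining sides ([junction_decomposition]). If [phi] sends all of them
to identities, it identifies [rho(c, x)] with [lam(x, c)]. Conversely,
equivariance turns such a morphism into [phi] of the action of the pasting of
[arr_from_id u] and [arr_to_id u], and this pasting is an identity
([balancedP]).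

It is enough to treat cells, since a morphism is determined by its identity
cell and an object by its identity morphism. All of this concerns a single
fibration with two actions; it applies to iterated spans since tuples matching
at a set of junctions form a split two-sided 2-fibration, with [lam] acting at
one free coordinate and [rho] at another ([tuples_fib]). For the outer axioms
they are the first and the last coordinate; for the inner axiom at a junction
the matching is dropped there, and they are the two coordinates next to it. *)

Set Implicit Arguments.
Unset Strict Implicit.
Unset Printing Implicit Defensive.

(** * Total application of a 2-functor on a pullback *)

(** A 2-functor on a strict pullback takes a matching proof with each argument,
and rewriting inside the arguments would have to transport it. The functions
below make the proof a side condition of the lemmas instead. *)

Section TotalApplication.
Variables (A B C E : two_cat) (F : two_functor A C) (G : two_functor B C).
Variables (H : two_functor (pullback F G) E) (d : forall k, A k -> B k -> E k).

(** A default [d] is supplied since [E] may be empty. *)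
Definition tapp k (x : A k) (y : B k) : E k :=
  match excluded_middle_informative (F k x = G k y) with
  | left e => H k (pb x y e)
  | right _ => d x y
  end.

Lemma tappE k (x : A k) (y : B k) e : H k (pb x y e) = tapp x y.
Proof.
by rewrite /tapp; case: excluded_middle_informative => // e';
  rewrite (proof_irrelevance _ e e').
Qed.

Lemma tapp_dom (x : A Mor) (y : B Mor) : F Mor x = G Mor y ->
  dom (tapp x y) = tapp (dom x) (dom y).
Proof.
move=> e; have e' : F Ob (dom x) = G Ob (dom y) by rewrite -!fdom e.
by rewrite -(tappE e) -(tappE e') fdom; congr (H Ob _); apply: sig_eq.
Qed.

Lemma tapp_cod (x : A Mor) (y : B Mor) : F Mor x = G Mor y ->
  cod (tapp x y) = tapp (cod x) (cod y).
Proof.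
move=> e; have e' : F Ob (cod x) = G Ob (cod y) by rewrite -!fcod e.
by rewrite -(tappE e) -(tappE e') fcod; congr (H Ob _); apply: sig_eq.
Qed.

Lemma tapp_src2 (x : A Cel) (y : B Cel) : F Cel x = G Cel y ->
  src2 (tapp x y) = tapp (src2 x) (src2 y).
Proof.
move=> e; have e' : F Mor (src2 x) = G Mor (src2 y) by rewrite -!fsrc2 e.
by rewrite -(tappE e) -(tappE e') fsrc2; congr (H Mor _); apply: sig_eq.
Qed.

Lemma tapp_tgt2 (x : A Cel) (y : B Cel) : F Cel x = G Cel y ->
  tgt2 (tapp x y) = tapp (tgt2 x) (tgt2 y).
Proof.
move=> e; have e' : F Mor (tgt2 x) = G Mor (tgt2 y) by rewrite -!ftgt2 e.
by rewrite -(tappE e) -(tappE e') ftgt2; congr (H Mor _); apply: sig_eq.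
Qed.

Lemma tapp_id1 (x : A Ob) (y : B Ob) : F Ob x = G Ob y ->
  tapp (id1 x) (id1 y) = id1 (tapp x y).
Proof.
move=> e; have e' : F Mor (id1 x) = G Mor (id1 y) by rewrite !fid1 e.
by rewrite -(tappE e) -(tappE e') -fid1; congr (H Mor _); apply: sig_eq.
Qed.

Lemma tapp_id2 (x : A Mor) (y : B Mor) : F Mor x = G Mor y ->
  tapp (id2 x) (id2 y) = id2 (tapp x y).
Proof.
move=> e; have e' : F Cel (id2 x) = G Cel (id2 y) by rewrite !fid2 e.
by rewrite -(tappE e) -(tappE e') -fid2; congr (H Cel _); apply: sig_eq.
Qed.

Lemma tapp_tc1 (x x' : A Mor) (y y' : B Mor) :
  F Mor x = G Mor y -> F Mor x' = G Mor y' ->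
  cod x = dom x' -> cod y = dom y' ->
  tapp (tc1 x' x) (tc1 y' y) = tc1 (tapp x' y') (tapp x y).
Proof.
move=> e e' ex ey.
have ee : F Mor (tc1 x' x) = G Mor (tc1 y' y) by rewrite !ftc1 // e e'.
rewrite -(tappE e) -(tappE e') -(tappE ee).
have c : cod (pb x y e : pullback F G Mor)
  = dom (pb x' y' e' : pullback F G Mor).
  by apply: sig_eq => /=; rewrite ex ey.
rewrite -ftc1 //; congr (H Mor _); apply: sig_eq.
by rewrite -(tcompE c) /= !tcompE.
Qed.

Lemma tapp_tcv (x x' : A Cel) (y y' : B Cel) :
  F Cel x = G Cel y -> F Cel x' = G Cel y' ->
  tgt2 x = src2 x' -> tgt2 y = src2 y' ->
  tapp (tcv x' x) (tcv y' y) = tcv (tapp x' y') (tapp x y).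
Proof.
move=> e e' ex ey.
have ee : F Cel (tcv x' x) = G Cel (tcv y' y) by rewrite !ftcv // e e'.
rewrite -(tappE e) -(tappE e') -(tappE ee).
have c : tgt2 (pb x y e : pullback F G Cel)
  = src2 (pb x' y' e' : pullback F G Cel).
  by apply: sig_eq => /=; rewrite ex ey.
rewrite -ftcv //; congr (H Cel _); apply: sig_eq.
by rewrite -(tcompE c) /= !tcompE.
Qed.

Lemma tapp_tch (x x' : A Cel) (y y' : B Cel) :
  F Cel x = G Cel y -> F Cel x' = G Cel y' ->
  cod (src2 x) = dom (src2 x') -> cod (src2 y) = dom (src2 y') ->
  tapp (tch x' x) (tch y' y) = tch (tapp x' y') (tapp x y).
Proof.
move=> e e' ex ey.
have ee : F Cel (tch x' x) = G Cel (tch y' y) by rewrite !ftch // e e'.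
rewrite -(tappE e) -(tappE e') -(tappE ee).
have c : ccod (cath (pullback F G)) (pb x y e)
  = cdom (cath (pullback F G)) (pb x' y' e').
  by apply: sig_eq; rewrite /= !hcodE !hdomE ex ey.
rewrite -ftch; last by rewrite -hcodE c hdomE.
congr (H Cel _); apply: sig_eq.
by rewrite -(tcompE c) /= !tcompE.
Qed.

End TotalApplication.

Notation tlam J := (tapp (lam J) (fun _ _ i => i)).
Notation trho J := (tapp (rho J) (fun _ i _ => i)).
Notation tpaste A := (tapp (lax_comp A) (fun _ x _ => x)).

(** The types [A Mor], [arr_mor A] and [arr_cel A] of the elements of [A^2] do
not determine the 2-category [lax_arrow A], so these notations name it. *)
Notation ltc1 A := (tcomp (cat1 (lax_arrow A))).
Notation ltcv A := (tcomp (catv (lax_arrow A))).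
Notation ltch A := (tcomp (cath (lax_arrow A))).

(** * Generating squares in the lax arrow 2-category *)

Section ArrowIdentities.
Variable A : two_cat.
Implicit Types (m n : arr_mor A) (x y : arr_cel A).

Lemma lax_tc1E m n (e : am_u1 m = am_u0 n) :
  ltc1 A n m = arr_comp e.
Proof. by rewrite -(tcompE (X := cat1 (lax_arrow A)) e). Qed.

Lemma tpasteE m n (e : am_t m = am_s n) :
  tpaste A (k := Mor) m n = paste_mor e.
Proof.
by rewrite -(@tappE _ _ _ _ (lax_tgt A) (lax_src A) (lax_comp A) _ Mor m n e).
Qed.

Lemma lax_cel_eq (x y : lax_arrow A Cel) :
  src2 x = src2 y -> tgt2 x = tgt2 y ->
  lax_src A Cel x = lax_src A Cel y -> lax_tgt A Cel x = lax_tgt A Cel y ->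
    x = y.
Proof. exact: arr_cel_eq. Qed.

Lemma lax_unit_src k (a : A k) : lax_src A k (lax_unit A k a) = a.
Proof. by case: k a => //= a; exact: cdom_id. Qed.

Lemma lax_unit_tgt k (a : A k) : lax_tgt A k (lax_unit A k a) = a.
Proof. by case: k a => //= a; exact: ccod_id. Qed.

Lemma tpaste_src k (x y : lax_arrow A k) : lax_tgt A k x = lax_src A k y ->
  lax_src A k (tpaste A x y) = lax_src A k x.
Proof.
case: k x y => x y e; rewrite -(tappE _ _ e) //=.
by rewrite cdom_comp.
Qed.

Lemma tpaste_tgt k (x y : lax_arrow A k) : lax_tgt A k x = lax_src A k y ->
  lax_tgt A k (tpaste A x y) = lax_tgt A k y.
Proof.
case: k x y => x y e; rewrite -(tappE _ _ e) //=.
by rewrite ccod_comp.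
Qed.

Implicit Types p : lax_arrow A Mor.

(** With [p = (s, z, t) : u0 -> u1], these are [(t o u0, id, t) : u0 -> id] and
[(s, id, u1 o s) : id -> u1]. Pasting [z] before the former gives [p] followed
by [arr_to_id u1], and pasting it after the latter gives [arr_from_id u0]
followed by [p]. *)
Definition to_id_after p : lax_arrow A Mor :=
  ltc1 A (unit_mor (am_t p)) (arr_to_id (dom p)).
Definition from_id_before p : lax_arrow A Mor :=
  ltc1 A (arr_from_id (cod p)) (unit_mor (am_s p)).
(** The 2-dimensional version of these pastings, comparing [to_id_after p] with
[arr_to_id u1 o p], and [p o arr_from_id u0] with [from_id_before p]. *)
Definition to_id_cell p : lax_arrow A Cel :=
  tpaste A (k := Cel) (cel_from_unit (am_z p)) (id2 (to_id_after p)).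
Definition from_id_cell p : lax_arrow A Cel :=
  tpaste A (k := Cel) (id2 (from_id_before p)) (cel_to_unit (am_z p)).

Lemma to_id_after_match p :
  cod (arr_to_id (dom p) : lax_arrow A Mor)
    = dom (unit_mor (am_t p) : lax_arrow A Mor).
Proof. by rewrite /= am_dom_t. Qed.

Lemma from_id_before_match p :
  cod (unit_mor (am_s p) : lax_arrow A Mor)
    = dom (arr_from_id (cod p) : lax_arrow A Mor).
Proof. by rewrite /= am_cod_s. Qed.

Lemma to_id_after_src p : lax_src A Mor (to_id_after p) = src2 (am_z p).
Proof. by rewrite ftc1 ?to_id_after_match //= am_srcE. Qed.

Lemma to_id_after_tgt p : lax_tgt A Mor (to_id_after p) = am_t p.
Proof. by rewrite ftc1 ?to_id_after_match //= tidr // am_dom_t. Qed.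

Lemma from_id_before_src p : lax_src A Mor (from_id_before p) = am_s p.
Proof. by rewrite ftc1 ?from_id_before_match //= tidl // am_cod_s. Qed.

Lemma from_id_before_tgt p : lax_tgt A Mor (from_id_before p) = tgt2 (am_z p).
Proof. by rewrite ftc1 ?from_id_before_match //= am_tgtE. Qed.

Lemma to_id_cell_match p :
  lax_tgt A Cel (cel_from_unit (am_z p)) = lax_src A Cel (id2 (to_id_after p)).
Proof. by rewrite fid2 to_id_after_src. Qed.

Lemma from_id_cell_match p :
  lax_tgt A Cel (id2 (from_id_before p)) = lax_src A Cel (cel_to_unit (am_z p)).
Proof. by rewrite fid2 from_id_before_tgt. Qed.

(** The cell of [arr_to_id (cod p)] is an identity, so composing with it merely
moves [u1] from the codomain of [p] to its source component; the pasting
separates the resulting globular cell [z] from the part with trivial cell. *)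
Lemma to_id_natural p :
  tpaste A (k := Mor) (arr_of_cel (am_z p)) (to_id_after p)
  = ltc1 A (arr_to_id (cod p)) p.
Proof.
have ep : am_u1 p = am_u0 (arr_to_id (cod p)) by [].
have et : am_u1 (arr_to_id (dom p)) = am_u0 (unit_mor (am_t p)).
  exact: to_id_after_match.
rewrite /to_id_after (lax_tc1E ep) (lax_tc1E et).
have e : am_t (arr_of_cel (am_z p)) = am_s (arr_comp et).
  by rewrite /= tcompE am_srcE.
rewrite (tpasteE e); am_facts p; apply: arr_mor_eq;
  rewrite ?arr_comp_z ?paste_mor_z /= ?tcompE.
- by rewrite am_dom_z tidr.
- by rewrite am_cod_z tidl ?ccod_id; [congruence|].
- by rewrite am_tgtE.
- by rewrite tidl ?tidr.
rewrite ?tcompE !th_idl; [|bd..].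
rewrite !th_idr; [|bd].
rewrite !th_id; [|bd..].
by rewrite !tidl ?tidr //; bd.
Qed.

Lemma from_id_natural p :
  tpaste A (k := Mor) (from_id_before p) (arr_of_cel (am_z p))
  = ltc1 A p (arr_from_id (dom p)).
Proof.
have ep : am_u1 (arr_from_id (dom p)) = am_u0 p by [].
have et : am_u1 (unit_mor (am_s p)) = am_u0 (arr_from_id (cod p)).
  exact: from_id_before_match.
rewrite /from_id_before (lax_tc1E ep) (lax_tc1E et).
have e : am_t (arr_comp et) = am_s (arr_of_cel (am_z p)).
  by rewrite /= tcompE am_tgtE.
rewrite (tpasteE e); am_facts p; apply: arr_mor_eq;
  rewrite ?arr_comp_z ?paste_mor_z /= ?tcompE.
- by rewrite am_dom_z tidr ?cdom_id //; congruence.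
- by rewrite am_cod_z tidl.
- by rewrite tidl ?tidr.
- by rewrite am_srcE.
rewrite ?tcompE !th_idl; [|bd..].
rewrite !th_idr; [|bd..].
rewrite !th_id; [|bd..].
by rewrite tidr; [rewrite !tidl ?tidr //; bd|bd].
Qed.

Lemma tpaste_unitl (m : arr_mor A) :
  tpaste A (k := Mor) (unit_mor (am_s m)) m = m.
Proof.
have e : am_t (unit_mor (am_s m)) = am_s m by [].
rewrite (tpasteE e); am_facts m; apply: arr_mor_eq; rewrite ?paste_mor_z //=.
- by rewrite tcompE tidr // am_dom_s.
- by rewrite tcompE tidr // am_cod_s.
by rewrite th_id ?th_idr ?tidl //; bd.
Qed.

Lemma tpaste_unitr (m : arr_mor A) :
  tpaste A (k := Mor) m (unit_mor (am_t m)) = m.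
Proof.
have e : am_t m = am_s (unit_mor (am_t m)) by [].
rewrite (tpasteE e); am_facts m; apply: arr_mor_eq; rewrite ?paste_mor_z //=.
- by rewrite tcompE tidl // am_dom_t.
- by rewrite tcompE tidl // am_cod_t.
by rewrite th_id ?th_idl ?tidr //; bd.
Qed.

(** This makes [arr_from_id u] a section: it turns a lift along [arr_to_id u]
back into the identity, which is why cleavages are cartesian and why the two
cleavages at a junction compose to an identity. *)
Lemma tpaste_from_to_id (u : A Mor) :
  tpaste A (k := Mor) (arr_from_id u) (arr_to_id u) = id1 (u : lax_arrow A Ob).
Proof.
have e : am_t (arr_from_id u) = am_s (arr_to_id u) by [].
rewrite (tpasteE e); apply: arr_mor_eq; rewrite ?paste_mor_z //=.
- by rewrite tcompE tidr.
- by rewrite tcompE tidl.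
by rewrite !th_id ?cdom_id ?ccod_id // tidr ?cdom_id // tidl // tidr.
Qed.

Lemma tpaste_to_from_unit (b : A Cel) :
  tpaste A (k := Cel) (cel_to_unit b) (cel_from_unit b)
  = id2 (arr_of_cel b : lax_arrow A Mor).
Proof.
have e : lax_tgt A Cel (cel_to_unit b) = lax_src A Cel (cel_from_unit b) by [].
apply: lax_cel_eq; rewrite ?tapp_src2 ?tapp_tgt2 //.
- by rewrite [LHS](tpaste_unitr (arr_of_cel b)) cdom_id.
- by rewrite [LHS](tpaste_unitl (arr_of_cel b)) ccod_id.
- by rewrite tpaste_src // fid2.
- by rewrite tpaste_tgt // fid2.
Qed.

Lemma to_id_cell_src2 p : src2 (to_id_cell p) = to_id_after p.
Proof.
rewrite tapp_src2 ?to_id_cell_match // cdom_id.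
by rewrite -[RHS]tpaste_unitl -[am_s _]/(lax_src A Mor _) to_id_after_src.
Qed.

Lemma to_id_cell_tgt2 p : tgt2 (to_id_cell p) = ltc1 A (arr_to_id (cod p)) p.
Proof. by rewrite tapp_tgt2 ?to_id_cell_match // ccod_id [LHS]to_id_natural.
  Qed.

Lemma from_id_cell_src2 p : src2 (from_id_cell p)
  = ltc1 A p (arr_from_id (dom p)).
Proof. by rewrite tapp_src2 ?from_id_cell_match // cdom_id
  [LHS]from_id_natural. Qed.

Lemma from_id_cell_tgt2 p : tgt2 (from_id_cell p) = from_id_before p.
Proof.
rewrite tapp_tgt2 ?from_id_cell_match // ccod_id.
by rewrite -[RHS]tpaste_unitr -[am_t _]/(lax_tgt A Mor _) from_id_before_tgt.
Qed.

Section Whiskering.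
Variable x : lax_arrow A Cel.

Definition whisk_to_id : lax_arrow A Cel :=
  ltch A (id2 (arr_to_id (cod (src2 x)) : lax_arrow A Mor)) x.
Definition unit_whisk_to_id : lax_arrow A Cel :=
  ltch A (unit_cel (ac_t x)) (id2 (arr_to_id (dom (src2 x)) : lax_arrow A Mor)).
Definition whisk_from_id : lax_arrow A Cel :=
  ltch A x (id2 (arr_from_id (dom (src2 x)) : lax_arrow A Mor)).
Definition unit_whisk_from_id : lax_arrow A Cel :=
  ltch A (id2 (arr_from_id (cod (src2 x)) : lax_arrow A Mor)) (unit_cel (ac_s
    x)).

Lemma whisk_to_id_match :
  cod (src2 x) = dom (src2 (id2 (arr_to_id (cod (src2 x)) : lax_arrow A Mor))).
Proof. by rewrite cdom_id. Qed.

Lemma unit_whisk_to_id_match :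
  cod (src2 (id2 (arr_to_id (dom (src2 x)) : lax_arrow A Mor)))
  = dom (src2 (unit_cel (ac_t x) : lax_arrow A Cel)).
Proof. by rewrite cdom_id /= ac_src_t am_dom_t. Qed.

Lemma whisk_from_id_match :
  cod (src2 (id2 (arr_from_id (dom (src2 x)) : lax_arrow A Mor)))
    = dom (src2 x).
Proof. by rewrite cdom_id. Qed.

Lemma unit_whisk_from_id_match :
  cod (src2 (unit_cel (ac_s x) : lax_arrow A Cel))
  = dom (src2 (id2 (arr_from_id (cod (src2 x)) : lax_arrow A Mor))).
Proof. by rewrite cdom_id /= ac_src_s am_cod_s. Qed.

Lemma to_id_cell_whisk : tgt2 (to_id_cell (src2 x)) = src2 whisk_to_id.
Proof.
have h := whisk_to_id_match.
by rewrite /whisk_to_id th_src // cdom_id to_id_cell_tgt2.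
Qed.

Lemma whisk_to_id_cell : tgt2 unit_whisk_to_id = src2 (to_id_cell (tgt2 x)).
Proof.
have h := unit_whisk_to_id_match.
rewrite /unit_whisk_to_id to_id_cell_src2 th_tgt // ccod_id.
by rewrite -dom_tgt2 /= ac_tgt_t.
Qed.

Lemma whisk_from_id_cell : tgt2 whisk_from_id = src2 (from_id_cell (tgt2 x)).
Proof.
have h := whisk_from_id_match.
by rewrite /whisk_from_id th_tgt // ccod_id from_id_cell_src2 dom_tgt2.
Qed.

Lemma from_id_cell_whisk : tgt2 (from_id_cell (src2 x))
  = src2 unit_whisk_from_id.
Proof.
have h := unit_whisk_from_id_match.
rewrite /unit_whisk_from_id from_id_cell_tgt2 th_src // cdom_id /=.
by rewrite ac_src_s.
Qed.

Lemma whisk_to_id_tgt : lax_tgt A Cel whisk_to_id = ac_t x.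
Proof.
have h := whisk_to_id_match.
rewrite /whisk_to_id ftch // fid2 /= th_idl //.
by rewrite ac_src_t am_cod_t.
Qed.

Lemma unit_whisk_to_id_tgt : lax_tgt A Cel unit_whisk_to_id = ac_t x.
Proof.
have h := unit_whisk_to_id_match.
rewrite /unit_whisk_to_id ftch // fid2 /= th_idr //.
by rewrite ac_src_t -am_dom_t.
Qed.

Lemma whisk_from_id_src : lax_src A Cel whisk_from_id = ac_s x.
Proof.
have h := whisk_from_id_match.
rewrite /whisk_from_id ftch // fid2 /= th_idr //.
by rewrite ac_src_s am_dom_s.
Qed.

Lemma unit_whisk_from_id_src : lax_src A Cel unit_whisk_from_id = ac_s x.
Proof.
have h := unit_whisk_from_id_match.
rewrite /unit_whisk_from_id ftch // fid2 /= th_idl //.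
by rewrite ac_src_s am_cod_s.
Qed.

(** On source components this is the defining law of the cell [x] of [A^2]; on
target components both sides are [ac_t x]. *)
Lemma to_id_cell_natural :
  ltcv A whisk_to_id (to_id_cell (src2 x))
  = ltcv A (to_id_cell (tgt2 x)) unit_whisk_to_id.
Proof.
have h0 := whisk_to_id_match; have h1 := unit_whisk_to_id_match.
have v0 := to_id_cell_whisk; have v1 := whisk_to_id_cell.
apply: lax_cel_eq.
- by rewrite tdom // tdom // /unit_whisk_to_id to_id_cell_src2 th_src //
  cdom_id /= ac_src_t.
- by rewrite tcod // tcod // to_id_cell_tgt2 /whisk_to_id th_tgt // ccod_id
  cod_tgt2.
- rewrite !ftcv // /whisk_to_id /unit_whisk_to_id !ftch // !tpaste_src
  ?to_id_cell_match // !fid2.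
  exact: ac_lawE.
- rewrite !ftcv // whisk_to_id_tgt unit_whisk_to_id_tgt.
  rewrite !tpaste_tgt ?to_id_cell_match // !fid2 !to_id_after_tgt.
  by rewrite tidl ?tidr // ?ac_src_t // ac_tgt_t.
Qed.

(** On target components this is the defining law of the cell [x] of [A^2]; on
source components both sides are [ac_s x]. *)
Lemma from_id_cell_natural :
  ltcv A (from_id_cell (tgt2 x)) whisk_from_id
  = ltcv A unit_whisk_from_id (from_id_cell (src2 x)).
Proof.
have h0 := whisk_from_id_match; have h1 := unit_whisk_from_id_match.
have v0 := whisk_from_id_cell; have v1 := from_id_cell_whisk.
apply: lax_cel_eq.
- by rewrite tdom // tdom // /whisk_from_id from_id_cell_src2 th_src // cdom_id.
- by rewrite tcod // tcod // from_id_cell_tgt2 /unit_whisk_from_id th_tgt //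
  ccod_id -cod_tgt2 /= ac_tgt_s.
- rewrite !ftcv // whisk_from_id_src unit_whisk_from_id_src.
  rewrite !tpaste_src ?from_id_cell_match // !fid2 !from_id_before_src.
  by rewrite tidl ?tidr // ?ac_src_s // ac_tgt_s.
- rewrite !ftcv // /whisk_from_id /unit_whisk_from_id !ftch // !tpaste_tgt
  ?from_id_cell_match // !fid2.
  exact/esym/ac_lawE.
Qed.

End Whiskering.

End ArrowIdentities.

(** * Actions and cleavages of a split two-sided 2-fibration *)

Section TotalActions.
Variables (A B : two_cat) (J : two_fib A B).

Lemma tlamE k x (i : J k) e : lam J k (pb x i e) = tlam J x i.
Proof. exact: tappE. Qed.

Lemma trhoE k (i : J k) y e : rho J k (pb i y e) = trho J i y.
Proof. exact: tappE. Qed.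

Lemma p_tlam k x (i : J k) : lax_tgt A k x = legp J k i ->
  legp J k (tlam J x i) = lax_src A k x.
Proof. by move=> e; rewrite -(tappE _ _ e) p_lam. Qed.

Lemma q_tlam k x (i : J k) : lax_tgt A k x = legp J k i ->
  legq J k (tlam J x i) = legq J k i.
Proof. by move=> e; rewrite -(tappE _ _ e) q_lam. Qed.

Lemma p_trho k (i : J k) y : legq J k i = lax_src B k y ->
  legp J k (trho J i y) = legp J k i.
Proof. by move=> e; rewrite -(tappE _ _ e) p_rho. Qed.

Lemma q_trho k (i : J k) y : legq J k i = lax_src B k y ->
  legq J k (trho J i y) = lax_tgt B k y.
Proof. by move=> e; rewrite -(tappE _ _ e) q_rho. Qed.

Lemma tlam_unit k (i : J k) : tlam J (lax_unit A k (legp J k i)) i = i.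
Proof.
have e := lax_unit_tgt (legp J k i).
by rewrite -(tappE _ _ e) lam_unit.
Qed.

Lemma trho_unit k (i : J k) : trho J i (lax_unit B k (legq J k i)) = i.
Proof.
have e := esym (lax_unit_src (legq J k i)).
by rewrite -(tappE _ _ e) rho_unit.
Qed.

Lemma tlam_comp k x y (i : J k) :
  lax_tgt A k x = lax_src A k y -> lax_tgt A k y = legp J k i ->
  tlam J (tpaste A x y) i = tlam J x (tlam J y i).
Proof.
move=> exy e.
have e1 : lax_tgt A k (tpaste A x y) = legp J k i by rewrite tpaste_tgt.
have e2 : lax_tgt A k x = legp J k (tlam J y i) by rewrite p_tlam.
rewrite -(tappE _ _ e2) -(tappE _ _ e1).
move: e1 e2; rewrite -(tappE _ _ e) -(tappE _ _ exy) => e1 e2.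
exact: lam_comp.
Qed.

Lemma trho_comp k (i : J k) x y :
  legq J k i = lax_src B k x -> lax_tgt B k x = lax_src B k y ->
  trho J i (tpaste B x y) = trho J (trho J i x) y.
Proof.
move=> e exy.
have e1 : legq J k i = lax_src B k (tpaste B x y) by rewrite tpaste_src.
have e2 : legq J k (trho J i x) = lax_src B k y by rewrite q_trho.
rewrite -(tappE _ _ e2) -(tappE _ _ e1).
move: e1 e2; rewrite -(tappE _ _ e) -(tappE _ _ exy) => e1 e2.
exact: rho_comp.
Qed.

Lemma trho_tlam k x (i : J k) y :
  lax_tgt A k x = legp J k i -> legq J k i = lax_src B k y ->
  trho J (tlam J x i) y = tlam J x (trho J i y).
Proof.
move=> e1 e3.
have e2 : legq J k (tlam J x i) = lax_src B k y by rewrite q_tlam.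
have e4 : lax_tgt A k x = legp J k (trho J i y) by rewrite p_trho.
rewrite -(tappE _ _ e2) -(tappE _ _ e4).
move: e2 e4; rewrite -(tappE _ _ e1) -(tappE _ _ e3) => e2 e4.
exact: rho_lam.
Qed.

Definition lam_lift1 (u : A Mor) (i : J Ob) : J Mor :=
  tlam J (k := Mor) (arr_to_id u) (id1 i).
Definition lam_lift2 (s : J Mor) (a : A Cel) : J Cel :=
  tlam J (k := Cel) (cel_from_unit a) (id2 s).
Definition rho_lift1 (i : J Ob) (v : B Mor) : J Mor :=
  trho J (k := Mor) (id1 i) (arr_from_id v).
Definition rho_lift2 (b : B Cel) (s : J Mor) : J Cel :=
  trho J (k := Cel) (id2 s) (cel_to_unit b).

Lemma lam_morE u i e : lam_mor J u i e = lam_lift1 u i.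
Proof. exact: tappE. Qed.
Lemma lam_celE s a e : lam_cel J s a e = lam_lift2 s a.
Proof. exact: tappE. Qed.
Lemma rho_morE i v e : rho_mor J i v e = rho_lift1 i v.
Proof. exact: tappE. Qed.
Lemma rho_celE b s e : rho_cel J b s e = rho_lift2 b s.
Proof. exact: tappE. Qed.

(** * The cleavage of the left leg *)

Lemma left_match_src2 (x : lax_arrow A Cel) (c : J Cel) :
  ac_t x = legp J Cel c -> am_t (src2 x) = legp J Mor (src2 c).
Proof. by move=> e; rewrite -fsrc2 -e /= ac_src_t. Qed.

Lemma left_match_tgt2 (x : lax_arrow A Cel) (c : J Cel) :
  ac_t x = legp J Cel c -> am_t (tgt2 x) = legp J Mor (tgt2 c).
Proof. by move=> e; rewrite -ftgt2 -e /= ac_tgt_t. Qed.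

Lemma left_match_dom (p : lax_arrow A Mor) (s : J Mor) :
  am_t p = legp J Mor s -> cod (dom p : A Mor) = legp J Ob (dom s).
Proof. by move=> e; rewrite -fdom -e /= am_dom_t. Qed.

Lemma left_match_cod (p : lax_arrow A Mor) (s : J Mor) :
  am_t p = legp J Mor s -> cod (cod p : A Mor) = legp J Ob (cod s).
Proof. by move=> e; rewrite -fcod -e /= am_cod_t. Qed.

Lemma cod_lam_lift1 u i : cod u = legp J Ob i -> cod (lam_lift1 u i) = i.
Proof.
move=> e; rewrite tapp_cod ?(lam_mor_match e) //= ccod_id e.
exact: (tlam_unit (k := Ob)).
Qed.

Lemma tlam_to_id_after (p : lax_arrow A Mor) (s : J Mor) :
  am_t p = legp J Mor s ->
  tlam J (to_id_after p) s = tc1 s (lam_lift1 (dom p) (dom s)).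
Proof.
move=> e; have e0 := left_match_dom e.
rewrite /lam_lift1 -[X in tc1 X _](tlam_unit (k := Mor)) -tapp_tc1 //.
- by rewrite -e [in RHS]tidr.
- exact: (lam_mor_match e0).
- by rewrite /= -e -am_dom_t.
- by rewrite ccod_id.
Qed.

(** The pasting is acted with in two stages, the inner stage being [to_id_after
p]; what remains is the action of a cell of the form [cel_from_unit], that is,
a cleavage. *)
Lemma tlam_to_id_cell (p : lax_arrow A Mor) (s : J Mor) :
  am_t p = legp J Mor s ->
  tlam J (to_id_cell p) (id2 s) = lam_lift2 (tlam J (to_id_after p) s) (am_z p).
Proof.
move=> e; have e0 : lax_tgt A Mor (to_id_after p) = legp J Mor s.
  by rewrite to_id_after_tgt.
rewrite tlam_comp ?to_id_cell_match ?fid2 ?e0 //.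
by rewrite tapp_id2.
Qed.

Section LeftDecomposition.
Variables (x : lax_arrow A Cel) (c : J Cel).
Hypothesis e : ac_t x = legp J Cel c.

Let M1 := lam_lift1 (cod (src2 x)) (cod (src2 c)).
Let M0 := lam_lift1 (dom (src2 x)) (dom (src2 c)).
Let N0 := lam_lift2 (tlam J (to_id_after (src2 x)) (src2 c)) (am_z (src2 x)).
Let N1 := lam_lift2 (tlam J (to_id_after (tgt2 x)) (tgt2 c)) (am_z (tgt2 x)).

(** The image of [to_id_cell_natural] under [lam(-, c)]. It expresses [lam(x,
c)] through cleavages, up to the two factors that [lam_lift1_mono] and
[lam_lift2_epi] cancel. *)
Lemma left_decomposition :
  [/\ cod (src2 (tlam J x c)) = dom M1,
    tgt2 N0 = src2 (tch (id2 M1) (tlam J x c)),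
    tgt2 (tch c (id2 M0)) = src2 N1 &
    tcv (tch (id2 M1) (tlam J x c)) N0 = tcv N1 (tch c (id2 M0))].
Proof.
have e0 := left_match_src2 e; have e1 := left_match_tgt2 e.
have d0 := left_match_dom e0; have d1 := left_match_cod e0.
have m0 := lam_mor_match d0; have m1 := lam_mor_match d1.
have i0 : id2 M0 = tlam J (k := Cel) (id2 (arr_to_id (dom (src2 x)) : lax_arrow
  A Mor))
    (id2 (id1 (dom (src2 c)))) by rewrite tapp_id2.
have i1 : id2 M1 = tlam J (k := Cel) (id2 (arr_to_id (cod (src2 x)) : lax_arrow
  A Mor))
    (id2 (id1 (cod (src2 c)))) by rewrite tapp_id2.
have n0 := tlam_to_id_cell e0; have n1 := tlam_to_id_cell e1.
have a1 : cod (src2 (tlam J x c)) = dom M1.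
  by rewrite tapp_src2 // tapp_cod // /M1 /lam_lift1 tapp_dom // cdom_id.
have h1 : tch (id2 M1) (tlam J x c) = tlam J (whisk_to_id x) c.
  rewrite i1 -tapp_tch ?cdom_id //; last by rewrite !fid2 m1.
  by rewrite th_idl.
have h0 : tch c (id2 M0) = tlam J (unit_whisk_to_id x) c.
  rewrite i0 -[X in tch X _](tlam_unit (k := Cel)) -tapp_tch ?ccod_id //.
  - by rewrite th_idr // -e.
  - by rewrite !fid2 m0.
  - by rewrite -e; exact: unit_whisk_to_id_match.
  - by rewrite cdom_id ccod_id.
have v0 := to_id_cell_whisk x; have v1 := whisk_to_id_cell x.
have t0 : lax_tgt A Cel (to_id_cell (src2 x)) = legp J Cel (id2 (src2 c)).
  by rewrite tpaste_tgt ?to_id_cell_match // !fid2 to_id_after_tgt e0.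
have t1 : lax_tgt A Cel (to_id_cell (tgt2 x)) = legp J Cel (id2 (tgt2 c)).
  by rewrite tpaste_tgt ?to_id_cell_match // !fid2 to_id_after_tgt e1.
have t2 : lax_tgt A Cel (whisk_to_id x) = legp J Cel c by rewrite
  whisk_to_id_tgt.
have t3 : lax_tgt A Cel (unit_whisk_to_id x) = legp J Cel c.
  by rewrite unit_whisk_to_id_tgt.
split=> //.
- by rewrite h1 /N0 -n0 tapp_src2 // tapp_tgt2 // v0 ccod_id.
- by rewrite h0 /N1 -n1 tapp_src2 // tapp_tgt2 // v1 cdom_id.
rewrite h1 h0 /N0 /N1 -n0 -n1 -!tapp_tcv ?ccod_id ?cdom_id //.
by rewrite to_id_cell_natural tidl ?tidr.
Qed.
End LeftDecomposition.

(** Uniqueness in the cartesian property of the lift of [u]: acting on the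
composite with [arr_from_id u], whiskered with the image of [y], undoes the
lift and returns [y]. *)
Lemma lam_lift1_mono u i (y y' : J Cel) : cod u = legp J Ob i ->
  cod (src2 y) = dom (lam_lift1 u i) -> cod (src2 y') = dom (lam_lift1 u i) ->
  legp J Cel y = legp J Cel y' ->
  tch (id2 (lam_lift1 u i)) y = tch (id2 (lam_lift1 u i)) y' -> y = y'.
Proof.
move=> e cy cy' py E.
pose r (z : A Cel) := ltch A (id2 (arr_from_id u : lax_arrow A Mor)) (unit_cel
  z).
have m := lam_mor_match e.
have R y1 : cod (src2 y1) = dom (lam_lift1 u i) ->
    y1 = tlam J (r (legp J Cel y1)) (tch (id2 (lam_lift1 u i)) y1).
  move=> cy1.
  have py1 : cod (src2 (legp J Cel y1)) = dom u.
    by rewrite fsrc2 fcod cy1 -fdom p_tlam.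
  rewrite tapp_tch ?cdom_id //; last 2 first.
  - by rewrite !fid2 p_tlam.
  - by rewrite /= py1.
  rewrite tlam_unit tapp_id2; last by rewrite p_tlam.
  rewrite /lam_lift1 -tlam_comp // tpaste_from_to_id tapp_id1; last by [].
  by rewrite th_idl // cy1 tapp_dom // cdom_id.
by rewrite (R y) // (R y') // py E.
Qed.

(** Uniqueness in the opcartesian property of the lift of [a]: [cel_to_unit a]
followed by the image of [y] undoes the lift and returns [y]. *)
Lemma lam_lift2_epi s a (y y' : J Cel) : src2 a = legp J Mor s ->
  tgt2 (lam_lift2 s a) = src2 y -> tgt2 (lam_lift2 s a) = src2 y' ->
  legp J Cel y = legp J Cel y' ->
  tcv y (lam_lift2 s a) = tcv y' (lam_lift2 s a) -> y = y'.
Proof.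
move=> e cy cy' py E.
pose r (z : A Cel) := ltcv A (unit_cel z) (cel_to_unit a).
have m := lam_cel_match e.
have R y1 : tgt2 (lam_lift2 s a) = src2 y1 ->
    y1 = tlam J (r (legp J Cel y1)) (tcv y1 (lam_lift2 s a)).
  move=> cy1.
  have py1 : tgt2 a = src2 (legp J Cel y1).
    by rewrite fsrc2 -cy1 -ftgt2 p_tlam.
  rewrite tapp_tcv //; last 2 first.
  - by rewrite p_tlam.
  - by rewrite /= py1.
  rewrite tlam_unit /lam_lift2 -tlam_comp // tpaste_to_from_unit tapp_id2;
    last by rewrite -e.
  by rewrite tidr // -cy1 tapp_tgt2 // ccod_id.
by rewrite (R y) // (R y') // py E.
Qed.

(** * The cleavage of the right leg *)

Lemma right_match_src2 (c : J Cel) (x : lax_arrow B Cel) :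
  legq J Cel c = ac_s x -> legq J Mor (src2 c) = am_s (src2 x).
Proof. by move=> e; rewrite -fsrc2 e /= ac_src_s. Qed.

Lemma right_match_tgt2 (c : J Cel) (x : lax_arrow B Cel) :
  legq J Cel c = ac_s x -> legq J Mor (tgt2 c) = am_s (tgt2 x).
Proof. by move=> e; rewrite -ftgt2 e /= ac_tgt_s. Qed.

Lemma right_match_dom (s : J Mor) (p : lax_arrow B Mor) :
  legq J Mor s = am_s p -> legq J Ob (dom s) = dom (dom p : B Mor).
Proof. by move=> e; rewrite -fdom e /= am_dom_s. Qed.

Lemma right_match_cod (s : J Mor) (p : lax_arrow B Mor) :
  legq J Mor s = am_s p -> legq J Ob (cod s) = dom (cod p : B Mor).
Proof. by move=> e; rewrite -fcod e /= am_cod_s. Qed.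

Lemma dom_rho_lift1 i v : legq J Ob i = dom v -> dom (rho_lift1 i v) = i.
Proof.
move=> e; rewrite tapp_dom ?(rho_mor_match e) //= cdom_id -e.
exact: (trho_unit (k := Ob)).
Qed.

Lemma trho_from_id_before (s : J Mor) (p : lax_arrow B Mor) :
  legq J Mor s = am_s p ->
  trho J s (from_id_before p) = tc1 (rho_lift1 (cod s) (cod p)) s.
Proof.
move=> e; have e0 := right_match_cod e.
rewrite /rho_lift1 -[X in tc1 _ X](trho_unit (k := Mor)) -tapp_tc1 //.
- by rewrite e [in RHS]tidl.
- exact: (rho_mor_match e0).
- by rewrite cdom_id.
- by rewrite /= e am_cod_s.
Qed.

(** As for [lam], the pasting acts in two stages, and the second one is a
cleavage. *)
Lemma trho_from_id_cell (s : J Mor) (p : lax_arrow B Mor) :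
  legq J Mor s = am_s p ->
  trho J (id2 s) (from_id_cell p) = rho_lift2 (am_z p) (trho J s
    (from_id_before p)).
Proof.
move=> e; have e0 : legq J Mor s = lax_src B Mor (from_id_before p).
  by rewrite from_id_before_src.
rewrite trho_comp ?from_id_cell_match ?fid2 ?e0 //.
by rewrite tapp_id2.
Qed.

Section RightDecomposition.
Variables (c : J Cel) (x : lax_arrow B Cel).
Hypothesis e : legq J Cel c = ac_s x.

Let M1 := rho_lift1 (cod (src2 c)) (cod (src2 x)).
Let M0 := rho_lift1 (dom (src2 c)) (dom (src2 x)).
Let N0 := rho_lift2 (am_z (src2 x)) (trho J (src2 c) (from_id_before (src2 x))).
Let N1 := rho_lift2 (am_z (tgt2 x)) (trho J (tgt2 c) (from_id_before (tgt2 x))).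

(** The image of [from_id_cell_natural] under [rho(c, -)]. *)
Lemma right_decomposition :
  [/\ dom (src2 (trho J c x)) = cod M0,
    tgt2 (tch (trho J c x) (id2 M0)) = src2 N1,
    tgt2 N0 = src2 (tch (id2 M1) c) &
    tcv N1 (tch (trho J c x) (id2 M0)) = tcv (tch (id2 M1) c) N0].
Proof.
have e0 := right_match_src2 e; have e1 := right_match_tgt2 e.
have d0 := right_match_dom e0; have d1 := right_match_cod e0.
have m0 := rho_mor_match d0; have m1 := rho_mor_match d1.
have i0 : id2 M0 = trho J (k := Cel) (id2 (id1 (dom (src2 c))))
    (id2 (arr_from_id (dom (src2 x)) : lax_arrow B Mor)) by rewrite tapp_id2.
have i1 : id2 M1 = trho J (k := Cel) (id2 (id1 (cod (src2 c))))
    (id2 (arr_from_id (cod (src2 x)) : lax_arrow B Mor)) by rewrite tapp_id2.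
have n0 := trho_from_id_cell e0; have n1 := trho_from_id_cell e1.
have a0 : dom (src2 (trho J c x)) = cod M0.
  by rewrite tapp_src2 // tapp_dom // /M0 /rho_lift1 tapp_cod // ccod_id.
have h0 : tch (trho J c x) (id2 M0) = trho J c (whisk_from_id x).
  rewrite i0 -tapp_tch ?cdom_id ?ccod_id //; last by rewrite !fid2 m0.
  by rewrite th_idr.
have h1 : tch (id2 M1) c = trho J c (unit_whisk_from_id x).
  rewrite i1 -[X in tch _ X](trho_unit (k := Cel)) -tapp_tch //.
  - by rewrite th_idl // e.
  - by rewrite !fid2 m1.
  - by rewrite !cdom_id.
  - by rewrite e; exact: unit_whisk_from_id_match.
have v0 := whisk_from_id_cell x; have v1 := from_id_cell_whisk x.
have t0 : legq J Cel (id2 (src2 c)) = lax_src B Cel (from_id_cell (src2 x)).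
  by rewrite tpaste_src ?from_id_cell_match // !fid2 from_id_before_src e0.
have t1 : legq J Cel (id2 (tgt2 c)) = lax_src B Cel (from_id_cell (tgt2 x)).
  by rewrite tpaste_src ?from_id_cell_match // !fid2 from_id_before_src e1.
have t2 : legq J Cel c = lax_src B Cel (whisk_from_id x) by rewrite
  whisk_from_id_src.
have t3 : legq J Cel c = lax_src B Cel (unit_whisk_from_id x).
  by rewrite unit_whisk_from_id_src.
split=> //.
- by rewrite h0 /N1 -n1 tapp_tgt2 // tapp_src2 // v0 cdom_id.
- by rewrite h1 /N0 -n0 tapp_tgt2 // tapp_src2 // v1 ccod_id.
rewrite h1 h0 /N0 /N1 -n0 -n1 -!tapp_tcv ?ccod_id ?cdom_id //.
by rewrite from_id_cell_natural tidl ?tidr.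
Qed.
End RightDecomposition.

(** Uniqueness in the opcartesian property of the lift of [v], undone by
[arr_to_id v]. *)
Lemma rho_lift1_epi i v (y y' : J Cel) : legq J Ob i = dom v ->
  dom (src2 y) = cod (rho_lift1 i v) -> dom (src2 y') = cod (rho_lift1 i v) ->
  legq J Cel y = legq J Cel y' ->
  tch y (id2 (rho_lift1 i v)) = tch y' (id2 (rho_lift1 i v)) -> y = y'.
Proof.
move=> e cy cy' qy E.
pose r (z : B Cel) := ltch B (unit_cel z) (id2 (arr_to_id v : lax_arrow B Mor)).
have m := rho_mor_match e.
have R y1 : dom (src2 y1) = cod (rho_lift1 i v) ->
    y1 = trho J (tch y1 (id2 (rho_lift1 i v))) (r (legq J Cel y1)).
  move=> cy1.
  have qy1 : dom (src2 (legq J Cel y1)) = cod v.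
    by rewrite fsrc2 fdom cy1 -fcod q_trho.
  rewrite tapp_tch ?cdom_id //; last 2 first.
  - by rewrite !fid2 q_trho.
  - by rewrite /= qy1.
  rewrite trho_unit tapp_id2; last by rewrite q_trho.
  rewrite /rho_lift1 -trho_comp // tpaste_from_to_id tapp_id1; last by [].
  by rewrite th_idr // cy1 tapp_cod // ccod_id.
by rewrite (R y) // (R y') // qy E.
Qed.

(** Uniqueness in the cartesian property of the lift of [b], undone by
[cel_from_unit b]. *)
Lemma rho_lift2_mono b s (y y' : J Cel) : legq J Mor s = tgt2 b ->
  tgt2 y = src2 (rho_lift2 b s) -> tgt2 y' = src2 (rho_lift2 b s) ->
  legq J Cel y = legq J Cel y' ->
  tcv (rho_lift2 b s) y = tcv (rho_lift2 b s) y' -> y = y'.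
Proof.
move=> e cy cy' qy E.
pose r (z : B Cel) := ltcv B (cel_from_unit b) (unit_cel z).
have m := rho_cel_match e.
have R y1 : tgt2 y1 = src2 (rho_lift2 b s) ->
    y1 = trho J (tcv (rho_lift2 b s) y1) (r (legq J Cel y1)).
  move=> cy1.
  have qy1 : tgt2 (legq J Cel y1) = src2 b.
    by rewrite ftgt2 cy1 -fsrc2 q_trho.
  rewrite tapp_tcv //; last 2 first.
  - by rewrite q_trho.
  - by rewrite /= qy1.
  rewrite trho_unit /rho_lift2 -trho_comp // tpaste_to_from_unit tapp_id2;
    last by rewrite e.
  by rewrite tidl // cy1 tapp_src2 // cdom_id.
by rewrite (R y) // (R y') // qy E.
Qed.

End TotalActions.

(** * Equivariance with respect to the outer actions *)

(** This reduces equations between objects to morphisms, and between morphisms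
to cells. *)
Lemma cid_inj O M (X : cat_on O M) a b : cid X a = cid X b -> a = b.
Proof. by move=> /(f_equal (cdom X)); rewrite !cdom_id. Qed.

Section LaxMap.
Variables (A C : two_cat) (f : two_functor A C).

Lemma lax_map_to_id (u : A Mor) :
  lax_map f Mor (arr_to_id u) = arr_to_id (f Mor u).
Proof. by apply: arr_mor_eq; rewrite /= ?fid1 ?fid2 ?fcod. Qed.

Lemma lax_map_from_id (u : A Mor) :
  lax_map f Mor (arr_from_id u) = arr_from_id (f Mor u).
Proof. by apply: arr_mor_eq; rewrite /= ?fid1 ?fid2 ?fdom. Qed.

Lemma lax_map_of_cel (b : A Cel) :
  lax_map f Mor (arr_of_cel b) = arr_of_cel (f Cel b).
Proof. by apply: arr_mor_eq; rewrite /= ?fid1 ?fsrc2 ?ftgt2 ?fdom ?fcod. Qed.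

Lemma lax_map_unit (s : A Mor) :
  lax_map f Mor (unit_mor s) = unit_mor (f Mor s).
Proof. by apply: arr_mor_eq; rewrite /= ?fid1 ?fid2 ?fdom ?fcod. Qed.

Lemma lax_map_from_unit (b : A Cel) :
  lax_map f Cel (cel_from_unit b) = cel_from_unit (f Cel b).
Proof.
apply: arr_cel_eq; rewrite /= ?fid2 ?fsrc2 //.
- exact: lax_map_unit.
- exact: lax_map_of_cel.
Qed.

Lemma lax_map_to_unit (b : A Cel) :
  lax_map f Cel (cel_to_unit b) = cel_to_unit (f Cel b).
Proof.
apply: arr_cel_eq; rewrite /= ?fid2 ?ftgt2 //.
- exact: lax_map_of_cel.
- exact: lax_map_unit.
Qed.

End LaxMap.

Section Equivariance.
Variables (A B C D : two_cat) (L : two_fib A B) (K : two_fib C D).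
Variable phi : two_functor L K.

Section Left.
Variable f : two_functor A C.
Hypothesis over : forall k i, legp K k (phi k i) = f k (legp L k i).

Definition left_equivariant : Prop :=
  forall k x (i : L k), lax_tgt A k x = legp L k i ->
  phi k (tlam L x i) = tlam K (lax_map f k x) (phi k i).

Definition preserves_lam_lift1 : Prop := forall u i, cod u = legp L Ob i ->
  phi Mor (lam_lift1 u i) = lam_lift1 (f Mor u) (phi Ob i).
Definition preserves_lam_lift2 : Prop := forall s a, src2 a = legp L Mor s ->
  phi Cel (lam_lift2 s a) = lam_lift2 (phi Mor s) (f Cel a).

(** Both sides solve the same equation: the image under [phi] of the
decomposition of [lam(x, c)] is the decomposition of [lam(f^2 x, phi c)], apart
from the term that is being compared, and the cleavages around it can be
cancelled. *)
Lemma left_equivariant_cel :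
  preserves_lam_lift1 -> preserves_lam_lift2 ->
  forall (x : lax_arrow A Cel) (c : L Cel), ac_t x = legp L Cel c ->
  phi Cel (tlam L x c) = tlam K (lax_map f Cel x) (phi Cel c).
Proof.
move=> H1 H2 x c e.
have e' : ac_t (lax_map f Cel x) = legp K Cel (phi Cel c) by rewrite over -e.
have [a v w E] := left_decomposition e.
have [a' v' w' E'] := left_decomposition e'.
have e0 := left_match_src2 e; have e1 := left_match_tgt2 e.
have d0 := left_match_dom e0; have d1 := left_match_cod e0.
have T (p : lax_arrow A Mor) s : am_t p = legp L Mor s ->
    phi Mor (tlam L (to_id_after p) s)
    = tlam K (to_id_after (lax_map f Mor p)) (phi Mor s).
  move=> ep; rewrite !tlam_to_id_after // ?over /= ?ep //.
  have dp := left_match_dom ep.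
  rewrite ftc1 ?cod_lam_lift1 //.
  by rewrite H1 // !fdom.
have N (p : lax_arrow A Mor) s : am_t p = legp L Mor s ->
    phi Cel (lam_lift2 (tlam L (to_id_after p) s) (am_z p))
    = lam_lift2 (tlam K (to_id_after (lax_map f Mor p)) (phi Mor s))
        (am_z (lax_map f Mor p)).
  move=> ep; rewrite H2 ?T //.
  by rewrite p_tlam ?to_id_after_tgt // to_id_after_src.
rewrite !fsrc2 !ftgt2 !fcod !fdom -!N // -!H1 // in a' v' E'.
set M1 := lam_lift1 (cod (src2 x)) (cod (src2 c)) in a v E a' v' E'.
set M0 := lam_lift1 (dom (src2 x)) (dom (src2 c)) in w E E'.
set N0 := lam_lift2 _ (am_z (src2 x)) in v E v' E'.
set N1 := lam_lift2 _ (am_z (tgt2 x)) in w E E'.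
set X' := tlam K _ _ in a' v' E' *.
have py : legp K Cel (phi Cel (tlam L x c)) = legp K Cel X'.
  by rewrite over !p_tlam // lax_src_map.
have am : cod (src2 (phi Cel (tlam L x c))) = dom (phi Mor M1).
  by rewrite fsrc2 fcod a fdom.
have mE : phi Cel (tch (id2 M1) (tlam L x c))
  = tch (id2 (phi Mor M1)) (phi Cel (tlam L x c)).
  by rewrite ftch ?cdom_id // fid2.
have vm : tgt2 (phi Cel N0) = src2 (tch (id2 (phi Mor M1)) (phi Cel (tlam L x
  c))).
  by rewrite -mE fsrc2 -v ftgt2.
have {}E' : tcv (tch (id2 (phi Mor M1)) (phi Cel (tlam L x c))) (phi Cel N0)
    = tcv (tch (id2 (phi Mor M1)) X') (phi Cel N0).
  rewrite E' -mE -ftcv // E ftcv // ftch; last by rewrite cdom_id cod_lam_lift1.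
  by rewrite fid2.
rewrite /M1 H1 // in am a' vm v' E'.
rewrite /N0 N // in vm v' E'.
apply: (lam_lift1_mono _ am a' py) => //; first by rewrite fcod over -d1.
apply: (lam_lift2_epi _ vm v' _ E').
  by rewrite p_tlam ?to_id_after_src // to_id_after_tgt over /= e0.
by rewrite !ftch ?cdom_id // py.
Qed.

Lemma left_equivariantP :
  left_equivariant <-> preserves_lam_lift1 /\ preserves_lam_lift2.
Proof.
split=> [H|[H1 H2] k x i e].
- split=> [u i e|s a e].
  + by rewrite /lam_lift1 H ?lax_map_to_id ?fid1 //= e.
  + by rewrite /lam_lift2 H ?lax_map_from_unit ?fid2 //= e.
have HC := left_equivariant_cel H1 H2.
have HM (y : lax_arrow A Mor) (s : L Mor) : am_t y = legp L Mor s ->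
    phi Mor (tlam L y s) = tlam K (lax_map f Mor y) (phi Mor s).
  move=> e'; apply: (@cid_inj _ _ (catv K)).
  rewrite -fid2 -!tapp_id2 //; last by rewrite lax_tgt_map over -e'.
  by rewrite HC ?fid2 //= e'.
case: k x i e => x i e; [|exact: HM|exact: HC].
apply: (@cid_inj _ _ (cat1 K)).
rewrite -fid1 -!tapp_id1 //; last by rewrite lax_tgt_map over -e.
by rewrite HM ?fid1 // [LHS](fid1 (lax_tgt A)) e.
Qed.
End Left.

Section Right.
Variable g : two_functor B D.
Hypothesis over : forall k i, legq K k (phi k i) = g k (legq L k i).

Definition right_equivariant : Prop :=
  forall k (i : L k) y, legq L k i = lax_src B k y ->
  phi k (trho L i y) = trho K (phi k i) (lax_map g k y).

Definition preserves_rho_lift1 : Prop := forall i v, legq L Ob i = dom v ->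
  phi Mor (rho_lift1 i v) = rho_lift1 (phi Ob i) (g Mor v).
Definition preserves_rho_lift2 : Prop := forall s b, legq L Mor s = tgt2 b ->
  phi Cel (rho_lift2 b s) = rho_lift2 (g Cel b) (phi Mor s).

(** The same argument as on the left, with the cancellation properties of the
lifts for [rho]. *)
Lemma right_equivariant_cel :
  preserves_rho_lift1 -> preserves_rho_lift2 ->
  forall (c : L Cel) (x : lax_arrow B Cel), legq L Cel c = ac_s x ->
  phi Cel (trho L c x) = trho K (phi Cel c) (lax_map g Cel x).
Proof.
move=> H1 H2 c x e.
have e' : legq K Cel (phi Cel c) = ac_s (lax_map g Cel x) by rewrite over e.
have [a v w E] := right_decomposition e.
have [a' v' w' E'] := right_decomposition e'.
have e0 := right_match_src2 e; have e1 := right_match_tgt2 e.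
have d0 := right_match_dom e0; have d1 := right_match_cod e0.
have T (p : lax_arrow B Mor) s : legq L Mor s = am_s p ->
    phi Mor (trho L s (from_id_before p))
    = trho K (phi Mor s) (from_id_before (lax_map g Mor p)).
  move=> ep; rewrite !trho_from_id_before // ?over /= ?ep //.
  have dp := right_match_cod ep.
  rewrite ftc1 ?dom_rho_lift1 //.
  by rewrite H1 // !fcod.
have N (p : lax_arrow B Mor) s : legq L Mor s = am_s p ->
    phi Cel (rho_lift2 (am_z p) (trho L s (from_id_before p)))
    = rho_lift2 (am_z (lax_map g Mor p))
        (trho K (phi Mor s) (from_id_before (lax_map g Mor p))).
  move=> ep; rewrite H2 ?T //.
  by rewrite q_trho ?from_id_before_src // from_id_before_tgt.
rewrite !fsrc2 !ftgt2 !fcod !fdom -!N // -!H1 // in a' v' E'.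
set M1 := rho_lift1 (cod (src2 c)) (cod (src2 x)) in w E E'.
set M0 := rho_lift1 (dom (src2 c)) (dom (src2 x)) in a v E a' v' E'.
set N0 := rho_lift2 (am_z (src2 x)) _ in w E E'.
set N1 := rho_lift2 (am_z (tgt2 x)) _ in v E v' E'.
set X' := trho K _ _ in a' v' E' *.
have qy : legq K Cel (phi Cel (trho L c x)) = legq K Cel X'.
  by rewrite over !q_trho // lax_tgt_map.
have am : dom (src2 (phi Cel (trho L c x))) = cod (phi Mor M0).
  by rewrite fsrc2 fdom a fcod.
have mE : phi Cel (tch (trho L c x) (id2 M0))
  = tch (phi Cel (trho L c x)) (id2 (phi Mor M0)).
  by rewrite ftch ?cdom_id // fid2.
have vm : tgt2 (tch (phi Cel (trho L c x)) (id2 (phi Mor M0)))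
  = src2 (phi Cel N1).
  by rewrite -mE ftgt2 v fsrc2.
have {}E' : tcv (phi Cel N1) (tch (phi Cel (trho L c x)) (id2 (phi Mor M0)))
    = tcv (phi Cel N1) (tch X' (id2 (phi Mor M0))).
  rewrite E' -mE -ftcv // E ftcv // ftch; last by rewrite cdom_id dom_rho_lift1.
  by rewrite fid2.
rewrite /M0 H1 // in am a' vm v' E'.
rewrite /N1 N // in vm v' E'.
apply: (rho_lift1_epi _ am a' qy) => //; first by rewrite fdom over d0.
apply: (rho_lift2_mono _ vm v' _ E').
  by rewrite q_trho ?from_id_before_tgt // from_id_before_src over /= e1.
by rewrite !ftch ?cdom_id // qy.
Qed.

Lemma right_equivariantP :
  right_equivariant <-> preserves_rho_lift1 /\ preserves_rho_lift2.
Proof.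
split=> [H|[H1 H2] k i x e].
- split=> [i v e|s b e].
  + by rewrite /rho_lift1 H ?lax_map_from_id ?fid1 //= e.
  + by rewrite /rho_lift2 H ?lax_map_to_unit ?fid2 //= e.
have HC := right_equivariant_cel H1 H2.
have HM (s : L Mor) (y : lax_arrow B Mor) : legq L Mor s = am_s y ->
    phi Mor (trho L s y) = trho K (phi Mor s) (lax_map g Mor y).
  move=> e'; apply: (@cid_inj _ _ (catv K)).
  rewrite -fid2 -!tapp_id2 //; last by rewrite lax_src_map over e'.
  by rewrite HC ?fid2 //= e'.
case: k i x e => i x e; [|exact: HM|exact: HC].
apply: (@cid_inj _ _ (cat1 K)).
rewrite -fid1 -!tapp_id1 //; last by rewrite lax_src_map over e.
by rewrite HM ?fid1 // [RHS](fid1 (lax_src B)) e.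
Qed.
End Right.
End Equivariance.

(** * Acting from both sides *)

Section TwoSidedAction.
Variables (A B : two_cat) (S : two_fib A B).

Definition bact k (x : lax_arrow A k) (i : S k) (y : lax_arrow B k) : S k :=
  tlam S x (trho S i y).

Definition bmatch k (x : lax_arrow A k) (i : S k) (y : lax_arrow B k) : Prop :=
  lax_tgt A k x = legp S k i /\ legq S k i = lax_src B k y.

Lemma bmatch_left k x (i : S k) y : bmatch x i y ->
  lax_tgt A k x = legp S k (trho S i y).
Proof. by case=> e1 e2; rewrite p_trho. Qed.

Lemma p_bact k x (i : S k) y : bmatch x i y -> legp S k (bact x i y)
  = lax_src A k x.
Proof. by move=> m; rewrite p_tlam ?(bmatch_left m). Qed.

Lemma q_bact k x (i : S k) y : bmatch x i y -> legq S k (bact x i y)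
  = lax_tgt B k y.
Proof. by move=> m; rewrite q_tlam ?(bmatch_left m) // q_trho //; case: m. Qed.

Lemma bact_dom (x : lax_arrow A Mor) (i : S Mor) (y : lax_arrow B Mor) :
  bmatch x i y -> dom (bact x i y) = bact (dom x) (dom i) (dom y).
Proof. by move=> m; rewrite tapp_dom ?(bmatch_left m) // tapp_dom //;
  case: m. Qed.

Lemma bact_cod (x : lax_arrow A Mor) (i : S Mor) (y : lax_arrow B Mor) :
  bmatch x i y -> cod (bact x i y) = bact (cod x) (cod i) (cod y).
Proof. by move=> m; rewrite tapp_cod ?(bmatch_left m) // tapp_cod //;
  case: m. Qed.

Lemma bact_src2 (x : lax_arrow A Cel) (i : S Cel) (y : lax_arrow B Cel) :
  bmatch x i y -> src2 (bact x i y) = bact (src2 x) (src2 i) (src2 y).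
Proof. by move=> m; rewrite tapp_src2 ?(bmatch_left m) // tapp_src2 //;
  case: m. Qed.

Lemma bact_tgt2 (x : lax_arrow A Cel) (i : S Cel) (y : lax_arrow B Cel) :
  bmatch x i y -> tgt2 (bact x i y) = bact (tgt2 x) (tgt2 i) (tgt2 y).
Proof. by move=> m; rewrite tapp_tgt2 ?(bmatch_left m) // tapp_tgt2 //;
  case: m. Qed.

Lemma bact_id2 (x : lax_arrow A Mor) (i : S Mor) (y : lax_arrow B Mor) :
  bmatch x i y -> bact (id2 x) (id2 i) (id2 y) = id2 (bact x i y).
Proof. by move=> m; rewrite -tapp_id2 ?(bmatch_left m) // -tapp_id2 //;
  case: m. Qed.

Lemma bact_tch (x x' : lax_arrow A Cel) (i i' : S Cel) (y y' : lax_arrow B Cel)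
  :
  bmatch x i y -> bmatch x' i' y' ->
  cod (src2 x) = dom (src2 x') -> cod (src2 i) = dom (src2 i') ->
  cod (src2 y) = dom (src2 y') ->
  bact (tch x' x) (tch i' i) (tch y' y) = tch (bact x' i' y') (bact x i y).
Proof.
move=> m m' ex ei ey; rewrite /bact.
have [_ n] := m; have [_ n'] := m'.
have l := bmatch_left m; have l' := bmatch_left m'.
rewrite tapp_tch // tapp_tch //.
by rewrite !tapp_src2 // tapp_cod ?tapp_dom -?fsrc2 ?n ?n' // ei ey.
Qed.

Lemma bact_tcv (x x' : lax_arrow A Cel) (i i' : S Cel) (y y' : lax_arrow B Cel)
  :
  bmatch x i y -> bmatch x' i' y' ->
  tgt2 x = src2 x' -> tgt2 i = src2 i' -> tgt2 y = src2 y' ->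
  bact (tcv x' x) (tcv i' i) (tcv y' y) = tcv (bact x' i' y') (bact x i y).
Proof.
move=> m m' ex ei ey; rewrite /bact.
have [_ n] := m; have [_ n'] := m'.
have l := bmatch_left m; have l' := bmatch_left m'.
rewrite tapp_tcv // tapp_tcv //.
by rewrite tapp_tgt2 // tapp_src2 // ei ey.
Qed.

End TwoSidedAction.

(** * The comparison between the two actions at a junction *)

(** The legs of [S] have the same codomain; an object of [S] on which they
agree is a matching pair, and one with an arrow [u] between its images can be
acted on by [u] from either side. *)

Section Junction.
Variables (A : two_cat) (S : two_fib A A).

(** Both cleavages at once: [junction1 u i : lam(u, i) -> rho(i, u)] and
[junction2 a s : rho(s, a) => lam(a, s)], with legs [u] and [u], respectively
[a] and [a]. *)
Definition junction1 (u : A Mor) (i : S Ob) : S Mor :=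
  bact (k := Mor) (arr_to_id u) (id1 i) (arr_from_id u).
Definition junction2 (a : A Cel) (s : S Mor) : S Cel :=
  bact (k := Cel) (cel_from_unit a) (id2 s) (cel_to_unit a).

Lemma junction1_match (u : A Mor) (i : S Ob) :
  legq S Ob i = dom u -> cod u = legp S Ob i ->
  bmatch (k := Mor) (arr_to_id u) (id1 i) (arr_from_id u).
Proof. by move=> e1 e2; split; rewrite fid1 ?e1 -?e2. Qed.

Lemma junction2_match (a : A Cel) (s : S Mor) :
  legq S Mor s = tgt2 a -> src2 a = legp S Mor s ->
  bmatch (k := Cel) (cel_from_unit a) (id2 s) (cel_to_unit a).
Proof. by move=> e1 e2; split; rewrite fid2 ?e1 -?e2. Qed.

(** Its legs are the two sides of the cell [z] of [p]; the actions of [z] on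
it, from the left and from the right, are the two composites in the naturality
square of [junction1] at [p] and [s]. *)
Definition bact_along (p : lax_arrow A Mor) (s : S Mor) : S Mor :=
  bact (to_id_after p) s (from_id_before p).

Lemma bact_along_match (p : lax_arrow A Mor) (s : S Mor) :
  legq S Mor s = am_s p -> am_t p = legp S Mor s ->
  bmatch (to_id_after p) s (from_id_before p).
Proof. by move=> e1 e2; split; rewrite ?to_id_after_tgt ?from_id_before_src.
  Qed.

Lemma bact_cells_match (p : lax_arrow A Mor) (s : S Mor) :
  legq S Mor s = am_s p -> am_t p = legp S Mor s ->
  bmatch (to_id_cell p) (id2 s) (from_id_cell p).
Proof.
move=> e1 e2; split.
  by rewrite tpaste_tgt ?to_id_cell_match // !fid2 to_id_after_tgt e2.
by rewrite tpaste_src ?from_id_cell_match // !fid2 from_id_before_src e1.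
Qed.

(** As the two actions commute, [to_id_after p] and [from_id_before p] can act
first, which gives [bact_along p s]; then the cell of [p] acts from both sides.
*)
Lemma bact_cells (p : lax_arrow A Mor) (s : S Mor) :
  legq S Mor s = am_s p -> am_t p = legp S Mor s ->
  bact (to_id_cell p) (id2 s) (from_id_cell p)
    = junction2 (am_z p) (bact_along p s).
Proof.
move=> e1 e2; have m := bact_along_match e1 e2; have [m1 m2] := m.
rewrite /junction2 -bact_id2 // /bact trho_tlam; last 2 first.
- by rewrite !fid2 (bmatch_left m) tapp_id2 // fid2.
- by rewrite tapp_id2 // fid2 q_trho // from_id_before_tgt.
rewrite -trho_comp ?from_id_cell_match ?fid2 ?m2 //.
rewrite -tlam_comp ?to_id_cell_match //.
by rewrite p_trho !fid2 ?m1 // tpaste_src ?from_id_cell_match // !fid2 m2.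
Qed.

Section Decomposition.
Variables (x : lax_arrow A Cel) (c : S Cel).
Hypothesis eq : legq S Cel c = ac_s x.
Hypothesis ep : ac_t x = legp S Cel c.

Let K1 := junction1 (cod (src2 x)) (cod (src2 c)).
Let K0 := junction1 (dom (src2 x)) (dom (src2 c)).
Let Z0 := junction2 (am_z (src2 x)) (bact_along (src2 x) (src2 c)).
Let Z1 := junction2 (am_z (tgt2 x)) (bact_along (tgt2 x) (tgt2 c)).

(** Lax naturality of [junction1], with [junction2] filling the squares at the
source and the target of [x]: the images of [to_id_cell_natural] and
[from_id_cell_natural] under the action from both sides. Composability is
stated along with the equation, since the latter is transported along
2-functors. *)
Lemma junction_decomposition :
  [/\ cod (src2 (tlam S x c)) = dom K1 /\ tgt2 Z0
    = src2 (tch (id2 K1) (tlam S x c)),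
    cod K0 = dom (src2 (trho S c x)) /\ tgt2 (tch (trho S c x) (id2 K0))
      = src2 Z1 &
    tcv (tch (id2 K1) (tlam S x c)) Z0 = tcv Z1 (tch (trho S c x) (id2 K0))].
Proof.
have q0 := right_match_src2 eq; have q1 := right_match_tgt2 eq.
have p0 := left_match_src2 ep; have p1 := left_match_tgt2 ep.
have k0 := junction1_match (right_match_dom q0) (left_match_dom p0).
have k1 := junction1_match (right_match_cod q0) (left_match_cod p0).
have k0' : bmatch (k := Cel) (id2 (arr_to_id (dom (src2 x)) : lax_arrow A Mor))
    (id2 (id1 (dom (src2 c)))) (id2 (arr_from_id (dom (src2 x)) : lax_arrow A
      Mor)).
  by case: k0 => a b; split; rewrite !fid2 ?a ?b.
have k1' : bmatch (k := Cel) (id2 (arr_to_id (cod (src2 x)) : lax_arrow A Mor))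
    (id2 (id1 (cod (src2 c)))) (id2 (arr_from_id (cod (src2 x)) : lax_arrow A
      Mor)).
  by case: k1 => a b; split; rewrite !fid2 ?a ?b.
have L : bmatch x c (unit_cel (ac_s x)) by [].
have R : bmatch (k := Cel) (unit_cel (ac_t x)) c x by [].
have EL : tlam S x c = bact x c (unit_cel (ac_s x)).
  by rewrite /bact -[unit_cel _]/(lax_unit A Cel _) -eq trho_unit.
have ER : trho S c x = bact (k := Cel) (unit_cel (ac_t x)) c x.
  by rewrite /bact -[unit_cel _]/(lax_unit A Cel _) ep -(p_trho eq) tlam_unit.
have hL := unit_whisk_from_id_match x; have hR := unit_whisk_to_id_match x.
have h1 : tch (id2 K1) (tlam S x c)
    = bact (whisk_to_id x) c (unit_whisk_from_id x).
  by rewrite EL -bact_id2 // -bact_tch ?cdom_id // th_idl.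
have h0 : tch (trho S c x) (id2 K0)
    = bact (unit_whisk_to_id x) c (whisk_from_id x).
  by rewrite ER -bact_id2 // -bact_tch ?cdom_id ?ccod_id // th_idr.
have m1 : bmatch (whisk_to_id x) c (unit_whisk_from_id x).
  by split; rewrite ?whisk_to_id_tgt ?unit_whisk_from_id_src.
have m0 : bmatch (unit_whisk_to_id x) c (whisk_from_id x).
  by split; rewrite ?unit_whisk_to_id_tgt ?whisk_from_id_src.
have n0 := bact_cells_match q0 p0; have n1 := bact_cells_match q1 p1.
have z0 := bact_cells q0 p0; have z1 := bact_cells q1 p1.
have v0 := to_id_cell_whisk x; have v1 := whisk_to_id_cell x.
have w0 := whisk_from_id_cell x; have w1 := from_id_cell_whisk x.
split.
- split; last by rewrite h1 /Z0 -z0 bact_tgt2 // bact_src2 // v0 w1 ccod_id.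
  rewrite EL bact_src2 // bact_cod; last first.
    by case: L => a b; split; rewrite -?fsrc2 ?a ?b.
  by rewrite /K1 bact_dom // cdom_id /= ac_src_s am_cod_s.
- split; last by rewrite h0 /Z1 -z1 bact_tgt2 // bact_src2 // v1 w0 cdom_id.
  rewrite ER bact_src2 // bact_dom; last first.
    by case: R => a b; split; rewrite -?fsrc2 ?a ?b.
  by rewrite /K0 bact_cod // ccod_id /= ac_src_t am_dom_t.
rewrite h1 h0 /Z0 /Z1 -z0 -z1 -!bact_tcv ?cdom_id ?ccod_id //.
by rewrite to_id_cell_natural from_id_cell_natural tidl ?tidr.
Qed.
End Decomposition.
End Junction.

(** * Equivariance at a junction *)

(** [P] is the 2-category of matching pairs, included in [S] by [iota]. *)

Section Balanced.
Variables (A : two_cat) (S : two_fib A A) (P K : two_cat).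
Variables (iota : two_functor P S) (phi : two_functor P K).
Hypothesis iota_inj : forall k, injective (iota k).
Hypothesis iota_surj : forall k (i : S k), legq S k i = legp S k i ->
  exists j, iota k j = i.

Definition balanced : Prop := forall k x (i : S k) (r l : P k),
  legq S k i = lax_src A k x -> lax_tgt A k x = legp S k i ->
  iota k r = trho S i x -> iota k l = tlam S x i -> phi k r = phi k l.

Definition collapses_junction1 : Prop := forall u i (w : P Mor),
  legq S Ob i = dom u -> cod u = legp S Ob i ->
  iota Mor w = junction1 u i -> exists c, phi Mor w = id1 c.
Definition collapses_junction2 : Prop := forall a s (w : P Cel),
  legq S Mor s = tgt2 a -> src2 a = legp S Mor s ->
  iota Cel w = junction2 a s -> exists r, phi Cel w = id2 r.

(** All terms of [junction_decomposition] lie in [P], so that [phi] can be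
applied to it; then only the compared terms are left. *)
Lemma balanced_cel : collapses_junction1 -> collapses_junction2 ->
  forall (x : lax_arrow A Cel) (c : S Cel) (r l : P Cel),
  legq S Cel c = ac_s x -> ac_t x = legp S Cel c ->
  iota Cel r = trho S c x -> iota Cel l = tlam S x c -> phi Cel r = phi Cel l.
Proof.
move=> H1 H2 x c r l eq ep er el.
have [[aL vL] [aR vR] E] := junction_decomposition eq ep.
have q0 := right_match_src2 eq; have q1 := right_match_tgt2 eq.
have p0 := left_match_src2 ep; have p1 := left_match_tgt2 ep.
have b (p : lax_arrow A Mor) (s : S Mor) : legq S Mor s = am_s p -> am_t p
  = legp S Mor s ->
    legq S Mor (bact_along p s) = tgt2 (am_z p) /\ src2 (am_z p)
      = legp S Mor (bact_along p s).
  move=> e1 e2; have m := bact_along_match e1 e2.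
  by rewrite q_bact // p_bact // from_id_before_tgt to_id_after_src.
have HK (u : A Mor) (i : S Ob) : legq S Ob i = dom u -> cod u = legp S Ob i ->
    exists w, iota Mor w = junction1 u i /\ exists k, phi Mor w = id1 k.
  move=> e1 e2; have m := junction1_match e1 e2.
  have [|w ew] := @iota_surj Mor (junction1 u i);
    first by rewrite q_bact // p_bact.
  by exists w; split=> //; apply: H1 ew.
have HZ (a : A Cel) (s : S Mor) : legq S Mor s = tgt2 a -> src2 a
  = legp S Mor s ->
    exists w, iota Cel w = junction2 a s /\ exists k, phi Cel w = id2 k.
  move=> e1 e2; have m := junction2_match e1 e2.
  have [|w ew] := @iota_surj Cel (junction2 a s);
    first by rewrite q_bact // p_bact.
  by exists w; split=> //; apply: H2 ew.
have [k0 [ek0 [d0 f0]]] := HK _ _ (right_match_dom q0) (left_match_dom p0).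
have [k1 [ek1 [d1 f1]]] := HK _ _ (right_match_cod q0) (left_match_cod p0).
have [q0' p0'] := b _ _ q0 p0; have [q1' p1'] := b _ _ q1 p1.
have [z0 [ez0 [s0 g0]]] := HZ _ _ q0' p0'.
have [z1 [ez1 [s1 g1]]] := HZ _ _ q1' p1'.
have cL : cod (src2 l) = dom k1.
  by apply: iota_inj; rewrite -fcod -fdom -fsrc2 el ek1.
have cR : cod k0 = dom (src2 r).
  by apply: iota_inj; rewrite -fcod -fdom -fsrc2 er ek0.
have eL : iota Cel (tch (id2 k1) l) = tch (id2 (junction1 (cod (src2 x)) (cod
  (src2 c)))) (tlam S x c).
  by rewrite ftch ?cdom_id // fid2 ek1 el.
have eR : iota Cel (tch r (id2 k0)) = tch (trho S c x) (id2 (junction1 (dom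
  (src2 x)) (dom (src2 c)))).
  by rewrite ftch ?cdom_id // fid2 ek0 er.
have wL : tgt2 z0 = src2 (tch (id2 k1) l).
  by apply: iota_inj; rewrite -fsrc2 -ftgt2 eL ez0.
have wR : tgt2 (tch r (id2 k0)) = src2 z1.
  by apply: iota_inj; rewrite -fsrc2 -ftgt2 eR ez1.
have EP : tcv (tch (id2 k1) l) z0 = tcv z1 (tch r (id2 k0)).
  by apply: iota_inj; rewrite !ftcv // eL eR ez0 ez1.
move/(f_equal (phi Cel)): EP.
rewrite !ftcv // !ftch ?cdom_id // !fid2 f0 f1 g0 g1.
have tL : cod (src2 (phi Cel l)) = d1 by rewrite fsrc2 fcod cL -fdom f1 cdom_id.
have tR : dom (src2 (phi Cel r)) = d0 by rewrite fsrc2 fdom -cR -fcod f0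
  ccod_id.
rewrite th_idl // th_idr //.
have uL : s0 = src2 (phi Cel l).
  have := f_equal (phi Mor) wL; rewrite -ftgt2 g0 ccod_id => ->.
  by rewrite -fsrc2 ftch ?cdom_id // fid2 f1 th_idl.
have uR : tgt2 (phi Cel r) = s1.
  have := f_equal (phi Mor) wR; rewrite -fsrc2 g1 cdom_id => <-.
  by rewrite -ftgt2 ftch ?cdom_id // fid2 f0 th_idr.
by rewrite tidl // tidr.
Qed.

Lemma balancedP : balanced <-> collapses_junction1 /\ collapses_junction2.
Proof.
split=> [H|[H1 H2]].
- split=> [u i w e1 e2 ew|a s w e1 e2 ew].
  + have me := lam_mor_match e2; have mr := rho_mor_match e1.
    (* [junction1 u i] is [rho] of [arr_from_id u] on the lift of [u]; moving
       this action to the other side undoes the lift. *)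
    have [|l el] := @iota_surj Mor (tlam S (k :=
      Mor) (arr_from_id u) (lam_lift1 u i)).
      by rewrite q_tlam ?p_tlam // q_tlam // fid1 e1.
    exists (phi Ob (dom l)).
    rewrite -fid1 (H Mor (arr_from_id u) (lam_lift1 u i) w l) //.
    * congr (phi Mor _); apply: iota_inj; rewrite fid1 -fdom el.
      rewrite /lam_lift1 -tlam_comp // tpaste_from_to_id tapp_id1 //.
      by rewrite cdom_id.
    * by rewrite q_tlam // fid1 e1.
    * by rewrite p_tlam.
    * by rewrite ew trho_tlam.
  + have me := lam_cel_match e2; have mr := rho_cel_match e1.
    have [|l el] := @iota_surj Cel (tlam S (k :=
      Cel) (cel_to_unit a) (lam_lift2 s a)).
      by rewrite q_tlam ?p_tlam // q_tlam // fid2 e1.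
    exists (phi Mor (src2 l)).
    rewrite -fid2 (H Cel (cel_to_unit a) (lam_lift2 s a) w l) //.
    * congr (phi Cel _); apply: iota_inj; rewrite fid2 -fsrc2 el.
      rewrite /lam_lift2 -tlam_comp // tpaste_to_from_unit tapp_id2 //.
      by rewrite cdom_id.
    * by rewrite q_tlam // fid2 e1.
    * by rewrite p_tlam.
    * by rewrite ew trho_tlam.
have HC := balanced_cel H1 H2.
have HM (x : lax_arrow A Mor) (s : S Mor) (r l : P Mor) :
    legq S Mor s = am_s x -> am_t x = legp S Mor s ->
    iota Mor r = trho S s x -> iota Mor l = tlam S x s -> phi Mor r = phi Mor l.
  move=> e1 e2 er el; apply: (@cid_inj _ _ (catv K)); rewrite -!fid2.
  apply: (HC (id2 x) (id2 s)); rewrite ?fid2 ?er ?el ?tapp_id2 //.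
  - by rewrite e1.
  - by rewrite -e2.
case=> x i r l e1 e2 er el; [|exact: HM er el|exact: HC er el].
apply: (@cid_inj _ _ (cat1 K)); rewrite -!fid1.
apply: (HM (id1 x) (id1 i)); rewrite ?fid1 ?er ?el ?tapp_id1 //.
- by rewrite e1 -(fid1 (lax_src A)).
- by rewrite -e2 -(fid1 (lax_tgt A)).
Qed.

End Balanced.

(** * Tuples as a split two-sided 2-fibration *)

Lemma comp_is_functor O M O' M' O'' M'' (X : cat_on O M) (Y : cat_on O' M')
  (Z : cat_on O'' M'') F0 F1 G0 G1 :
  is_functor X Y F0 F1 -> is_functor Y Z G0 G1 ->
  is_functor X Z (fun a => G0 (F0 a)) (fun s => G1 (F1 s)).
Proof.
move=> FF GG; split=> [s|s|a|t s e e'].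
- by rewrite (is_fdom GG) (is_fdom FF).
- by rewrite (is_fcod GG) (is_fcod FF).
- by rewrite (is_fid FF) (is_fid GG).
have e1 : ccod Y (F1 s) = cdom Y (F1 t) by rewrite (is_fcod FF) (is_fdom FF) e.
by rewrite (is_fcomp FF _ e1) (is_fcomp GG _ e').
Qed.

Definition comp_functor (A B C : two_cat) (G : two_functor B C)
  (F : two_functor A B) : two_functor A C :=
  @TwoFunctor A C (fun k x => G k (F k x))
    (comp_is_functor (functor1 F) (functor1 G))
    (comp_is_functor (functorv F) (functorv G))
    (comp_is_functor (functorh F) (functorh G)).

Section PairFunctor.
Variables (Q A B C : two_cat) (F : two_functor A C) (G : two_functor B C).
Variables (X : two_functor Q A) (Y : two_functor Q B).
Hypothesis XY : forall k z, F k (X k z) = G k (Y k z).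

Definition pair_functor : two_functor Q (pullback F G).
Proof.
refine (@TwoFunctor Q (pullback F G) (fun k z => pb (X k z) (Y k z) (XY z)) _ _
  _);
  split=> [z|z|z|y z e e']; apply: sig_eq; congr pair => /=.
all: by [exact: is_fdom (functor1 _) _ | exact: is_fcod (functor1 _) _
  | exact: is_fid (functor1 _) _ | exact: is_fcomp (functor1 _) _ _ _ _
  | exact: is_fdom (functorv _) _ | exact: is_fcod (functorv _) _
  | exact: is_fid (functorv _) _ | exact: is_fcomp (functorv _) _ _ _ _
  | exact: is_fdom (functorh _) _ | exact: is_fcod (functorh _) _
  | exact: is_fid (functorh _) _ | exact: is_fcomp (functorh _) _ _ _ _].
Defined.
End PairFunctor.

Section Projections.
Variables (A B C : two_cat) (F : two_functor A C) (G : two_functor B C).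

Definition pb_fst : two_functor (pullback F G) A.
Proof.
by refine (@TwoFunctor (pullback F G) A (fun k z => (proj1_sig z).1) _ _ _);
  split=> // y z e e'; apply: ccomp_eq.
Defined.

Definition pb_snd : two_functor (pullback F G) B.
Proof.
by refine (@TwoFunctor (pullback F G) B (fun k z => (proj1_sig z).2) _ _ _);
  split=> // y z e e'; apply: ccomp_eq.
Defined.
End Projections.

Lemma eq_dfwith (I : eqType) (T : I -> Type) (f h : forall i, T i) i (v : T i) :
  h i = v -> (forall j, j != i -> h j = f j) -> h = dfwith f v.
Proof.
move=> hi hf; apply: functional_extensionality_dep.
by apply: (@dfwith_ind _ _ (fun j w => h j = w)).
Qed.

Lemma sub_is_functor O M O' M' (X : cat_on O M) (Y : cat_on O' M') P0 P1
  (s : @is_subcat _ _ Y P0 P1) (F0 : O -> {a | P0 a}) (F1 : M -> {f | P1 f}) :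
  is_functor X (sub_cat s) F0 F1
  <-> is_functor X Y (fun z => proj1_sig (F0 z)) (fun z => proj1_sig (F1 z)).
Proof.
split=> F; split=> [z|z|z|z y e e'].
- by rewrite -(is_fdom F).
- by rewrite -(is_fcod F).
- by rewrite (is_fid F).
- have ee : ccod (sub_cat s) (F1 y) = cdom (sub_cat s) (F1 z) by apply: sig_eq.
  by rewrite (is_fcomp F _ ee); apply: ccomp_eq.
- by apply: sig_eq; apply: (is_fdom F).
- by apply: sig_eq; apply: (is_fcod F).
- by apply: sig_eq; apply: (is_fid F).
- by apply: sig_eq; apply: (is_fcomp F).
Qed.

Lemma dfwith_is_functor O M (X : cat_on O M) (I : eqType) (O' M' : I -> Type)
  (Y : forall i, cat_on (O' i) (M' i)) G0 G1 m H0 H1 :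
  is_functor X (dprod_cat Y) G0 G1 -> is_functor X (Y m) H0 H1 ->
  is_functor X (dprod_cat Y) (fun z => dfwith (G0 z) (H0 z))
    (fun z => dfwith (G1 z) (H1 z)).
Proof.
move=> FG FH; split=> [z|z|z|z y e e'].
- apply: eq_dfwith => [|j jm] /=; first by rewrite !dfwith_in (is_fdom FH).
  by rewrite dfwith_out 1?eq_sym // -(is_fdom FG).
- apply: eq_dfwith => [|j jm] /=; first by rewrite !dfwith_in (is_fcod FH).
  by rewrite dfwith_out 1?eq_sym // -(is_fcod FG).
- apply/esym/eq_dfwith => [|j jm] /=; first by rewrite !dfwith_in (is_fid FH).
  by rewrite dfwith_out 1?eq_sym // (is_fid FG).
have eG : ccod (dprod_cat Y) (G1 y) = cdom (dprod_cat Y) (G1 z).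
  by rewrite (is_fcod FG) (is_fdom FG) e.
have eH : ccod (Y m) (H1 y) = cdom (Y m) (H1 z).
  by rewrite (is_fcod FH) (is_fdom FH) e.
rewrite (is_fcomp FG _ eG) (is_fcomp FH _ eH).
apply/esym/eq_dfwith => [|j jm] /=.
  by apply: ccomp_eq; rewrite dfwith_in.
by apply: ccomp_eq; rewrite dfwith_out // eq_sym.
Qed.

Lemma lam_congr A' B' (L : two_fib A' B') k x y (i j : L k) e e' :
  x = y -> i = j -> lam L k (pb x i e) = lam L k (pb y j e').
Proof. by move=> ex ei; subst; rewrite (proof_irrelevance _ e e'). Qed.
Lemma rho_congr A' B' (L : two_fib A' B') k x y (i j : L k) e e' :
  i = j -> x = y -> rho L k (pb i x e) = rho L k (pb j y e').
Proof. by move=> ex ei; subst; rewrite (proof_irrelevance _ e e'). Qed.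

Section Tuples.
Variables (n : nat) (A : nat -> two_cat).
Variable J : forall m : 'I_n.+1, two_fib (A m) (A m.+1).
Variable S : pred 'I_n.

Definition coord_functor m : two_functor (tuples J S) (J m).
Proof.
by refine (@TwoFunctor (tuples J S) (J m) (fun k i => coord i m) _ _ _);
  split=> // y z e e'; apply: ccomp_eq.
Defined.

Section Update.
Variables (Q : two_cat) (G : two_functor Q (tuples J S)) (m : 'I_n.+1).
Variable H : two_functor Q (J m).
Hypothesis match_GH : forall k z l, S l -> matched l (dfwith (coord (G k z)) (H
  k z)).

Definition update : two_functor Q (tuples J S).
Proof.
refine (@TwoFunctor Q (tuples J S)
  (fun k z => exist _ (dfwith (coord (G k z)) (H k z)) (@match_GH k z)) _ _ _);
  apply/sub_is_functor; apply: dfwith_is_functor.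
- exact: (proj1 (@sub_is_functor _ _ _ _ _ _ _ _ _ _ _) (functor1 G)).
- exact: functor1.
- exact: (proj1 (@sub_is_functor _ _ _ _ _ _ _ _ _ _ _) (functorv G)).
- exact: functorv.
- exact: (proj1 (@sub_is_functor _ _ _ _ _ _ _ _ _ _ _) (functorh G)).
- exact: functorh.
Defined.
End Update.

(** [lam] acts at the coordinate [a] and [rho] at the coordinate [b]. As they
change [legp] at [a] and [legq] at [b], tuples remain matching if [S] has no
junction immediately to the left of [a] or to the right of [b]. *)
Section TuplesFib.
Variables a b : 'I_n.+1.
Hypothesis free_a : forall l, S l -> rjoin l != a.
Hypothesis free_b : forall l, S l -> ljoin l != b.

Definition tuples_p : two_functor (tuples J S) (A a) :=
  comp_functor (legp (J a)) (coord_functor a).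
Definition tuples_q : two_functor (tuples J S) (A b.+1) :=
  comp_functor (legq (J b)) (coord_functor b).

Lemma match_update_left k (i : tuples J S k) (v : J a k) :
  legq (J a) k v = legq (J a) k (coord i a) ->
  forall l, S l -> matched l (dfwith (coord i) v).
Proof.
move=> e l Sl; rewrite /matched [in RHS]dfwith_out;
  last by rewrite eq_sym free_a.
apply: etrans _ (proj2_sig i l Sl).
exact: (@dfwith_ind _ _ (fun m w => legq (J m) k w = legq (J m) k (coord i m))
  (coord i) a v e (fun _ _ => erefl) (ljoin l)).
Qed.

Lemma match_update_right k (i : tuples J S k) (v : J b k) :
  legp (J b) k v = legp (J b) k (coord i b) ->
  forall l, S l -> matched l (dfwith (coord i) v).
Proof.
move=> e l Sl; rewrite /matched [in LHS]dfwith_out;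
  last by rewrite eq_sym free_b.
apply: etrans (proj2_sig i l Sl) _; apply/esym.
exact: (@dfwith_ind _ _ (fun m w => legp (J m) k w = legp (J m) k (coord i m))
  (coord i) b v e (fun _ _ => erefl) (rjoin l)).
Qed.

Definition lam_at : two_functor (pullback (lax_tgt (A a)) tuples_p) (J a) :=
  comp_functor (lam (J a))
    (@pair_functor _ _ _ _ (lax_tgt (A a)) (legp (J a))
       (pb_fst (lax_tgt (A a)) tuples_p)
       (comp_functor (coord_functor a) (pb_snd (lax_tgt (A a)) tuples_p))
       (fun k z => proj2_sig z)).

Definition rho_at : two_functor (pullback tuples_q (lax_src (A b.+1))) (J b) :=
  comp_functor (rho (J b))
    (@pair_functor _ _ _ _ (legq (J b)) (lax_src (A b.+1))
       (comp_functor (coord_functor b) (pb_fst tuples_q (lax_src (A b.+1))))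
       (pb_snd tuples_q (lax_src (A b.+1)))
       (fun k z => proj2_sig z)).

Lemma lam_at_match k (z : pullback (lax_tgt (A a)) tuples_p k) l : S l ->
  matched l (dfwith (coord (pb_snd (lax_tgt (A a)) tuples_p k z)) (lam_at k z)).
Proof. by apply: match_update_left; exact: q_lam. Qed.

Lemma rho_at_match k (z : pullback tuples_q (lax_src (A b.+1)) k) l : S l ->
  matched l (dfwith (coord (pb_fst tuples_q (lax_src (A b.+1)) k z)) (rho_at k
    z)).
Proof. by apply: match_update_right; exact: p_rho. Qed.

Definition tuples_lam := update lam_at_match.
Definition tuples_rho := update rho_at_match.

Lemma tuples_eq k (i j : tuples J S k) : (forall m, coord i m = coord j m) ->
  i = j.
Proof. by move=> E; apply: sig_eq; apply: functional_extensionality_dep. Qed.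

Lemma tuples_lam_at k x i e : coord (tuples_lam k (pb x i e)) a
  = lam (J a) k (pb x (coord i a) e).
Proof. exact: dfwith_in. Qed.
Lemma tuples_lam_out k x i e m : m != a -> coord (tuples_lam k (pb x i e)) m
  = coord i m.
Proof. by move=> ma; apply: dfwith_out; rewrite eq_sym. Qed.
Lemma tuples_rho_at k x i e : coord (tuples_rho k (pb i x e)) b
  = rho (J b) k (pb (coord i b) x e).
Proof. exact: dfwith_in. Qed.
Lemma tuples_rho_out k x i e m : m != b -> coord (tuples_rho k (pb i x e)) m
  = coord i m.
Proof. by move=> ma; apply: dfwith_out; rewrite eq_sym. Qed.

Lemma tuples_lam_q k x i e m :
  legq (J m) k (coord (tuples_lam k (pb x i e)) m) = legq (J m) k (coord i m).
Proof.
have [->|ma] := eqVneq m a; last by rewrite tuples_lam_out.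
by rewrite tuples_lam_at q_lam.
Qed.

Lemma tuples_rho_p k x i e m :
  legp (J m) k (coord (tuples_rho k (pb i x e)) m) = legp (J m) k (coord i m).
Proof.
have [->|ma] := eqVneq m b; last by rewrite tuples_rho_out.
by rewrite tuples_rho_at p_rho.
Qed.

End TuplesFib.

(** At distinct coordinates the actions commute for trivial reasons; for [a =
b] this is the corresponding axiom of [J a]. *)
Lemma tuples_rho_lam a b fa fb k x (i : tuples J S k) y e1 e2 e3 e4 :
  @tuples_rho b fb k (pb (@tuples_lam a fa k (pb x i e1)) y e2)
  = tuples_lam fa k (pb x (tuples_rho fb k (pb i y e3)) e4).
Proof.
apply: tuples_eq => m.
have [ab|ab] := eqVneq a b.
  subst b; have [ma|ma] := eqVneq m a.
    subst m; apply: etrans (tuples_rho_at fb e2) _.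
    apply: etrans _ (esym (tuples_lam_at fa e4)).
    have e2' := etrans (f_equal (legq (J a) k) (esym (tuples_lam_at fa e1))) e2.
    have e4' := etrans e4 (f_equal (legp (J a) k) (tuples_rho_at fb e3)).
    apply: etrans (@rho_congr _ _ _ _ _ _ _ _ _ e2' (tuples_lam_at _ _) erefl)
      _.
    apply: etrans _ (@lam_congr _ _ _ _ _ _ _ _ e4' _ erefl (esym
      (tuples_rho_at _ _))).
    exact: rho_lam.
  by rewrite tuples_rho_out // tuples_lam_out // tuples_lam_out //
    tuples_rho_out.
have [ma|ma] := eqVneq m a.
  subst m; rewrite tuples_rho_out // !tuples_lam_at.
  by apply: lam_congr => //; rewrite tuples_rho_out.
have [mb|mb] := eqVneq m b.
  subst m; rewrite tuples_lam_out // !tuples_rho_at.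
  by apply: rho_congr => //; rewrite tuples_lam_out.
by rewrite tuples_rho_out // !tuples_lam_out // tuples_rho_out.
Qed.

Definition tuples_fib a b (fa : forall l, S l -> rjoin l != a)
  (fb : forall l, S l -> ljoin l != b) : two_fib (A a) (A b.+1).
Proof.
refine (@TwoFib (A a) (A b.+1) (tuples J S) (tuples_p a) (tuples_q b)
  (tuples_lam fa) (tuples_rho fb) _ _ _ _ _ _ _ _ _).
- move=> k x i e; apply: etrans (f_equal (legp (J a) k) (tuples_lam_at fa e)) _.
  exact: p_lam.
- by move=> k x i e; exact: tuples_lam_q.
- by move=> k i y e; exact: tuples_rho_p.
- move=> k i y e; apply: etrans (f_equal (legq (J b) k) (tuples_rho_at fb e)) _.
  exact: q_rho.
- move=> k x y i exy e e1 e2; apply: tuples_eq => m.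
  have [ma|ma] := eqVneq m a; last by rewrite !tuples_lam_out.
  subst m; apply: etrans (tuples_lam_at fa e1) _.
  apply: etrans _ (esym (tuples_lam_at fa e2)).
  have e2' := etrans e2 (f_equal (legp (J a) k) (tuples_lam_at fa e)).
  apply: etrans _ (@lam_congr _ _ _ _ _ _ _ _ e2' _ erefl (esym (tuples_lam_at
    _ _))).
  exact: lam_comp.
- move=> k i e; apply: tuples_eq => m.
  have [ma|ma] := eqVneq m a; last by rewrite !tuples_lam_out.
  by subst m; rewrite !tuples_lam_at; exact: lam_unit.
- move=> k i x y exy e e1 e2; apply: tuples_eq => m.
  have [mb|mb] := eqVneq m b; last by rewrite !tuples_rho_out.
  subst m; apply: etrans (tuples_rho_at fb e1) _.
  apply: etrans _ (esym (tuples_rho_at fb e2)).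
  have e2' := etrans (f_equal (legq (J b) k) (esym (tuples_rho_at fb e))) e2.
  apply: etrans _ (@rho_congr _ _ _ _ _ _ _ _ e2' _ (esym (tuples_rho_at _ _))
    erefl).
  exact: rho_comp.
- move=> k i e; apply: tuples_eq => m.
  have [mb|mb] := eqVneq m b; last by rewrite !tuples_rho_out.
  by subst m; rewrite !tuples_rho_at; exact: rho_unit.
- move=> k x i y e1 e2 e3 e4; exact: tuples_rho_lam.
Defined.
End Tuples.

(** * Iterated spans *)

Section IteratedSpans.
Variables (n : nat) (A : nat -> two_cat).
Variable J : forall m : 'I_n.+1, two_fib (A m) (A m.+1).

Lemma ord0_free (l : 'I_n) : true -> rjoin l != ord0.
Proof. by []. Qed.

Lemma ord_max_free (l : 'I_n) : true -> ljoin l != ord_max.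
Proof. by rewrite -val_eqE /= neq_ltn ltn_ord. Qed.

Definition path_fib : two_fib (A 0) (A n.+1) :=
  tuples_fib J (S := xpredT) ord0_free ord_max_free.

Lemma set_first_tlam k x (i : prod_path J k) v pf
  (e : lax_tgt (A 0) k x = legp (J ord0) k (coord i ord0)) :
  v = lam (J ord0) k (pb x (coord i ord0) e) ->
  @set_first _ _ _ k i v pf = tlam path_fib x i.
Proof.
move=> ev; rewrite -(tappE _ _ (e : lax_tgt (A 0) k x = legp path_fib k i)).
by apply: sig_eq; rewrite /= ev.
Qed.

Lemma set_last_trho k (i : prod_path J k) y v pf
  (e : legq (J ord_max) k (coord i ord_max) = lax_src (A n.+1) k y) :
  v = rho (J ord_max) k (pb (coord i ord_max) y e) ->
  @set_last _ _ _ k i v pf = trho path_fib i y.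
Proof.
move=> ev; rewrite -(tappE _ _ (e : legq path_fib k i = lax_src (A n.+1) k y)).
by apply: sig_eq; rewrite /= ev.
Qed.

Lemma set_first_lam_mor (i : prod_path J Ob) u e pf :
  set_first (i := id1 i) (v := lam_mor (J ord0) u (coord i ord0) e) pf
  = lam_lift1 (J := path_fib) u i.
Proof.
exact: (@set_first_tlam Mor (arr_to_id u) (id1 i) _ _ (lam_mor_match e)).
Qed.

Lemma set_first_lam_cel (s : prod_path J Mor) a e pf :
  set_first (i := id2 s) (v := lam_cel (J ord0) (coord s ord0) a e) pf
  = lam_lift2 (J := path_fib) s a.
Proof.
exact: (@set_first_tlam Cel (cel_from_unit a) (id2 s) _ _ (lam_cel_match e)).
Qed.

Lemma set_last_rho_mor (i : prod_path J Ob) v e pf :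
  set_last (i := id1 i) (v := rho_mor (J ord_max) (coord i ord_max) v e) pf
  = rho_lift1 (J := path_fib) i v.
Proof.
exact: (@set_last_trho Mor (id1 i) (arr_from_id v) _ _ (rho_mor_match e)).
Qed.

Lemma set_last_rho_cel (s : prod_path J Mor) b e pf :
  set_last (i := id2 s) (v := rho_cel (J ord_max) b (coord s ord_max) e) pf
  = rho_lift2 (J := path_fib) b s.
Proof.
exact: (@set_last_trho Cel (id2 s) (cel_to_unit b) _ _ (rho_cel_match e)).
Qed.

Section Split.
Variable l : 'I_n.

Lemma rjoin_free l' : predC1 l l' -> rjoin l' != rjoin l.
Proof. by rewrite /= -val_eqE /= -val_eqE /= eqSS. Qed.

Lemma ljoin_free l' : predC1 l l' -> ljoin l' != ljoin l.
Proof. by rewrite /= -val_eqE /= -val_eqE. Qed.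

Definition split_fib : two_fib (A l.+1) (A l.+1) :=
  tuples_fib J (S := predC1 l) rjoin_free ljoin_free.

Definition forget_map k (i : prod_path J k) : split_path J l k :=
  exist (fun j : forall m, J m k => forall l', predC1 l l' -> matched l' j)
    (coord i) (fun l' _ => proj2_sig i l' isT).

Definition forget : two_functor (prod_path J) split_fib.
Proof.
refine (@TwoFunctor (prod_path J) split_fib forget_map _ _ _);
  apply/sub_is_functor; split=> // y z e e';
    apply: functional_extensionality_dep => m;
  exact: ccomp_eq.
Defined.

Lemma forget_inj k : injective (forget k).
Proof. by move=> i j /(f_equal (@proj1_sig _ _)) E; apply: sig_eq. Qed.

Lemma forget_surj k (i : split_fib k) : legq split_fib k i
  = legp split_fib k i ->
  exists j, forget k j = i.
Proof.
move=> e; have h l' : true -> matched (J := J) l' (coord i).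
  by move=> _; have [->|ne] := eqVneq l' l;
    [exact: e | exact: (proj2_sig i l' ne)].
by exists (exist _ (coord i) h); apply: sig_eq.
Qed.

(** The two coordinates next to [l] are acted on simultaneously. Taking [x] or
[y] to be a unit gives the two sides of the inner equivariance axiom, and
taking cleavages gives the tuples of iem and iec. *)
Lemma forget_set_join k x (i : split_path J l k) y v w pv pw pvw
  (e1 : legq (J (ljoin l)) k (coord i (ljoin l)) = lax_src (A l.+1) k y)
  (e2 : lax_tgt (A l.+1) k x = legp (J (rjoin l)) k (coord i (rjoin l))) :
  v = rho (J (ljoin l)) k (pb (coord i (ljoin l)) y e1) ->
  w = lam (J (rjoin l)) k (pb x (coord i (rjoin l)) e2) ->
  forget k (@set_join _ _ _ l k i v w pv pw pvw) = bact (S := split_fib) x i y.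
Proof.
move=> ev ew.
have lr : rjoin l != ljoin l by rewrite -val_eqE /= neq_ltn leqnn orbT.
rewrite /bact -(tappE _ _ (e1 : legq split_fib k i = lax_src (A l.+1) k y)).
have e3 : lax_tgt (A l.+1) k x = legp split_fib k (rho split_fib k
    (pb (F := legq split_fib) (G := lax_src (A l.+1)) i y e1)).
  by rewrite p_rho.
rewrite -(tappE _ _ e3).
apply: sig_eq; apply: (@etrans _ _ (dfwith (dfwith (coord i) v) w)) => //.
rewrite ev ew /=; congr dfwith.
by apply: lam_congr => //; apply/esym/dfwith_out; rewrite eq_sym.
Qed.
Lemma forget_join_rho k (i : split_path J l k) x
  (e : legq (J (ljoin l)) k (coord i (ljoin l))
    = lax_src (A l.+1) k x) pv pw pvw :
  forget k (set_join (i := i) (v := rho (J (ljoin l)) k (pb (coord i (ljoin l))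
    x e))
    (w := coord i (rjoin l)) pv pw pvw) = trho split_fib i x.
Proof.
have u := lax_unit_tgt (legp (J (rjoin l)) k (coord i (rjoin l))).
rewrite (@forget_set_join k _ i x _ _ _ _ _ e u) // ?lam_unit //.
by rewrite /bact -[legp _ _ _](p_trho (J := split_fib) e) tlam_unit.
Qed.

Lemma forget_join_lam k (i : split_path J l k) x
  (e : lax_tgt (A l.+1) k x = legp (J (rjoin l)) k (coord i (rjoin l))) pv pw
    pvw :
  forget k (set_join (i := i) (v := coord i (ljoin l))
    (w := lam (J (rjoin l)) k (pb x (coord i (rjoin l)) e)) pv pw pvw)
      = tlam split_fib x i.
Proof.
have u := esym (lax_unit_src (legq (J (ljoin l)) k (coord i (ljoin l)))).
rewrite (@forget_set_join k x i _ _ _ _ _ _ u e) // ?rho_unit //.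
by rewrite /bact (trho_unit (J := split_fib)).
Qed.

Lemma forget_join_mor (i : split_path J l Ob) u
  (e1 : legq (J (ljoin l)) Ob (coord i (ljoin l)) = dom u)
  (e2 : cod u = legp (J (rjoin l)) Ob (coord i (rjoin l))) pv pw pvw :
  forget Mor (set_join (i := id1 i)
    (v := rho_mor (J (ljoin l)) (coord i (ljoin l)) u e1)
    (w := lam_mor (J (rjoin l)) u (coord i (rjoin l)) e2) pv pw pvw)
  = junction1 (S := split_fib) u i.
Proof.
exact: (@forget_set_join Mor (arr_to_id u) (id1 i) (arr_from_id u) _ _ _ _ _
  (rho_mor_match e1) (lam_mor_match e2)).
Qed.

Lemma forget_join_cel (s : split_path J l Mor) a
  (e1 : legq (J (ljoin l)) Mor (coord s (ljoin l)) = tgt2 a)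
  (e2 : src2 a = legp (J (rjoin l)) Mor (coord s (rjoin l))) pv pw pvw :
  forget Cel (set_join (i := id2 s)
    (v := rho_cel (J (ljoin l)) a (coord s (ljoin l)) e1)
    (w := lam_cel (J (rjoin l)) (coord s (rjoin l)) a e2) pv pw pvw)
  = junction2 (S := split_fib) a s.
Proof.
exact: (@forget_set_join Cel (cel_from_unit a) (id2 s) (cel_to_unit a) _ _ _ _ _
  (rho_cel_match e1) (lam_cel_match e2)).
Qed.
End Split.

Section Cells.
Variables (C D : two_cat) (K : two_fib C D).
Variables (f : two_functor (A 0) C) (g : two_functor (A n.+1) D).
Variable phi : functor_over J K f g.

Lemma equivariant_leftP : equivariant_left phi <-> pcm phi /\ poc phi.
Proof.
pose F : two_functor path_fib K := phi.
have over k (i : path_fib k) : legp K k (F k i) = f k (legp path_fib k i).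
  exact: over_p.
have -> : equivariant_left phi <-> left_equivariant F f.
  split=> H k x i e; have := H k x i e;
    by rewrite (@set_first_tlam k x i _ _ e) // tlamE.
rewrite (left_equivariantP over).
have -> : pcm phi <-> preserves_lam_lift1 F f.
  split=> [H u i e|H i u e]; first have := H i u e; last have := H u i e;
    by rewrite set_first_lam_mor lam_morE.
have -> // : poc phi <-> preserves_lam_lift2 F f.
split=> H s a e; have := H s a e; by rewrite set_first_lam_cel lam_celE.
Qed.

Lemma equivariant_rightP : equivariant_right phi <-> pom phi /\ pcc phi.
Proof.
pose F : two_functor path_fib K := phi.
have over k (i : path_fib k) : legq K k (F k i) = g k (legq path_fib k i).
  exact: over_q.
have -> : equivariant_right phi <-> right_equivariant F g.
  split=> H k i y e; have := H k i y e;
    by rewrite (@set_last_trho k i y _ _ e) // trhoE.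
rewrite (right_equivariantP over).
have -> : pom phi <-> preserves_rho_lift1 F g.
  split=> H i v e; have := H i v e; by rewrite set_last_rho_mor rho_morE.
have -> // : pcc phi <-> preserves_rho_lift2 F g.
split=> H s b e; have := H s b e; by rewrite set_last_rho_cel rho_celE.
Qed.

Lemma equivariant_innerP : equivariant_inner phi <-> iem phi /\ iec phi.
Proof.
have -> : equivariant_inner phi <-> forall l, balanced (@forget l) phi.
  split=> [H l k x i r w e1 e2 er ew|H l k i x e1 e2].
    apply: etrans (etrans (f_equal (phi k) _) (H l k i x e1 e2)) (f_equal (phi
      k) _);
      apply: (@forget_inj l).
    + by rewrite er; apply/esym/forget_join_rho.
    + by rewrite ew; apply/forget_join_lam.
  apply: (H l k x i) => //; [exact: forget_join_rho | exact: forget_join_lam].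
have B l := balancedP phi (@forget_inj l) (@forget_surj l).
have -> : iem phi <-> forall l, collapses_junction1 (@forget l) phi.
  split=> [H l u i w e1 e2 ew|H l i u e1 e2].
    have [c E] := H l i u e1 e2; exists c; rewrite -E; congr (phi Mor _).
    by apply: (@forget_inj l); rewrite ew; apply/esym/forget_join_mor.
  by apply: (H l u i) => //; exact: forget_join_mor.
have -> : iec phi <-> forall l, collapses_junction2 (@forget l) phi.
  split=> [H l a s w e1 e2 ew|H l s a e1 e2].
    have [c E] := H l s a e1 e2; exists c; rewrite -E; congr (phi Cel _).
    by apply: (@forget_inj l); rewrite ew; apply/esym/forget_join_cel.
  by apply: (H l a s) => //; exact: forget_join_cel.
split=> [H|[H1 H2] l]; last exact/B.
by split=> l; have /B[] := H l.
Qed.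
End Cells.
End IteratedSpans.

Theorem theorem6p5 (n : nat) (A : nat -> two_cat)
  (J : forall m : 'I_n.+1, two_fib (A m) (A m.+1))
  (C D : two_cat) (K : two_fib C D)
  (f : two_functor (A 0) C) (g : two_functor (A n.+1) D)
  (phi : functor_over J K f g) :
  is_unary_cell phi <->
  pcm phi /\ poc phi /\ iem phi /\ iec phi /\ pom phi /\ pcc phi.
Proof.
have L := equivariant_leftP phi; have R := equivariant_rightP phi.
have I := equivariant_innerP phi.
split=> [[/L[? ?] /R[? ?] /I[? ?]]|[? [? [? [? [? ?]]]]]]; first by do !split.
by split; [apply/L | apply/R | apply/I].
Qed.
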